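(* Let $d\ge1$, $m\ge0$ be integers and let $\mathbf{a}:\mathbb{R}\times\mathbb{R}\times\mathbb{R}^d\to\mathbb{R}^d$ and $\mathbf{b}:\mathbb{R}\times\mathbb{R}^d\to\mathbb{R}^d$ satisfy: $\mathbf{a}\in(C_b^{m+1}(\mathbb{R}\times\mathbb{R}\times\mathbb{R}^d))^d$; $\theta\mapsto\mathbf{a}(t,\theta,\mathbf{x})$ is $2\pi$-periodic for every $t\in\mathbb{R}$, $\mathbf{x}\in\mathbb{R}^d$; $\mathbf{b}\in(C_b^{m+2}(\mathbb{R}\times\mathbb{R}^d))^d$. Suppose that the solution $\mathbf{Z}(t,\theta;\mathbf{z})$ of $\frac{\partial\mathbf{Z}}{\partial\theta}=\mathbf{b}(t,\mathbf{Z})$, $\mathbf{Z}(t,0;\mathbf{z})=\mathbf{z}$, is $2\pi$-periodic in $\theta$ for every $t\in\mathbb{R}$, $\mathbf{z}\in\mathbb{R}^d$. Let $\tilde\alpha^k$, $\tilde{\mathbf{a}}^k$, $\tilde{\mathbf{A}}^k$ be the functions defined recursively in the context. For $\mathbf{x}\in\mathbb{R}^d$, $s\in\mathbb{R}$, $T>0$, let $\mathbf{Y}_\varepsilon=\mathbf{Y}_\varepsilon(t;\mathbf{x},s)$ be the solution of $$\frac{d\mathbf{Y}_\varepsilon}{dt}=\tilde\alpha^0\Big(t,\frac{t-s}\varepsilon,\mathbf{Y}_\varepsilon\Big),\qquad \mathbf{Y}_\varepsilon(s;\mathbf{x},s)=\mathbf{x},$$ let $\mathbf{Y}^0$ be the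 solution of $\frac{d\mathbf{Y}^0}{dt}=\tilde{\mathbf{a}}^0(t,\mathbf{Y}^0)$, $\mathbf{Y}^0(s;\mathbf{x},s)=\mathbf{x}$, and for $k=1,\dots,m$ let $\mathbf{Y}^k$ be the solution of $$\frac{d\mathbf{Y}^k}{dt}=\tilde{\mathbf{a}}^k(t,\mathbf{Y}^0,\dots,\mathbf{Y}^k),\qquad \mathbf{Y}^k(s;\mathbf{x},s)=0.$$ Define $\mathbf{Y}^0_\varepsilon=\mathbf{Y}_\varepsilon$ and, for $1\le k\le m$, $$\mathbf{Y}^k_\varepsilon(t;\mathbf{x},s)=\frac1\varepsilon\big(\mathbf{Y}^{k-1}_\varepsilon(t;\mathbf{x},s)-\mathbf{Y}^{k-1}(t;\mathbf{x},s)\big)-\big[\theta\tilde{\mathbf{A}}^{k-1}(t,\theta,\mathbf{Y}^0(t;\mathbf{x},s),\dots,\mathbf{Y}^{k-1}(t;\mathbf{x},s))\big]_{\theta=(t-s)/\varepsilon}.$$ Then, for any $\mathbf{x}\in\mathbb{R}^d$, $s\in\mathbb{R}$ and $T>0$, the families $(\mathbf{Y}^k_\varepsilon(\cdot;\mathbf{x},s))_{\varepsilon>0}$, for $k=0,\dots,m$, are bounded in $L^\infty([s,s+T])$, and $$\lim_{\varepsilon\to0}\sup_{t\in[s,s+T]}|\mathbf{Y}_\varepsilon(t;\mathbf{x},s)-\mathbf{Y}^0(t;\mathbf{x},s)|=0,\qquad \lim_{\varepsilon\to0}\sup_{t\in[s,s+T]}|\mathbf{Y}^k_\varepsilon(t;\mathbf{x},s)-\mathbf{Y}^k(t;\mathbf{x},s)|=0\quad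 (k=1,\dots,m).$$
   Context: $C_b^{m}$: functions having continuous and bounded derivatives up to order $m$ (order $0$ included). $|\cdot|$: Euclidean norm. $\nabla_z\mathbf{Z}$: Jacobian matrix of $\mathbf{z}\mapsto\mathbf{Z}(t,\theta;\mathbf{z})$. For a vector field $F$ of a variable $\mathbf{y}\in\mathbb{R}^d$ and $p\ge1$, $\{\nabla_y^{\,p}F\}\{\mathbf{h}^1,\dots,\mathbf{h}^p\}$ is the vector with $i$-th component $\sum_{l_1,\dots,l_p=1}^d\frac{\partial^pF_i}{\partial y_{l_1}\cdots\partial y_{l_p}}h^1_{l_1}\cdots h^p_{l_p}$. Definition of $\tilde\alpha^k,\tilde{\mathbf{a}}^k,\tilde{\mathbf{A}}^k$ (with $t,\theta\in\mathbb{R}$, $\mathbf{y}^0,\dots,\mathbf{y}^k\in\mathbb{R}^d$). For $k=0$: $$\tilde\alpha^0(t,\theta,\mathbf{y}^0)=\{\nabla_z\mathbf{Z}(t,\theta;\mathbf{y}^0)\}^{-1}\Big\{\mathbf{a}(t,\theta,\mathbf{Z}(t,\theta;\mathbf{y}^0))-\frac{\partial\mathbf{Z}}{\partial t}(t,\theta;\mathbf{y}^0)\Big\}.$$ For all $k\ge0$: $$\tilde{\mathbf{a}}^k(t,\mathbf{y}^0,\dots,\mathbf{y}^k)=\frac1{2\pi}\int_0^{2\pi}\tilde\alpha^k(t,\theta,\mathbf{y}^0,\dots,\mathbf{y}^k)\,d\theta,\qquad \tilde{\mathbf{A}}^k(t,\theta,\mathbf{y}^0,\dots,\mathbf{y}^k)=\frac1\theta\int_0^\theta\tilde\alpha^k(t,\sigma,\mathbf{y}^0,\dots,\mathbf{y}^k)\,d\sigma-\tilde{\mathbf{a}}^k(t,\mathbf{y}^0,\dots,\mathbf{y}^k),$$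 so that $\theta\tilde{\mathbf{A}}^k=\int_0^\theta\tilde\alpha^k\,d\sigma-\theta\tilde{\mathbf{a}}^k$ (also at $\theta=0$, where it is $0$). For $k\ge1$, writing $\mathbf{h}^j=\mathbf{y}^j+\theta\tilde{\mathbf{A}}^{j-1}(t,\theta,\mathbf{y}^0,\dots,\mathbf{y}^{j-1})$ for $j\ge1$, $$\tilde\alpha^k(t,\theta,\mathbf{y}^0,\dots,\mathbf{y}^k)=\sum_{p=1}^k\frac1{p!}\sum_{\substack{j_1,\dots,j_p\ge1\\ j_1+\dots+j_p=k}}\{\nabla_{y^0}^{\,p}\tilde\alpha^0(t,\theta,\mathbf{y}^0)\}\{\mathbf{h}^{j_1},\dots,\mathbf{h}^{j_p}\}$$ $$\qquad-\theta\Big(\sum_{j=0}^{k-1}\{\nabla_{y^j}\tilde{\mathbf{A}}^{k-1}(t,\theta,\mathbf{y}^0,\dots,\mathbf{y}^{k-1})\}\{\tilde{\mathbf{a}}^j(t,\mathbf{y}^0,\dots,\mathbf{y}^j)\}+\frac{\partial\tilde{\mathbf{A}}^{k-1}}{\partial t}(t,\theta,\mathbf{y}^0,\dots,\mathbf{y}^{k-1})\Big).$$ *)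

(* Defs.v *)
From HB Require Import structures.
From mathcomp Require Import all_boot all_order all_algebra.
From mathcomp Require Import all_classical all_reals all_analysis.

Set Implicit Arguments.
Unset Strict Implicit.
Unset Printing Implicit Defensive.
Import Order.TTheory GRing.Theory Num.Theory.
Import numFieldNormedType.Exports.

Local Open Scope classical_set_scope.
Local Open Scope ring_scope.

(* Vectors of R^d are row vectors, so a d x d matrix acts by right
   multiplication and the library's Jacobian ['J f p] is the transpose of the
   usual one. The norm [`|_|] on 'rV[R]_d is the max norm, whence [enorm]. *)
Definition enorm (R : realType) (d : nat) (v : 'rV[R]_d) : R :=
  Num.sqrt (\sum_(i < d) v 0 i ^+ 2).

Section Cb.
Context {R : realType}.

(* f has continuous bounded partial derivatives up to order n, the partial
   derivatives being taken along the vectors of the list e. *)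
Fixpoint Cb (E : normedModType R) (e : seq E) (n : nat) (f : E -> R) : Prop :=
  [/\ continuous f, exists M : R, forall x, `|f x| <= M &
      if n is n'.+1 then
        forall v, v \in e -> (forall x, derivable f x v) /\ Cb e n' ('D_v f)
      else True].

Definition coord_dirs (d : nat) : seq 'rV[R]_d :=
  [seq delta_mx 0 i | i <- enum 'I_d].

Definition coord_dirs_tx (d : nat) : seq (R * 'rV[R]_d)%type :=
  (1, 0) :: [seq (0, v) | v <- coord_dirs d].

Definition coord_dirs_tthx (d : nat) : seq (R * R * 'rV[R]_d)%type :=
  [:: (1, 0, 0), (0, 1, 0) & [seq (0, 0, v) | v <- coord_dirs d]].

End Cb.

Section TwoScale.
Context {R : realType} {d : nat}.
Notation V := 'rV[R]_d.

(* Componentwise integral, oriented: \int_u^v = - \int_v^u when v < u. *)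
Definition vint (u v : R) (F : R -> V) : V :=
  \row_i (if u <= v then \int[lebesgue_measure]_(s in `[u, v]) F s 0 i
          else - \int[lebesgue_measure]_(s in `[v, u]) F s 0 i).

Definition partial (l : seq 'I_d) (f : V -> R) : V -> R :=
  foldr (fun j g => 'D_(delta_mx 0 j) g) f l.

(* {nabla^p F (y)}{h_0, ..., h_{p-1}} *)
Definition nablap (p : nat) (F : V -> V) (y : V) (h : 'I_p -> V) : V :=
  \row_i \sum_(l : {ffun 'I_p -> 'I_d})
    partial (codom l) (fun z => F z 0 i) y * \prod_(q < p) h q 0 (l q).

(* A function of (t, theta, y^0, ..., y^k) is represented as a function of the
   whole sequence y; see [alphat_local]. *)
Definition profile : Type := R -> R -> (nat -> V) -> V.

Definition mean (al : profile) (t : R) (y : nat -> V) : V :=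
  (2 * pi)^-1 *: vint 0 (2 * pi) (fun th => al t th y).

(* At th = 0 the factor th^-1 is 0; only th *: osc al t th y is ever used,
   and it vanishes there. *)
Definition osc (al : profile) (t th : R) (y : nat -> V) : V :=
  th^-1 *: vint 0 th (fun sg => al t sg y) - mean al t y.

Section Recursion.
Variables (a : R -> R -> V -> V) (Z : R -> R -> V -> V).

Definition alpha0 (t th : R) (y0 : V) : V :=
  (a t th (Z t th y0) - derive1 (fun t' => Z t' th y0) t)
    *m invmx ('J (Z t th) y0).

(* The two terms of the recursion for k >= 1, given the profiles of index < k. *)
Definition taylor_term (al : nat -> profile) (k : nat) : profile :=
  fun t th y =>
  let h j := y j + th *: osc (al j.-1) t th y in
  \sum_(1 <= p < k.+1) (p`!%:R)^-1 *:
    (\sum_(j : {ffun 'I_p -> 'I_k.+1} |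
           [forall q, (0 < j q)%N] && (\sum_(q < p) j q == k)%N)
        nablap (alpha0 t th) (y 0%N) (fun q => h (j q))).

Definition transport_term (al : nat -> profile) (k : nat) : profile :=
  fun t th y =>
  \sum_(j < k)
     nablap (fun u => osc (al k.-1) t th [eta y with (j : nat) |-> u])
            (y j) (fun _ : 'I_1 => mean (al j) t y)
  + derive1 (fun t' => osc (al k.-1) t' th y) t.

Definition alpha_next (al : nat -> profile) (k : nat) : profile :=
  fun t th y => taylor_term al k t th y - th *: transport_term al k t th y.

Fixpoint alpha_upto (k : nat) : nat -> profile :=
  if k is k'.+1 then
    fun i => if (i <= k')%N then alpha_upto k' i
             else alpha_next (alpha_upto k') k
  else fun _ t th y => alpha0 t th (y 0%N).

Definition alphat (k : nat) : profile := alpha_upto k k.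
Definition at_ (k : nat) : R -> (nat -> V) -> V := mean (alphat k).
Definition At_ (k : nat) : profile := osc (alphat k).

Lemma alpha_next_ext (al al' : nat -> profile) (k : nat) t th y y' :
  (0 < k)%N -> (forall i, (i <= k)%N -> y i = y' i) ->
  (forall i t th z z', (i < k)%N -> (forall j, (j <= i)%N -> z j = z' j) ->
     al i t th z = al' i t th z') ->
  alpha_next al k t th y = alpha_next al' k t th y'.
Proof.
move=> k0 eqy eqal.
have meanE i t1 z z' : (i < k)%N -> (forall j, (j <= i)%N -> z j = z' j) ->
    mean (al i) t1 z = mean (al' i) t1 z'.
  move=> ik eqz; rewrite /mean.
  suff -> : (fun th1 => al i t1 th1 z) = (fun th1 => al' i t1 th1 z') by [].
  by apply/funext => ?; exact: eqal.
have oscE i t1 th1 z z' : (i < k)%N -> (forall j, (j <= i)%N -> z j = z' j) ->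
    osc (al i) t1 th1 z = osc (al' i) t1 th1 z'.
  move=> ik eqz; rewrite /osc (meanE i _ z z' ik eqz).
  suff -> : (fun sg => al i t1 sg z) = (fun sg => al' i t1 sg z') by [].
  by apply/funext => ?; exact: eqal.
have k1 : (k.-1 < k)%N by rewrite ltn_predL.
have le1 i : (i <= k.-1)%N -> (i <= k)%N.
  by move/leq_trans; apply; rewrite leq_pred.
have taylorE : taylor_term al k t th y = taylor_term al' k t th y'.
  rewrite /taylor_term; apply: eq_bigr => p _.
  apply: (congr1 (fun v : V => (p`!%:R)^-1 *: v)).
  apply: eq_bigr => j.
  case/andP.
  move/forallP => j0 _.
  rewrite (eqy 0%N (leq0n k)).
  apply: (congr1 (nablap (alpha0 t th) (y' 0%N))).
  apply/funext => q.
  have jk : (j q <= k)%N by rewrite -ltnS.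
  have jk1 : ((j q).-1 < k)%N by rewrite prednK.
  rewrite (eqy _ jk) (oscE _ t th y y' jk1); first by [].
  by move=> i ij; apply: eqy; exact: leq_trans ij (ltnW jk1).
have dE : derive1 (fun t' => osc (al k.-1) t' th y) t =
          derive1 (fun t' => osc (al' k.-1) t' th y') t.
  apply: (congr1 (fun f => derive1 f t)); apply/funext => t'.
  by apply: oscE k1 _ => i ik; exact/eqy/le1.
have nablaE (j : 'I_k) :
    nablap (fun u => osc (al k.-1) t th [eta y with (j : nat) |-> u])
      (y j) (fun _ : 'I_1 => mean (al j) t y) =
    nablap (fun u => osc (al' k.-1) t th [eta y' with (j : nat) |-> u])
      (y' j) (fun _ : 'I_1 => mean (al' j) t y').
  have jk : (j <= k)%N by exact: ltnW.
  rewrite (eqy j jk) (meanE j t y y' (ltn_ord j)); last first.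
    by move=> i ij; apply: eqy; exact: leq_trans ij jk.
  apply: (congr1 (fun F => nablap F (y' j) (fun=> mean (al' j) t y'))).
  apply/funext => u; apply: oscE k1 _ => i ik /=.
  by case: ifP => _; [reflexivity | exact: eqy (le1 _ ik)].
have transportE : transport_term al k t th y = transport_term al' k t th y'.
  exact: congr2 (eq_bigr _ (fun j _ => nablaE j)) dE.
by rewrite /alpha_next taylorE transportE.
Qed.

Lemma alpha_uptoE k i : (i <= k)%N -> alpha_upto k i = alphat i.
Proof.
elim: k => [|k IH]; first by rewrite leqn0 => /eqP ->.
rewrite leq_eqVlt => /predU1P[-> //|]; rewrite ltnS => ik /=.
by rewrite ik IH.
Qed.

Lemma alphat0E t th y : alphat 0 t th y = alpha0 t th (y 0%N).
Proof. by []. Qed.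

Lemma alphat_local k t th (y y' : nat -> V) :
  (forall i, (i <= k)%N -> y i = y' i) -> alphat k t th y = alphat k t th y'.
Proof.
elim/ltn_ind: k t th y y' => -[_ t th y y' eqy|k IH t th y y' eqy].
  by rewrite !alphat0E eqy.
rewrite /alphat /= ltnn; apply: alpha_next_ext => // i t1 th1 z z'.
by rewrite ltnS => ik eqz; rewrite !alpha_uptoE//; exact: IH.
Qed.

Lemma alphatE k t th y : (0 < k)%N ->
  alphat k t th y = alpha_next alphat k t th y.
Proof.
case: k => // k _; rewrite {1}/alphat /= ltnn.
apply: alpha_next_ext => // i t1 th1 z z'.
by rewrite ltnS => ik eqz; rewrite alpha_uptoE//; exact: alphat_local.
Qed.

(* The corrected differences Y^k_eps(t), for Y0e the exact solution at eps. *)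
Fixpoint Yk_eps (s : R) (Y : nat -> R -> V) (Y0e : R -> V) (eps : R) (k : nat)
    (t : R) : V :=
  if k is k'.+1 then
    eps^-1 *: (Yk_eps s Y Y0e eps k' t - Y k' t)
    - ((t - s) / eps) *: At_ k' t ((t - s) / eps) (fun j => Y j t)
  else Y0e t.

End Recursion.

(* Y solves dY/dt = rhs on [s, s + T] with Y(s) = x; the values of Y outside
   [s, s + T] are irrelevant. *)
Definition solves_on (s T : R) (x : V) (Y : R -> V) (rhs : R -> V) : Prop :=
  [/\ Y s = x, {within `[s, s + T], continuous Y} &
      forall t, t \in `]s, s + T[ -> is_derive t 1 Y (rhs t)].

Definition bounded_Linfty (D : set R) (F : R -> R -> V) : Prop :=
  exists M : R, forall eps : R, 0 < eps ->
    (forall i, measurable_fun D (fun t => F eps t 0 i)) /\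
    ('N[lebesgue_measure]_+oo
        [(fun t => (enorm (F eps t))%:E) \_ D] <= M%:E)%E.

(* sup_{t in D} |F_eps(t) - G(t)| -> 0 as eps -> 0, eps > 0. *)
Definition cvg_unif_eps (D : set R) (F : R -> R -> V) (G : R -> V) : Prop :=
  ereal_sup [set (enorm (F eps t - G t))%:E | t in D] @[eps --> 0^'+]
    --> 0%:E.

End TwoScale.

(* Main.v *)
Require Import Defs.
From HB Require Import structures.
From mathcomp Require Import all_boot all_order all_algebra.
From mathcomp Require Import all_classical all_reals all_analysis.
From mathcomp Require Import ring lra.

Set Implicit Arguments.
Unset Strict Implicit.
Unset Printing Implicit Defensive.
Import Order.TTheory GRing.Theory Num.Theory.
Import numFieldNormedType.Exports.

Local Open Scope classical_set_scope.
Local Open Scope ring_scope.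

(* The recursion makes each Y^k_eps a rescaled remainder: with
   W_k = sum_{j<k} eps^j (Y^j + eps theta A^j) evaluated at theta = (t - s)/eps,
   one has Y^k_eps = eps^-k (Y_eps - W_k). By the chain rule the derivative of
   Y^j + eps theta A^j is alpha^j + eps * transport^(j+1), where transport^(j+1)
   is the second part of the definition of alpha^(j+1); hence W_(m+1)' telescopes
   to alpha^0 + sum_{1<=k<=m} eps^k taylor^k + eps^(m+1) transport^(m+1). This is
   the Taylor expansion, sorted by powers of eps, of alpha^0(t, theta, W_(m+1)) up
   to O(eps^(m+1)), uniformly in theta because everything is periodic. Gronwall's
   lemma gives Y_eps - W_(m+1) = O(eps^(m+1)), and descending induction on k gives
   Y^k_eps - Y^k = eps (Y^(k+1)_eps + theta A^k) = O(eps). For eps bounded below,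
   Y_eps is bounded because alpha^0 is.

   The regularity of alpha^0 comes from that of flows: the inverse Jacobian of
   z |-> Z(t, theta; z) is the Jacobian of z |-> Z(t, -theta; z), and Z is the flow
   of (t, z) |-> (0, b(t, z)), which is C^n when b is, by passing to the tangent
   flow. *)

(** The count of derivatives is exact. One derivative of Z, which is C^(m+2), enters alpha^0, so
    alpha^0 is C^(m+1); each step of the recursion costs one more, so alpha^k is C^(m+1-k). The last
    profile alpha^m is still C^1, which is what the chain rule for theta A^m requires. Hence
    W_(m+1), one order beyond the claim, can be differentiated, and the convergence comes with the
    rate O(eps).

    The derivatives of alpha^0 are controlled on bounded sets of y only. Gronwall's lemma therefore
    has a bootstrap form: the differential inequality is assumed while the error stays below a
    threshold, and the conclusion keeps the error under it. The same form serves flows of locally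
    Lipschitz fields.

    The linearised flow is not constructed by solving an equation. It is the limit of difference
    quotients, which are Cauchy by Gronwall and converge because closed balls are compact;
    uniqueness then makes it linear in the direction.

    The object handled throughout is theta A^k, smooth and periodic in theta, rather than the
    quotient A^k. *)

(* Identities of linear combinations in an abstract module are decided by
   comparing the coefficient of each atom with [ring], which does not know [*:]. *)
Section LmodIdentity.
Context {R : comPzRingType} {V : lmodType R}.

Inductive lexp := LVar of nat | LAdd of lexp & lexp | LOpp of lexp | LZero
  | LScale of R & lexp.

Fixpoint leval (s : seq V) (e : lexp) : V :=
  match e with
  | LVar i => nth 0 s i
  | LAdd e1 e2 => leval s e1 + leval s e2
  | LOpp e1 => - leval s e1
  | LZero => 0
  | LScale k e1 => k *: leval s e1
  end.

Fixpoint lcoef (e : lexp) (i : nat) : R :=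
  match e with
  | LVar j => if Nat.eqb i j then 1 else 0
  | LAdd e1 e2 => lcoef e1 i + lcoef e2 i
  | LOpp e1 => - lcoef e1 i
  | LZero => 0
  | LScale k e1 => k * lcoef e1 i
  end.

Fixpoint lcoef_eq (e1 e2 : lexp) (n : nat) : Prop :=
  if n is n'.+1 then lcoef e1 n' = lcoef e2 n' /\ lcoef_eq e1 e2 n' else True.

Lemma leval_coef s e : leval s e = \sum_(i < size s) lcoef e i *: nth 0 s i.
Proof.
elim: e => [j|e1 IH1 e2 IH2|e1 IH1||k e1 IH1] /=; rewrite ?IH1 ?IH2.
- have [js|sj] := ltnP j (size s).
    rewrite (bigD1 (Ordinal js))//=; case: PeanoNat.Nat.eqb_spec => // _;
      rewrite scale1r big1 ?addr0// => i ij.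
    case: PeanoNat.Nat.eqb_spec => [E|_]; last by rewrite scale0r.
    by case/eqP: ij; apply/val_inj.
  rewrite nth_default// big1// => i _.
  case: PeanoNat.Nat.eqb_spec => [E|_]; last by rewrite scale0r.
  by have := ltn_ord i; rewrite E ltnNge sj.
- by rewrite -big_split; apply: eq_bigr => i _; rewrite scalerDl.
- by rewrite -sumrN; apply: eq_bigr => i _; rewrite scaleNr.
- by rewrite big1// => i _; rewrite scale0r.
- by rewrite scaler_sumr; apply: eq_bigr => i _; rewrite scalerA.
Qed.

Lemma leval_eq s e1 e2 : lcoef_eq e1 e2 (size s) -> leval s e1 = leval s e2.
Proof.
rewrite !leval_coef => H; apply: eq_bigr => i _; congr (_ *: _).
elim: (size s) H i => [_ []//|n IH /= [E H] i].
have [->//|ni] := eqVneq (i : nat) n.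
have iN : (i < n)%N by rewrite ltn_neqAle ni -ltnS ltn_ord.
exact: (IH H (Ordinal iN)).
Qed.

End LmodIdentity.

(** Atoms are identified up to unification, not syntactically. The inner [match goal] makes [unify]
    run while a term is being computed, so that its failure moves the search to the next atom. *)
Ltac lmod_pos x l :=
  match l with
  | ?y :: _ => let _ := match goal with _ => unify x y end in constr:(O)
  | _ :: ?t => let n := lmod_pos x t in constr:(S n)
  end.
Ltac lmod_add x l :=
  match goal with
  | _ => let _ := lmod_pos x l in l
  | _ => constr:(x :: l)
  end.
Ltac lmod_atoms l e :=
  lazymatch e with
  | (?a + ?b)%R => let l' := lmod_atoms l a in lmod_atoms l' b
  | (- ?a)%R => lmod_atoms l a
  | (0)%R => l
  | (_ *: ?a)%R => lmod_atoms l a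
  | _ => lmod_add e l
  end.
Ltac lmod_reify R l e :=
  lazymatch e with
  | (?a + ?b)%R => let x := lmod_reify R l a in
                   let y := lmod_reify R l b in constr:(@LAdd R x y)
  | (- ?a)%R => let x := lmod_reify R l a in constr:(@LOpp R x)
  | (0)%R => constr:(@LZero R)
  | (?k *: ?a)%R => let x := lmod_reify R l a in constr:(@LScale R k x)
  | _ => let n := lmod_pos e l in constr:(@LVar R n)
  end.
Ltac lmod_with R V :=
  lazymatch goal with
  | |- ?x = ?y =>
    let l0 := constr:(@nil V) in
    let l1 := lmod_atoms l0 x in
    let l := lmod_atoms l1 y in
    let ex := lmod_reify R l x in
    let ey := lmod_reify R l y in
    apply: (@leval_eq R V l ex ey);
    cbv [lcoef_eq lcoef size Nat.eqb]; repeat (split; first ring); try exact I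
  end.

Ltac lmod R :=
  lazymatch goal with
  | |- ?x = ?y =>
    let T := type of x in
    let l0 := constr:(@nil T) in
    let l1 := lmod_atoms l0 x in
    let l := lmod_atoms l1 y in
    let ex := lmod_reify R l x in
    let ey := lmod_reify R l y in
    apply: (@leval_eq R _ l ex ey);
    cbv [lcoef_eq lcoef size Nat.eqb]; repeat (split; first ring); try exact I
  end.

(** * Maps of class C^n between normed spaces *)

Section Cn.
Context {R : realType}.

Lemma cont_epsP (E F : normedModType R) (f : E -> F) (x : E) :
  {for x, continuous f} <->
  forall e : R, 0 < e -> exists2 d : R, 0 < d &
    forall h, `|h| < d -> `|f (x + h) - f x| <= e.
Proof.
split=> [cf e e0|H].
  move/cvgrPdist_le: cf => /(_ e e0).
  move=> /(iffLR (nbhs0P _ _)) /nbhs_norm0P [d /= d0 H]; exists d => // h hd.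
  by rewrite distrC; exact: (H h).
apply/cvgrPdist_le => e e0; have [d d0 Hd] := H e e0.
by apply/nbhs0P/nbhs_norm0P; exists d => //= h hd; rewrite distrC; exact: Hd.
Qed.

Lemma diff_eps (E F : normedModType R) (f : E -> F) (x : E) :
  differentiable f x -> forall e : R, 0 < e -> exists2 d : R, 0 < d &
    forall h, `|h| < d -> `|f (x + h) - f x - 'd f x h| <= e * `|h|.
Proof.
move=> /diff_locally /eqaddoP H e e0; have /nbhs_norm0P[d /= d0 Hd] := H e e0.
exists d => // h hd; have := Hd h hd.
by rewrite /= !fctE/= opprD addrA [h + x]addrC.
Qed.

(** The candidate differential is a bare function, packed into a linear map only here, so that
    explicit formulas can serve as differentials without an instance being declared for each. *)
Lemma is_diff_eps (E F : normedModType R) (f : E -> F) (x : E) (L : E -> F) :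
  linear L -> continuous L ->
  (forall e : R, 0 < e -> exists2 d : R, 0 < d &
    forall h, `|h| < d -> `|f (x + h) - f x - L h| <= e * `|h|) ->
  is_diff x f L.
Proof.
move=> linL cL H.
pose LM := GRing.isLinear.Build _ _ _ _ _ linL.
pose L' : {linear _ -> _} := HB.pack L LM.
have LE : L = L' by [].
have HL : f \o shift x = cst (f x) + L' +o_ 0 id.
  apply/eqaddoP => e e0; have [d d0 Hd] := H e e0.
  apply/nbhs_norm0P; exists d => //= h hd.
  by rewrite !fctE/= opprD addrA [h + x]addrC; exact: Hd.
have dL : 'd f x = L' :> (E -> F) by apply: diff_unique HL; rewrite -LE.
by split=> //; apply/diff_locallyP; rewrite dL; split.
Qed.

Lemma is_derive_epsP (E : normedModType R) (u : R -> E) (t : R) (du : E) :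
  is_derive t 1 u du <->
  forall e : R, 0 < e -> exists2 d : R, 0 < d &
    forall h, `|h| < d -> `|u (t + h) - u t - h *: du| <= e * `|h|.
Proof.
split=> [Hu e e0|H].
  have /derivable1_diffP dfu : derivable u t 1 by [].
  have [d d0 Hd] := diff_eps dfu e0; exists d => // h hd.
  have := Hd h hd; rewrite diff1E// derive1E.
  by have -> : 'D_1 u t = du by exact: derive_val.
have [dfu vdu] : is_diff t u (fun h : R => h *: du).
  apply: is_diff_eps => //; first by move=> k x y; rewrite scalerDl scalerA.
  by move=> k; apply: cvgZr_tmp; exact: cvg_id.
split; first exact/derivable1_diffP.
by rewrite deriveE// vdu scale1r.
Qed.

Lemma is_derive_cont (E : normedModType R) (u : R -> E) (t : R) (du : E) :
  is_derive t 1 u du -> {for t, continuous u}.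
Proof.
by move=> [du_ _]; apply: differentiable_continuous; apply/derivable1_diffP.
Qed.

(** Only the fibre component of the usual tangent map; the base point [f x] is paired back where
    maps are composed. *)
Definition tangent (E F : normedModType R) (f : E -> F) : E * E -> F :=
  fun p => 'd f (p.1) (p.2).

(* C^n without coordinates: a partial derivative is a slice of the iterated
   tangent map, and closure under composition is the functoriality of [tangent]. *)
Fixpoint Cn (n : nat) (E F : normedModType R) (f : E -> F) : Prop :=
  if n is n'.+1 then (forall x, differentiable f x) /\ Cn n' (tangent f)
  else continuous f.

Lemma CnS n (E F : normedModType R) (f : E -> F) : Cn n.+1 f -> Cn n f.
Proof.
elim: n E F f => [|n IH] E F f [df Tf].
  by move=> x; exact/differentiable_continuous.
by split => //; exact: IH.
Qed.

Lemma Cn_le k n (E F : normedModType R) (f : E -> F) : (k <= n)%N -> Cn n f -> Cn k f.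
Proof.
move=> /subnK <-; elim: (n - k)%N => [//|i IH]; rewrite addSn => /CnS; exact: IH.
Qed.

Lemma Cn_cont n (E F : normedModType R) (f : E -> F) : Cn n f -> continuous f.
Proof. exact: (@Cn_le 0). Qed.

Lemma Cn_lin n (E F : normedModType R) (f : {linear E -> F}) : continuous f -> Cn n f.
Proof.
elim: n E F f => [//|n IH] E F f cf; split => [x|]; first exact: linear_differentiable.
have -> : tangent f = f \o snd by apply/funext => p; rewrite /tangent diff_lin.
apply: (IH _ _ (f \o snd : {linear _ -> _})) => p.
by apply: continuous_comp; [exact: cvg_snd|exact: cf].
Qed.

Lemma Cn_cst n (E F : normedModType R) (c : F) : Cn n (fun _ : E => c).
Proof.
elim: n E F c => [|n IH] E F c; first exact: cst_continuous.
split => [x|]; first exact: differentiable_cst.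
have -> : tangent (fun _ : E => c) = (fun=> 0); last exact: IH.
by apply/funext => p; rewrite /tangent (diff_cst c).
Qed.

Lemma Cn_add n (E F : normedModType R) (f g : E -> F) :
  Cn n f -> Cn n g -> Cn n (fun x => f x + g x).
Proof.
elim: n E F f g => [|n IH] E F f g.
  by move=> cf cg x; apply: cvgD; [exact: cf|exact: cg].
move=> [df Tf] [dg Tg]; split => [x|]; first exact: differentiableD.
have -> : tangent (fun x => f x + g x) = (fun p => tangent f p + tangent g p).
  by apply/funext => p; rewrite /tangent -[fun x => _]/(f + g) diffD.
exact: IH.
Qed.

Lemma Cn_fst n (E F : normedModType R) : Cn n (@fst E F).
Proof. by apply: (@Cn_lin _ _ _ fst) => x; exact: cvg_fst. Qed.

Lemma Cn_snd n (E F : normedModType R) : Cn n (@snd E F).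
Proof. by apply: (@Cn_lin _ _ _ snd) => x; exact: cvg_snd. Qed.

Lemma Cn_id n (E : normedModType R) : Cn n (fun x : E => x).
Proof. by apply: (@Cn_lin _ _ _ idfun) => x; exact: cvg_id. Qed.

Lemma Cn_pair n (E F G : normedModType R) (f : E -> F) (g : E -> G) :
  Cn n f -> Cn n g -> Cn n (fun x => (f x, g x)).
Proof.
elim: n E F G f g => [|n IH] E F G f g.
  by move=> cf cg x; apply: cvg_pair; [exact: cf|exact: cg].
move=> [df Tf] [dg Tg]; split => [x|]; first exact: differentiable_pair.
have -> : tangent (fun x => (f x, g x)) = (fun p => (tangent f p, tangent g p)).
  by apply/funext => p; rewrite /tangent diff_pair.
exact: IH.
Qed.

Lemma Cn_comp n (E F G : normedModType R) (f : E -> F) (g : F -> G) :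
  Cn n f -> Cn n g -> Cn n (g \o f).
Proof.
elim: n E F G f g => [|n IHn] E F G f g.
  by move=> cf cg x; apply: continuous_comp; [exact: cf|exact: cg].
move=> Cf [dg Tg]; have [df Tf] := Cf.
split => [x|]; first exact: differentiable_comp.
have -> : tangent (g \o f) = tangent g \o (fun p => (f p.1, tangent f p)).
  by apply/funext => p; rewrite /tangent diff_comp.
apply: (IHn) => //; apply: Cn_pair => //.
exact: (IHn _ _ _ _ f (@Cn_fst _ _ _) (CnS Cf)).
Qed.

(** Everything reduces to the bilinear map itself. Its tangent map is a sum of two copies of it
    composed with projections, so the induction on the order closes. *)
Lemma Cn_scale n (E F : normedModType R) (f : E -> R) (g : E -> F) :
  Cn n f -> Cn n g -> Cn n (fun x => f x *: g x).
Proof.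
move=> Cf Cg.
suff scaleC : Cn n (fun p : R * F => p.1 *: p.2).
  exact: (Cn_comp (Cn_pair Cf Cg) scaleC).
elim: n F {E f g Cf Cg} => [|n IHn] F.
  by move=> p; apply: cvgZ; [exact: cvg_fst|exact: cvg_snd].
pose lscale := (fun p : R * F => p.1 *: p.2).
have lin1 (p : R * F) : linear (fun q : R * F => p.1 *: q.2 + q.1 *: p.2).
  move=> k x y /=; rewrite !scalerDr !scalerDl !scalerA addrACA -!scalerA.
  by rewrite [p.1 *: _]scalerA mulrC -scalerA.
have dscale (p : R * F) : is_diff p lscale (fun q : R * F => p.1 *: q.2 + q.1 *: p.2).
  apply: (is_diff_eps (lin1 p)).
    move=> q; apply: cvgD.
      by apply: cvgZl_tmp; exact: cvg_snd.
    by apply: cvgZr_tmp; exact: cvg_fst.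
  (* The remainder is exactly the quadratic term [h.1 *: h.2], so [e] itself is a suitable
     radius. *)
  move=> e e0; exists e => // h he.
  rewrite /lscale /= scalerDl !scalerDr -!addrA.
  rewrite [X in `|X|](_ : _ = h.1 *: h.2); last by lmod_with R F.
  rewrite normrZ; apply: ler_pM => //.
    apply: le_trans (ltW he); by rewrite prod_normE le_max lexx.
  by rewrite prod_normE le_max lexx orbT.
change (Cn n.+1 lscale); split => [p|]; first by case: (dscale p).
have -> : tangent lscale = (fun u => u.1.1 *: u.2.2 + u.2.1 *: u.1.2).
  by apply/funext => p; rewrite /tangent diff_val.
have C1 := @Cn_fst n (R * F)%type (R * F)%type.
have C2 := @Cn_snd n (R * F)%type (R * F)%type.
apply: Cn_add.
- exact: (Cn_comp (Cn_pair (Cn_comp C1 (Cn_fst _ _ _)) (Cn_comp C2 (Cn_snd _ _ _)))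
  (IHn F)).
- exact: (Cn_comp (Cn_pair (Cn_comp C2 (Cn_fst _ _ _)) (Cn_comp C1 (Cn_snd _ _ _)))
  (IHn F)).
Qed.

End Cn.

(** * Gronwall's lemma *)

Section Gronwall.
Context {R : realType}.

Definition cont_on (E : normedModType R) (a b : R) (u : R -> E) :=
  forall t, a <= t <= b -> forall e, 0 < e -> exists2 d, 0 < d &
    forall s, a <= s <= b -> `|s - t| < d -> `|u s - u t| <= e.

(** First-contact argument: where the norm of [u] first meets [phi], it would have to grow at least
    as fast as [phi], against the strict inequality of slopes. The norm is never differentiated; a
    backward increment at the contact is compared instead. *)
Lemma fence (E : normedModType R) (u du : R -> E) (phi dphi : R -> R) (a b : R) :
  cont_on a b u ->
  (forall t : R, a < t < b -> is_derive t 1 u (du t)) ->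
  (forall t : R, is_derive t 1 phi (dphi t)) ->
  `|u a| < phi a ->
  (forall t, a < t < b -> `|u t| = phi t -> `|du t| < dphi t) ->
  forall t, a <= t <= b -> `|u t| <= phi t.
Proof.
move=> cu hu hphi ua touch.
pose g t := phi t - `|u t|.
have cphi t : forall e, 0 < e -> exists2 d, 0 < d & forall s, `|s - t| < d ->
  `|phi s - phi t| <= e.
  have /cont_epsP H := is_derive_cont (hphi t).
  move=> e e0; have [d d0 Hd] := H e e0; exists d => // s sd.
  by have := Hd (s - t) sd; rewrite [t + _]addrC subrK.
have cg t : a <= t <= b -> forall e, 0 < e -> exists2 d, 0 < d &
    forall s, a <= s <= b -> `|s - t| < d -> `|g s - g t| <= e.
  move=> tab e e0; have e20 : 0 < e / 2 by lra.
  have [d1 d10 H1] := cu t tab _ e20; have [d2 d20 H2] := cphi t _ e20.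
  exists (Num.min d1 d2); first by rewrite lt_min d10.
  move=> s sab; rewrite lt_min => /andP[sd1 sd2].
  have := H1 s sab sd1; have := H2 s sd2.
  have := ler_dist_dist (u s) (u t); rewrite /g.
  rewrite !ler_norml; lra.
have ga : 0 < g a by rewrite /g subr_gt0.
have main t0 : a <= t0 < b -> 0 < g t0.
  move=> /andP[at0 t0b]; rewrite ltNge; apply/negP => gt0.
  pose A := [set t | a <= t <= t0 /\ g t <= 0].
  have A0 : A !=set0 by exists t0; split=> //; rewrite at0 lexx.
  have lbA : lbound A a by move=> t [/andP[]].
  have hA : has_inf A by split=> //; exists a.
  (* The first contact. Continuity of [g] places it in [A], after [a], with [g tau = 0]. *)
  pose tau := inf A.
  have atau : a <= tau by apply: lb_le_inf.
  have taut0 : tau <= t0 by apply: ge_inf; [exists a|split=> //; rewrite at0 lexx].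
  have tauab : a <= tau <= b by rewrite atau (le_trans taut0 (ltW t0b)).
  have gtau : g tau <= 0.
    rewrite leNgt; apply/negP => gtau.
    have e0 : 0 < g tau / 2 by lra.
    have [d d0 Hd] := cg tau tauab _ e0.
    have [s [/andP[as_ st0] gs] sd] := inf_adherent d0 hA.
    have taus : tau <= s by apply: ge_inf; [exists a|split=> //; rewrite as_].
    have := Hd s; rewrite as_ (le_trans st0 (ltW t0b)) => /(_ isT).
    rewrite ger0_norm ?subr_ge0// ltrBlDl => /(_ sd).
    rewrite ler_norml; lra.
  have ltau : a < tau.
    rewrite lt_neqAle atau andbT; apply/eqP => E0.
    by move: gtau; rewrite -E0; lra.
  have before t : a <= t < tau -> 0 < g t.
    move=> /andP[at_ ttau]; rewrite ltNge; apply/negP => gt.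
    have : tau <= t by apply: ge_inf; [exists a|split=> //; rewrite at_/=; lra].
    lra.
  have gtau0 : g tau = 0.
    apply/eqP; rewrite eq_le gtau /= leNgt; apply/negP => gneg.
    have e0 : 0 < - g tau / 2 by lra.
    have [d d0 Hd] := cg tau tauab _ e0.
    pose s := Num.max a (tau - d / 2).
    have as_ : a <= s by rewrite le_max lexx.
    have stau : s < tau by rewrite gt_max ltau /=; lra.
    have sd : `|s - tau| < d.
      rewrite ltr0_norm ?subr_lt0// opprB.
      have : tau - d / 2 <= s by rewrite le_max lexx orbT.
      lra.
    have sab : a <= s <= b by rewrite as_ /=; lra.
    have := Hd s sab sd; have := before s; rewrite as_ stau => /(_ isT).
    rewrite ler_norml; lra.
  have tauab' : a < tau < b by rewrite ltau /=; lra.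
  have utau : `|u tau| = phi tau by move: gtau0; rewrite /g; lra.
  have dlt := touch tau tauab' utau.
  (* A third of the gap between slopes: one [e] is spent on linearising [u], one on [phi], and the
     last one gives the contradiction. *)
  pose e := (dphi tau - `|du tau|) / 3.
  have e0 : 0 < e by rewrite /e; lra.
  have [d1 d10 H1] := (iffLR (is_derive_epsP _ _ _)) (hu tau tauab') e e0.
  have [d2 d20 H2] := (iffLR (is_derive_epsP _ _ _)) (hphi tau) e e0.
  pose k := Num.min (Num.min (d1 / 2) (d2 / 2)) (tau - a).
  have k0 : 0 < k by rewrite !lt_min; lra.
  have [kd1 kd2 ka] : [/\ k <= d1 / 2, k <= d2 / 2 & k <= tau - a].
    by split; rewrite !ge_min lexx ?orbT.
  have := H1 (- k); have := H2 (- k); rewrite normrN (gtr0_norm k0).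
  move=> /(_ ltac:(lra)) h2 /(_ ltac:(lra)) h1.
  have gk := before (tau - k); move: gk => /(_ ltac:(lra)) gk.
  have nu : `|u tau| <= `|u (tau - k)| + k * `|du tau| + e * k.
    have -> : u tau = u (tau - k) - (- k *: du tau) - (u (tau - k) - u tau - - k *: du tau).
      by lmod_with R E.
    apply: le_trans (ler_normB _ _) _; apply: lerD => //.
    apply: le_trans (ler_normB _ _) _.
    by rewrite normrZ normrN (gtr0_norm k0).
  move: h2; rewrite /GRing.scale /= ler_norml => h2.
  have : 3 * e = dphi tau - `|du tau| by rewrite /e; lra.
  move: gk nu; rewrite /g utau => gk nu e3.
  have : 0 < k * e by apply: mulr_gt0.
  have : k * (3 * e) = k * dphi tau - k * `|du tau| by rewrite e3; ring.
  nra.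
(* The endpoint [b], where no derivative is assumed, is reached by continuity of [g]. *)
move=> t /andP[at_]; rewrite le_eqVlt => /predU1P[tb|tb]; last first.
  by have := main t; rewrite at_ tb => /(_ isT); rewrite /g; lra.
rewrite {}tb in at_ *.
suff : 0 <= g b by rewrite /g; lra.
have [E0|nab] := eqVneq a b; first by rewrite -E0; lra.
rewrite leNgt; apply/negP => gneg.
have e0 : 0 < - g b / 2 by lra.
have ab : a < b by rewrite lt_neqAle nab; lra.
have bab : a <= b <= b by lra.
have [d d0 Hd] := cg b bab _ e0.
pose s := Num.max a (b - d / 2).
have as_ : a <= s by rewrite le_max lexx.
have sb : s < b by rewrite gt_max ab /=; lra.
have sd : `|s - b| < d.
  rewrite ltr0_norm ?subr_lt0// opprB.
  have : b - d / 2 <= s by rewrite le_max lexx orbT.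
  lra.
have := main s; rewrite as_ sb => /(_ isT); have := Hd s.
rewrite as_ (ltW sb) => /(_ isT sd); rewrite ler_norml; lra.
Qed.

(** Bootstrap form: the differential inequality is known only where [u] is smaller than [rho], and
    the final bound lies below [rho], so that [u] cannot leave this region. *)
Lemma gronwall (E : normedModType R) (u du : R -> E) (a b L e dl rho : R) :
  cont_on a b u ->
  (forall t : R, a < t < b -> is_derive t 1 u (du t)) ->
  0 <= L -> 0 <= e -> 0 <= dl -> `|u a| <= dl ->
  (forall t, a < t < b -> `|u t| < rho -> `|du t| <= L * `|u t| + e) ->
  (dl + e * (b - a)) * expR (L * (b - a)) < rho ->
  forall t, a <= t <= b -> `|u t| <= (dl + e * (b - a)) * expR (L * (b - a)).
Proof.
move=> cu hu L0 e0 dl0 ua hdu hrho t /andP[at_ tb].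
set K := _ * expR _ in hrho *.
rewrite leNgt; apply/negP => Kt.
pose X := expR (L * (b - a)); have X0 : 0 < X by exact: expR_gt0.
pose m := Num.min (rho - K) (`|u t| - K).
have m0 : 0 < m by rewrite lt_min; lra.
have ab : a <= b by lra.
have X1 : 0 < (1 + (b - a)) * X by apply: mulr_gt0 => //; lra.
(* Raising both the initial value and the source by [eta] makes the Gronwall exponential strictly
   steeper than [u]. This [eta] raises its value at [b] by [m / 2], which keeps it below [rho] and
   below the value of [u] at [t] that is to be refuted. *)
pose eta := m / 2 / ((1 + (b - a)) * X).
have eta0 : 0 < eta by rewrite divr_gt0//; lra.
pose phi r := (dl + eta + (e + eta) * (r - a)) * expR (L * (r - a)).
pose dphi r := (e + eta) * expR (L * (r - a)) + L * phi r.
have dphiP (r : R) : is_derive r 1 phi (dphi r).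
  have d1 : is_derive r 1 (fun r => L * (r - a)) L.
    by apply: is_derive_eq; rewrite /GRing.scale/=; ring.
  have d2 : is_derive r 1 (fun r => expR (L * (r - a))) (L * expR (L * (r - a))).
    rewrite mulrC.
    exact: (@is_derive1_comp _ (@expR R) (fun r =>
      L * (r - a)) r _ _ (is_derive_expR _) d1).
  rewrite /phi /dphi.
  apply: is_derive_eq; have sc (p q : R) : p *: (q : R) = p * q by [].
  rewrite /phi !sc; ring.
have phi_le r : a <= r <= b -> phi r <= K + m / 2.
  move=> /andP[ar rb].
  have -> : K + m / 2 = (dl + eta + (e + eta) * (b - a)) * X.
    have -> : m / 2 = eta * ((1 + (b - a)) * X) by rewrite /eta divfK// gt_eqF.
    rewrite /K -/X; ring.
  apply: ler_pM.
  - by apply: addr_ge0; [lra|apply: mulr_ge0; lra].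
  - exact: expR_ge0.
  - by apply: lerD => //; apply: ler_wpM2l; lra.
  - by rewrite ler_expR; apply: ler_wpM2l => //; lra.
have mrho : m <= rho - K by rewrite ge_min lexx.
have mu : m <= `|u t| - K by rewrite ge_min lexx orbT.
have := @fence E u du phi dphi a b cu hu dphiP.
have phia : phi a = dl + eta by rewrite /phi subrr !mulr0 addr0 expR0 mulr1.
rewrite phia => /(_ ltac:(lra)).
move=> /(_ _ t); rewrite at_ tb => H.
have : `|u t| <= phi t.
  apply: H => // r rab Er.
  have rab' : a <= r <= b by lra.
  have := phi_le r rab'; have := hdu r rab; rewrite Er => h1 h2.
  have := h1 ltac:(lra); rewrite /dphi.
  have : 1 <= expR (L * (r - a)) by rewrite -expR0 ler_expR; apply: mulr_ge0 => //; lra.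
  have ee : 0 < e + eta by lra.
  move: ee; set y := expR _ ; nra.
have := phi_le t; rewrite at_ tb => /(_ isT); lra.
Qed.

Lemma derive_cont_on (E : normedModType R) (u du : R -> E) a b :
  (forall t : R, a <= t <= b -> is_derive t 1 u (du t)) -> cont_on a b u.
Proof.
move=> hu t tab.
have /cont_epsP H := is_derive_cont (hu t tab).
move=> e e0; have [d d0 Hd] := H e e0; exists d => // s _ sd.
by have := Hd (s - t) sd; rewrite [t + _]addrC subrK.
Qed.

Lemma mean_value (E : normedModType R) (u du : R -> E) (a b M : R) :
  cont_on a b u -> (forall t : R, a < t < b -> is_derive t 1 u (du t)) ->
  (forall t, a < t < b -> `|du t| <= M) -> 0 <= M -> a <= b ->
  `|u b - u a| <= M * (b - a).
Proof.
move=> cu hu hM M0 ab.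
have := @gronwall E (fun t => u t - u a) du a b 0 M 0 (M * (b - a) + 1).
rewrite subrr normr0 mul0r expR0 mulr1 add0r.
move=> /(_ _ _ _ _ _ _ _ _ b); apply => //; last by lra.
- move=> t tab e e0; have [d d0 Hd] := cu t tab e e0; exists d => // s sab sd.
  by rewrite opprB addrA subrK; exact: Hd.
- move=> t tab; have := hu t tab => ?.
  by apply: is_derive_eq; rewrite subr0.
- by move=> t tab _; rewrite mul0r add0r; exact: hM.
- by lra.
Qed.

Lemma gronwall_sym (E : normedModType R) (u du : R -> E) (Th L e dl rho : R) :
  (forall t : R, is_derive t 1 u (du t)) ->
  0 <= L -> 0 <= e -> 0 <= dl -> `|u 0| <= dl ->
  (forall t, `|t| <= Th -> `|u t| < rho -> `|du t| <= L * `|u t| + e) ->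
  (dl + e * Th) * expR (L * Th) < rho ->
  forall t, `|t| <= Th -> `|u t| <= (dl + e * Th) * expR (L * Th).
Proof.
move=> hu L0 e0 dl0 u0 hdu hrho t tTh.
have Th0 : 0 <= Th by apply: le_trans tTh.
have half (v dv : R -> E) : (forall t : R, is_derive t 1 v (dv t)) -> `|v 0| <= dl ->
  (forall t, `|t| <= Th -> `|v t| < rho -> `|dv t| <= L * `|v t| + e) ->
  forall t, 0 <= t <= Th -> `|v t| <= (dl + e * Th) * expR (L * Th).
  move=> hv v0 hdv r rTh.
  have := @gronwall E v dv 0 Th L e dl rho.
  rewrite subr0; apply => //.
  - by apply: derive_cont_on => s _; exact: hv.
  - by move=> s sTh; apply: hdv; rewrite ler_norml; lra.
have [t0|t0] := leP 0 t.
  by apply: (half u du hu u0 hdu); rewrite t0; move: tTh; rewrite ler_norml; lra.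
have hv (r : R) : is_derive r 1 (fun r => u (- r)) (- du (- r)).
  apply/is_derive_epsP => e1 e10.
  have [d d0 Hd] := (iffLR (is_derive_epsP _ _ _)) (hu (- r)) e1 e10.
  exists d => // h hd; have := Hd (- h); rewrite normrN => /(_ hd).
  by rewrite scaleNr scalerN opprD.
have := half _ _ hv; rewrite oppr0 => /(_ u0) H.
have := H _ (- t); rewrite opprK; apply.
  by move=> s sTh us; rewrite normrN; apply: hdu; rewrite ?normrN.
by move: tTh; rewrite ler_norml; lra.
Qed.

End Gronwall.

(** * Compactness and mean value estimates *)

Section Compactness.
Context {R : realType}.

(** Stands for finite dimension. In this form it needs no coordinates and passes to products, hence
    to the domains of iterated tangent maps. *)
Definition fd (E : normedModType R) := forall r : R, compact [set x : E | `|x| <= r].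

Lemma fd_R : fd R.
Proof.
move=> r; have -> : [set x : R | `|x| <= r] = `[- r, r]%classic.
  by apply/seteqP; split => x /=; rewrite in_itv/= ler_norml.
exact: segment_compact.
Qed.

Lemma fd_prod (E F : normedModType R) : fd E -> fd F -> fd (E * F)%type.
Proof.
move=> fE fF r.
have -> : [set x : E * F | `|x| <= r] = [set x : E | `|x| <= r] `*` [set x : F | `|x| <= r].
  apply/seteqP; split => [[x y]|[x y]] /=; rewrite prod_normE/= ge_max.
    by move/andP.
  by move=> [-> ->].
exact: compact_setX.
Qed.

Lemma fd_rV n : fd 'rV[R]_n.
Proof.
move=> r; apply: bounded_closed_compact.
  exists r; split; first exact: num_real.
  by move=> x rx y /= yr; apply: le_trans yr (ltW rx).
have -> : [set x : 'rV[R]_n | `|x| <= r] = (fun x : 'rV[R]_n =>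
  `|x|) @^-1` [set t | t <= r] by [].
apply: closed_comp; last exact: closed_le.
by move=> x _; exact: norm_continuous.
Qed.

Lemma compact_cont_unif (T : topologicalType) (E F : normedModType R)
    (K : set T) (f : T -> E -> F) :
  compact K ->
  (forall x, K x -> {for (x, 0), continuous (fun p : T * E => f p.1 p.2)}) ->
  forall e : R, 0 < e -> exists2 rho : R, 0 < rho &
    forall x y, K x -> `|y| < rho -> `|f x y - f x 0| <= e.
Proof.
move=> cK cf e e0.
have e20 : 0 < e / 2 by lra.
have /compact_near_coveringP NC := cK.
have := NC E (nbhs (0 : E)) (fun y x => `|f x y - f x 0| <= e) _.
have H : forall x : T, K x -> \forall x' \near x & i \near nbhs (0 :
  E), `|f x' i - f x' 0| <= e.
  move=> x Kx; have /cvgrPdist_le /(_ _ e20) := cf x Kx.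
  move=> [[U W] /= [Ux W0] UW]; exists (U, W) => //= -[x' y] /= [Ux' Wy].
  have h1 := UW (x', y) (conj Ux' Wy).
  have h2 := UW (x', 0) (conj Ux' (nbhs_singleton W0)).
  rewrite -(subrKA (f x 0)); apply: le_trans (ler_normD _ _) _.
  by rewrite /= in h1 h2; rewrite distrC; lra.
move=> /(_ _ H) /nbhs_norm0P [rho /= rho0 Hrho]; exists rho => // x y Kx yr.
exact: (Hrho y yr x Kx).
Qed.

Lemma compact_cont_bounded (T : topologicalType) (F : normedModType R)
    (K : set T) (f : T -> F) :
  compact K -> continuous f -> exists2 M : R, 0 <= M & forall x, K x -> `|f x| <= M.
Proof.
move=> cK cf.
have : compact (f @` K) by apply: continuous_compact => //; exact: continuous_subspaceT.
move=> /compact_bounded [M [_ HM]].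
exists (`|M| + 1); first by apply: addr_ge0.
move=> x Kx; apply: HM; last by exists x.
by rewrite (le_lt_trans (ler_norm _))// ltrDl.
Qed.

Lemma is_derive_comp (E F : normedModType R) (c : R -> E) (f : E -> F) (t : R) (dc : E) :
  is_derive t 1 c dc -> differentiable f (c t) ->
  is_derive t 1 (f \o c) ('d f (c t) dc).
Proof.
move=> Hc df.
have dc1 : differentiable c t by apply/derivable1_diffP; case: Hc.
split; first exact/derivable1_diffP/differentiable_comp.
rewrite deriveE; last exact: differentiable_comp.
rewrite diff_comp//=; congr ('d f _ _); rewrite -(deriveE (1 : R) dc1).
by case: Hc.
Qed.

Lemma is_derive_line (E : normedModType R) (c h : E) (t : R) :
  is_derive t 1 (fun s : R => c + s *: h) h.
Proof.
apply/is_derive_epsP => e e0; exists 1 => // k _.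
rewrite [X in `|X|](_ : _ = 0); last by lmod_with R E.
by rewrite normr0 mulr_ge0// ltW.
Qed.

Lemma is_derive_line_comp (E F : normedModType R) (f : E -> F) (c h : E) (t : R) :
  differentiable f (c + t *: h) ->
  is_derive t 1 (fun s : R => f (c + s *: h)) ('d f (c + t *: h) h).
Proof. by move=> df; apply: (is_derive_comp (is_derive_line c h t)). Qed.

(** The segment from [t] to [t + k] is run over [0, 1], so [k] may have either sign; subtracting the
    constant slope [G] gives a first-order estimate directly. *)
Lemma mean_value_sym (F : normedModType R) (f df : R -> F) (t k : R) (G : F) (M : R) :
  (forall r : R, `|r - t| <= `|k| -> is_derive r 1 f (df r)) ->
  (forall r : R, `|r - t| <= `|k| -> `|df r - G| <= M) ->
  `|f (t + k) - f t - k *: G| <= M * `|k|.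
Proof.
move=> hf hM.
have M0 : 0 <= M by apply: le_trans (hM t _) => //; rewrite subrr normr0.
pose g s := f (t + s *: k) - s *: (k *: G).
have rk s : 0 <= s <= 1 -> `|t + s *: k - t| <= `|k|.
  move=> s01; rewrite addrC addKr normrZ ler_piMl// ger0_norm; lra.
have gP (s : R) : 0 <= s <= 1 -> is_derive s 1 g (k *: df (t + s *: k) - k *: G).
  move=> s01; have d1 := hf _ (rk s s01).
  have d2 : differentiable f (t + s *: k) by apply/derivable1_diffP; case: d1.
  have := is_derive_line_comp d2.
  have -> : 'd f (t + s *: k) k = k *: df (t + s *: k).
    by rewrite diff1E// derive1E; congr (_ *: _); case: d1.
  move=> d3; have d4 : is_derive s 1 (fun s : R => s *: (k *: G)) (k *: G).
    by have := is_derive_line 0 (k *: G) s; under eq_fun do rewrite add0r.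
  by apply: is_deriveB.
have := @mean_value R F g (fun s => k *: df (t + s *: k) - k *: G) 0 1 (M * `|k|).
rewrite /g scale1r scale0r addr0 scale0r subr0 scale1r subr0 mulr1 addrAC.
apply => //.
- exact: derive_cont_on gP.
- by move=> s s01; apply: gP; lra.
- move=> s s01; rewrite -scalerBr normrZ mulrC ler_wpM2r//; apply: hM; apply: rk; lra.
- exact: mulr_ge0.
Qed.

End Compactness.

(** * Regularity of flows *)

Section Flow.
Context {R : realType} (E : normedModType R) (B : E -> E) (Phi : R -> E -> E).
Hypothesis fdE : fd E.
Hypothesis CB : Cn 1 B.
Hypothesis Phi0 : forall X, Phi 0 X = X.
Hypothesis Phi_ode : forall (th : R) X, is_derive th 1 (Phi^~ X) (B (Phi th X)).

Local Notation TB x v := (tangent B (x, v)).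

Lemma tangent_lin (F G : normedModType R) (f : F -> G) x k u v :
  tangent f (x, k *: u + v) = k *: tangent f (x, u) + tangent f (x, v).
Proof. by rewrite /tangent /= linearP. Qed.

Lemma tangentB (F G : normedModType R) (f : F -> G) x u v :
  tangent f (x, u - v) = tangent f (x, u) - tangent f (x, v).
Proof. by rewrite /tangent /= linearB. Qed.

Lemma tangentZ (F G : normedModType R) (f : F -> G) x k u :
  tangent f (x, k *: u) = k *: tangent f (x, u).
Proof. by rewrite /tangent /= linearZ. Qed.

Let TBc : continuous (tangent B). Proof. by case: CB. Qed.

Let Phi_cont X : continuous (Phi^~ X).
Proof. by move=> th; exact: is_derive_cont (Phi_ode th X). Qed.

Let K (Th : R) : set (R * E) :=
  [set x : R | `|x| <= Th] `*` [set x : E | `|x| <= 1].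

Let cK Th : compact (K Th).
Proof. by apply: compact_setX; [exact: fd_R|exact: fdE]. Qed.

Let homogeneous (F : normedModType R) (L : E -> F) (M : R) (v : E) :
  (forall k u, L (k *: u) = k *: L u) ->
  (forall v, `|v| <= 1 -> `|L v| <= M) -> `|L v| <= M * `|v|.
Proof.
move=> LZ LM; have [->|v0] := eqVneq v 0.
  by have := LZ 0 0; rewrite scale0r => ->; rewrite scale0r !normr0 mulr0.
have nv : 0 < `|v| by rewrite normr_gt0.
have -> : L v = `|v| *: L (`|v|^-1 *: v).
  by rewrite LZ scalerA divff ?scale1r// gt_eqF.
rewrite normrZ normr_id mulrC ler_pM2r//; apply: LM.
by rewrite normrZ normfV normr_id mulVf// gt_eqF.
Qed.

(** Joint continuity along the compact piece of orbit, for [v] in the unit ball, yields one radius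
    for all times; homogeneity in [v] then supplies the factor [|v|]. *)
Lemma tangent_unif X (Th e : R) : 0 < e -> exists2 rho : R, 0 < rho &
  forall s y v, `|s| <= Th -> `|y| < rho ->
    `|TB (Phi s X + y) v - TB (Phi s X) v| <= e * `|v|.
Proof.
move=> e0.
pose f (p : R * E) (y : E) := TB (Phi p.1 X + y) p.2.
have [|rho rho0 H] := @compact_cont_unif R _ E E (K Th) f (cK (Th := Th)) _ e e0.
  move=> p _; apply: (Cn_comp (n := 0) (g := tangent B) _ TBc).
  have C1 := @Cn_fst R 0 (R * E)%type E; have cP : Cn 0 (Phi^~ X) by exact: Phi_cont.
  apply: Cn_pair; last exact: (Cn_comp C1 (Cn_snd _ _ _)).
  exact: (Cn_add (Cn_comp (Cn_comp C1 (Cn_fst _ _ _)) cP) (Cn_snd _ _ _)).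
exists rho => // s y v sTh yr.
apply: (@homogeneous _ (fun v => TB (Phi s X + y) v - TB (Phi s X) v)).
  by move=> k u; rewrite !tangentZ scalerBr.
move=> w w1; have := H (s, w) y; rewrite /f /= addr0; apply => //.
Qed.

Lemma tangent_bound X (Th : R) : exists2 L : R, 0 <= L &
  forall s v, `|s| <= Th -> `|TB (Phi s X) v| <= L * `|v|.
Proof.
pose f (p : R * E) := TB (Phi p.1 X) p.2.
have [|L L0 H] := @compact_cont_bounded R _ E (K Th) f (cK (Th := Th)).
  have cP : Cn 0 (Phi^~ X) by exact: Phi_cont.
  apply: (Cn_comp (n := 0) (g := tangent B) _ TBc); apply: Cn_pair; last exact: Cn_snd.
  exact: (Cn_comp (Cn_fst _ _ _) cP).
exists L => // s v sTh; apply: homogeneous => [k u|w w1]; first exact: tangentZ.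
by apply: (H (s, w)).
Qed.

Lemma field_unif X (Th e : R) : 0 < e -> exists2 rho : R, 0 < rho &
  forall s y, `|s| <= Th -> `|y| < rho ->
    `|B (Phi s X + y) - B (Phi s X) - TB (Phi s X) y| <= e * `|y|.
Proof.
move=> e0; have [rho rho0 H] := tangent_unif X Th e0.
exists rho => // s y sTh yr.
have := @mean_value_sym R E (fun r => B (Phi s X + r *: y)) (fun r =>
  TB (Phi s X + r *: y) y) 0 1 (TB (Phi s X) y) (e * `|y|).
rewrite add0r scale0r addr0 !scale1r normr1 mulr1; apply.
  by move=> r _; apply: is_derive_line_comp; case: CB.
move=> r; rewrite subr0 => r1; apply: H => //.
by rewrite normrZ; apply: le_lt_trans yr; rewrite ler_piMl.
Qed.

Lemma linear_ode_bound X (Th L : R) (u : R -> E) (dl : R) :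
  0 <= L -> (forall s v, `|s| <= Th -> `|TB (Phi s X) v| <= L * `|v|) ->
  (forall s : R, is_derive s 1 u (TB (Phi s X) (u s))) -> `|u 0| <= dl ->
  forall s, `|s| <= Th -> `|u s| <= dl * expR (L * Th).
Proof.
move=> L0 HL hu u0 s sTh.
have dl0 : 0 <= dl by apply: le_trans u0.
have := @gronwall_sym R E u _ Th L 0 dl (dl * expR (L * Th) + 1) hu L0 (lexx _) dl0 u0.
rewrite mul0r addr0 ltrDl ltr01; apply => // r rTh _.
by rewrite addr0; exact: HL.
Qed.

(** [B] is only locally Lipschitz. The radius [rho1 / C] ensures that orbits at distance [C * |h|]
    remain where [field_unif] applies, which is the threshold of Gronwall's lemma. The rate [L + 1]
    is the bound [L] of the linearised field plus the linearisation error 1. *)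
Lemma flow_lip X (Th : R) : exists C rho : R, [/\ 0 < C, 0 < rho &
  forall s h, `|s| <= Th -> `|h| < rho -> `|Phi s (X + h) - Phi s X| <= C * `|h|].
Proof.
have [rho1 rho10 H1] := field_unif X Th (ltr01).
have [L L0 HL] := tangent_bound X Th.
pose C := expR ((L + 1) * Th); have C0 : 0 < C by exact: expR_gt0.
exists C, (rho1 / C); split=> //; first by rewrite divr_gt0.
move=> s h sTh; rewrite ltr_pdivlMr// => hC.
have := @gronwall_sym R E (fun r => Phi r (X + h) - Phi r X)
  (fun r => B (Phi r (X + h)) - B (Phi r X)) Th (L + 1) 0 `|h| rho1.
rewrite mul0r addr0 -/C (mulrC C); apply => //.
- by rewrite addr_ge0.
- by rewrite !Phi0 addrAC subrr add0r.
- move=> t tTh yr; set y := _ - _ in yr *.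
  have := H1 t y tTh yr; have := HL t y tTh.
  have -> : Phi t (X + h) = Phi t X + y by rewrite /y [RHS]addrC subrK.
  move=> h1 h2; rewrite addr0 -(subrK (TB (Phi t X) y) (B _ - _)).
  apply: le_trans (ler_normD _ _) _; rewrite mulrDl mul1r; lra.
Qed.

Definition dquot X v (l s : R) := l^-1 *: (Phi s (X + l *: v) - Phi s X).

(** The candidate for the linearised flow. [lind_approx] shows that the directional derivative
    exists, and [lind_ode] that it solves the linearised equation. *)
Definition lind X v (s : R) := 'D_v (Phi s) X.

Lemma dquot_derive X v l (s : R) :
  is_derive s 1 (dquot X v l) (l^-1 *: (B (Phi s (X + l *: v)) - B (Phi s X))).
Proof. by rewrite /dquot; apply: is_deriveZ; exact: is_deriveB. Qed.

(** A difference quotient solves the linearised equation up to a small source. The smallness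
    condition bears on [l *: v] and not on [l], so the estimate is uniform in the direction. *)
Lemma dquot_ode X (Th e : R) : 0 < e -> exists2 rho : R, 0 < rho &
  forall v l, l != 0 -> `|l *: v| < rho ->
  exists2 r : R -> E,
    (forall s : R, is_derive s 1 (dquot X v l) (TB (Phi s X) (dquot X v l s) + r s)) &
    forall s, `|s| <= Th -> `|r s| <= e * `|v|.
Proof.
move=> e0.
have [C [rho1 [C0 rho10 H1]]] := flow_lip X Th.
have eC0 : 0 < e / C by rewrite divr_gt0.
have [rho2 rho20 H2] := field_unif X Th eC0.
exists (Num.min rho1 (rho2 / C)); first by rewrite lt_min rho10 divr_gt0.
move=> v l l0; rewrite lt_min ltr_pdivlMr// => /andP[lv1 lv2].
exists (fun s => l^-1 *: (B (Phi s (X + l *: v)) - B (Phi s X)) - TB (Phi s X)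
  (dquot X v l s)).
  by move=> s; rewrite addrC subrK; exact: dquot_derive.
move=> s sTh; rewrite /dquot tangentZ -scalerBr normrZ.
set y := Phi s (X + l *: v) - Phi s X.
have hy := H1 s (l *: v) sTh lv1.
have yr : `|y| < rho2 by apply: le_lt_trans hy _; rewrite mulrC.
have -> : Phi s (X + l *: v) = Phi s X + y by rewrite /y [RHS]addrC subrK.
rewrite normfV mulrC ler_pdivrMr ?normr_gt0//.
apply: le_trans (H2 s y sTh yr) _.
apply: le_trans (ler_wpM2l (ltW eC0) hy) _; rewrite normrZ.
by rewrite le_eqVlt; apply/orP; left; apply/eqP; field; rewrite gt_eqF.
Qed.

Lemma dquot_cauchy X (Th e : R) : 0 < e -> exists2 rho : R, 0 < rho &
  forall v l l', l != 0 -> l' != 0 -> `|l *: v| < rho -> `|l' *: v| < rho ->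
  forall s, `|s| <= Th -> `|dquot X v l s - dquot X v l' s| <= e * `|v|.
Proof.
move=> e0; have [L L0 HL] := tangent_bound X Th.
have [Th0|Th0] := ltP Th 0.
  by exists 1 => // v l l' _ _ _ _ s sTh; have := normr_ge0 s; lra.
(* Two sources of size [e / D] act during [Th] and are amplified by the exponential; the added 1
   keeps [D] positive when [Th] is 0. *)
pose D := 2 * Th * expR (L * Th) + 1.
have D0 : 0 < D by rewrite ltr_wpDl// !mulr_ge0// expR_ge0.
have e10 : 0 < e / D by rewrite divr_gt0.
have [rho rho0 H] := dquot_ode X Th e10.
exists rho => // v l l' l0 l'0 lv l'v s sTh.
have [r hq hr] := H v l l0 lv; have [r' hq' hr'] := H v l' l'0 l'v.
set bd := (0 + 2 * (e / D) * `|v| * Th) * expR (L * Th).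
have bdE : bd <= e * `|v|.
  have -> : bd = (2 * Th * expR (L * Th)) / D * (e * `|v|).
    by rewrite /bd; field; rewrite gt_eqF.
  rewrite ler_piMl//; first by rewrite mulr_ge0// ltW.
  by rewrite ler_pdivrMr// mul1r lerDl.
apply: le_trans bdE.
apply: (@gronwall_sym R E (fun s =>
  dquot X v l s - dquot X v l' s) _ Th L (2 * (e / D) * `|v|) 0 (bd + 1)) => //.
- by rewrite !mulr_ge0// ltW// invr_gt0.
- by rewrite /dquot !Phi0 ![X + _]addrC !addrK !scalerK// subrr normr0.
- move=> t tTh _.
  rewrite [X in `|X|](_ : _ = TB (Phi t X) (dquot X v l t - dquot X v l' t) +
    (r t - r' t)); last first.
    by rewrite tangentB; lmod_with R E.
  apply: le_trans (ler_normD _ _) _; apply: lerD; first exact: HL.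
  apply: le_trans (ler_normB _ _) _; have := hr t tTh; have := hr' t tTh; lra.
- by rewrite -/bd ltrDl.
Qed.

(** The quotients are Cauchy by [dquot_cauchy] and stay in a compact ball by [flow_lip], so the
    limit defining [lind] exists. Sending the second step of the Cauchy estimate to 0 gives the
    bound. *)
Lemma lind_approx X (Th e : R) : 0 < e -> exists2 rho : R, 0 < rho &
  forall v l, l != 0 -> `|l *: v| < rho ->
  forall s, `|s| <= Th -> `|dquot X v l s - lind X v s| <= e * `|v|.
Proof.
move=> e0; have [C [rho1 [C0 rho10 H1]]] := flow_lip X Th.
have [rho2 rho20 H2] := dquot_cauchy X Th e0.
exists (Num.min rho1 rho2); first by rewrite lt_min rho10.
move=> v l l0; rewrite lt_min => /andP[lv1 lv2] s sTh.
pose q (k : R) := k^-1 *: ((Phi s \o shift X) (k *: v) - Phi s X).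
have qE k : q k = dquot X v k s by rewrite /q /dquot /= [k *: v + X]addrC.
have near_small rho : 0 < rho -> \forall k \near 0^', k != 0 /\ `|k *: v| < rho.
  move=> rho0; have n1 : 0 < `|v| + 1 by rewrite ltr_wpDl.
  near=> k; split; first by near: k; exact: nbhs_dnbhs_neq.
  rewrite normrZ; apply: (@le_lt_trans _ _ (rho / (`|v| + 1) * `|v|)).
    rewrite ler_wpM2r//; near: k; apply: dnbhs0_le; exact: divr_gt0.
  by rewrite -mulrA gtr_pMr// mulrC ltr_pdivrMr// mul1r ltrDl.
have cq : cvg (q @ 0^').
  apply: (@compact_cauchy_cvg E [set x : E | `|x| <= C * `|v|]).
  - apply/cauchy_ballP => d d0.
    have n1 : 0 < `|v| + 1 by rewrite ltr_wpDl.
    have dv0 : 0 < d / (`|v| + 1) by rewrite divr_gt0.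
    have [rho3 rho30 H3] := dquot_cauchy X Th dv0.
    rewrite near_map2; near=> k k'.
    have [k0 kv] : k != 0 /\ `|k *: v| < rho3 by near: k; exact: near_small.
    have [k'0 k'v] : k' != 0 /\ `|k' *: v| < rho3 by near: k'; exact: near_small.
    rewrite -ball_normE /= !qE; apply: le_lt_trans (H3 v k k' k0 k'0 kv k'v s sTh) _.
    by rewrite -mulrA gtr_pMr// mulrC ltr_pdivrMr// mul1r ltrDl.
  - rewrite /= /nbhs /=; near=> k.
    have [k0 kv] : k != 0 /\ `|k *: v| < rho1 by near: k; exact: near_small.
    rewrite /= qE /dquot normrZ normfV ler_pdivrMl ?normr_gt0//.
    apply: le_trans (H1 s _ sTh kv) _; rewrite normrZ; lra.
  - exact: fdE.
have limq : q @ 0^' --> lind X v s by exact: cq.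
apply/ler_addgt0Pr => d d0.
have : \forall k \near 0^', `|lind X v s - q k| <= d.
  by move/cvgrPdist_le: limq; apply.
move=> Hd; have [k [[k0 kv] kd]] := filter_ex (filterI (near_small _ rho20) Hd).
rewrite -(subrKA (dquot X v k s)); apply: le_trans (ler_normD _ _) _.
apply: lerD; first exact: H2.
by rewrite -qE distrC.
Unshelve. all: by end_near. Qed.

Lemma lind0 X v : lind X v 0 = v.
Proof.
rewrite /lind (_ : Phi 0 = id); last exact/funext.
exact: derive_id.
Qed.

Let small (v : E) (rho : R) : 0 < rho -> exists2 l : R, l != 0 & `|l *: v| < rho.
Proof.
move=> rho0; have n1 : 0 < `|v| + 1 by rewrite ltr_wpDl.
exists (rho / (`|v| + 1)); first by rewrite gt_eqF// divr_gt0.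
rewrite normrZ ger0_norm ?divr_ge0 ?ltW// -mulrA gtr_pMr// mulrC ltr_pdivrMr//.
by rewrite mul1r ltrDl.
Qed.

(** A locally uniform limit in time of the continuous difference quotients. *)
Lemma lind_cont X v : continuous (lind X v).
Proof.
move=> s0; apply/cont_epsP => e e0.
(* A positive bound for [|v|], so that dividing by it is safe even when [v] is 0. *)
pose c := `|v| + 1; have c0 : 0 < c by rewrite ltr_wpDl.
have e10 : 0 < e / 3 / c by rewrite !divr_gt0.
have cv : e / 3 / c * `|v| <= e / 3.
  by rewrite -mulrA ler_piMr ?divr_ge0 ?ltW// mulrC ltr_pdivrMr// mul1r ltrDl.
have [rho rho0 H] := lind_approx X (`|s0| + 1) e10.
have [l l0 lv] := small v rho0.
have [rho2 rho20 H2] := dquot_ode X 0 ltr01.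
have dc : continuous (dquot X v l).
  by move=> s; exact: (is_derive_cont (dquot_derive X v l s)).
have e30 : 0 < e / 3 by rewrite divr_gt0.
have [d d0 Hd] := (iffLR (cont_epsP _ _)) (dc s0) _ e30.
exists (Num.min d 1); first by rewrite lt_min d0 /=.
move=> h; rewrite lt_min => /andP[hd h1].
have := Hd h hd; have := H v l l0 lv s0; have := H v l l0 lv (s0 + h).
have n1 : `|s0 + h| <= `|s0| + 1 by apply: le_trans (ler_normD _ _) _; lra.
have n2 : `|s0| <= `|s0| + 1 by lra.
move=> /(_ n1) h1' /(_ n2) h2' h3'.
rewrite [X in `|X|](_ : _ = (dquot X v l (s0 + h) - dquot X v l s0) - (dquot X v l
  (s0 + h) - lind X v (s0 + h)) + (dquot X v l s0 - lind X v s0)); last by lmod_with R E.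
apply: le_trans (ler_normD _ _) _;
  have := ler_normB (dquot X v l (s0 + h) - dquot X v l s0) (dquot X v l
    (s0 + h) - lind X v (s0 + h)).
lra.
Qed.

(** The mean value inequality is applied to a quotient, whose derivative is close to [G] near [s]
    for three reasons, each costing [e / 4]: continuity of the limiting field, closeness of the
    quotient to [lind], and the source term. *)
Lemma lind_ode X v (s : R) : is_derive s 1 (lind X v) (TB (Phi s X) (lind X v s)).
Proof.
apply/is_derive_epsP => e e0.
set G := TB _ _.
pose c := `|v| + 1; have c0 : 0 < c by rewrite ltr_wpDl.
pose Th := `|s| + 1.
have [L L0 HL] := tangent_bound X Th.
have e40 : 0 < e / 4 / c by rewrite !divr_gt0.
have cv : e / 4 / c * `|v| <= e / 4.
  by rewrite -mulrA ler_piMr ?divr_ge0 ?ltW// mulrC ltr_pdivrMr// mul1r ltrDl.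
have Lc0 : 0 < L + 1 by rewrite ltr_wpDl.
have eL0 : 0 < e / 4 / c / (L + 1) by rewrite divr_gt0.
have e20 : 0 < e / 4 by rewrite divr_gt0.
have Gc : {for s, continuous (fun r => TB (Phi r X) (lind X v r))}.
  apply: (@continuous_comp _ _ _ (fun r => (Phi r X, lind X v r)) (tangent B));
    last exact: TBc.
  by apply: cvg_pair => /=; [exact: Phi_cont|exact: lind_cont].
have [d d0 Hd] := (iffLR (cont_epsP _ _)) Gc _ e20.
exists (Num.min d 1); first by rewrite lt_min d0 /=.
move=> k; rewrite lt_min => /andP[kd k1].
(* The time step [k] is fixed before [l]. Replacing [lind] by a quotient at the two endpoints costs
   [eta / 2] each, an error not proportional to [k], which disappears since [eta] is arbitrary. *)
apply/ler_addgt0Pr => eta eta0.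
have etac0 : 0 < eta / 2 / c by rewrite !divr_gt0.
have ecv : eta / 2 / c * `|v| <= eta / 2.
  by rewrite -mulrA ler_piMr ?divr_ge0 ?ltW// mulrC ltr_pdivrMr// mul1r ltrDl.
have [rho1 rho10 H1] := lind_approx X Th eL0.
have [rho2 rho20 H2] := dquot_ode X Th e40.
have [rho3 rho30 H3] := lind_approx X Th etac0.
have r0 : 0 < Num.min (Num.min rho1 rho2) rho3 by rewrite !lt_min rho10 rho20.
have [l l0] := small v r0; rewrite !lt_min => /andP[/andP[lv1 lv2] lv3].
have [r hq hr] := H2 v l l0 lv2.
have n1 : `|s + k| <= Th by apply: le_trans (ler_normD _ _) _; rewrite /Th; lra.
have n2 : `|s| <= Th by rewrite /Th; lra.
have a1 := H3 v l l0 lv3 _ n1; have a2 := H3 v l l0 lv3 _ n2.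
have main : `|dquot X v l (s + k) - dquot X v l s - k *: G| <= e * `|k|.
  apply: (mean_value_sym (df := fun s => TB (Phi s X) (dquot X v l s) + r s)).
  move=> t tk; have tTh : `|t| <= Th.
    rewrite -(subrK s t); apply: le_trans (ler_normD _ _) _; rewrite /Th; lra.
  have b1 := hr t tTh.
  have b2 := HL t (dquot X v l t - lind X v t) tTh.
  have b3 := H1 v l l0 lv1 t tTh.
  have b4 := Hd (t - s); rewrite [s + _]addrC subrK in b4.
  have {}b4 := b4 (le_lt_trans tk kd).
  rewrite [X in `|X|](_ : _ = (TB (Phi t X) (lind X v t) - G) + TB (Phi t X)
    (dquot X v l t - lind X v t) + r t); last first.
    by rewrite tangentB; lmod_with R E.
  apply: le_trans (ler_normD _ _) _.
  apply: le_trans (lerD (ler_normD _ _) (lexx _)) _.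
  have b5 : L * `|dquot X v l t - lind X v t| <= e / 4.
    apply: le_trans (ler_wpM2l L0 b3) _.
    rewrite [leLHS](_ : _ = (L / (L + 1)) * (e / 4 / c * `|v|)); last by ring.
    apply: le_trans cv; rewrite ler_piMl//; first by rewrite mulr_ge0// ltW.
    by rewrite ler_pdivrMr// mul1r lerDl.
  lra.
rewrite [X in `|X|](_ : _ = (dquot X v l (s + k) - dquot X v l s - k *: G) -
  (dquot X v l (s + k) - lind X v (s + k)) + (dquot X v l s - lind X v s));
    last by lmod_with R E.
apply: le_trans (ler_normD _ _) _.
apply: le_trans (lerD (ler_normB _ _) (lexx _)) _.
lra.
Qed.

Lemma lind_unique X (u : R -> E) v :
  (forall s : R, is_derive s 1 u (TB (Phi s X) (u s))) -> u 0 = v -> u = lind X v.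
Proof.
move=> hu u0; apply/funext => s.
have [L L0 HL] := tangent_bound X `|s|.
apply/eqP; rewrite -subr_eq0 -normr_le0.
have := @linear_ode_bound X `|s| L (fun s => u s - lind X v s) 0 L0 HL.
rewrite mul0r u0 lind0 subrr normr0; apply => // t.
rewrite tangentB; apply: is_deriveB; exact: lind_ode.
Qed.

(** Directional derivatives need not depend linearly on the direction; here uniqueness for the
    linearised equation forces it. *)
Lemma lind_lin X k v w s : lind X (k *: v + w) s = k *: lind X v s + lind X w s.
Proof.
suff -> : lind X (k *: v + w) = (fun s => k *: lind X v s + lind X w s) by [].
apply/esym/lind_unique; last by rewrite !lind0.
move=> t; rewrite tangent_lin; apply: is_deriveD; last exact: lind_ode.
by apply: is_deriveZ; exact: lind_ode.
Qed.

Lemma flow_cont : continuous (fun p : R * E => Phi p.1 p.2).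
Proof.
move=> [s X]; apply/cont_epsP => e e0.
have [C [rho [C0 rho0 H]]] := flow_lip X (`|s| + 1).
have e20 : 0 < e / 2 by rewrite divr_gt0.
have [d d0 Hd] := (iffLR (cont_epsP _ _)) (@Phi_cont X s) _ e20.
exists (Num.min (Num.min d 1) (Num.min rho (e / 2 / C))).
  by rewrite !lt_min d0 ltr01 rho0 !divr_gt0.
move=> [k h]; rewrite prod_normE /= !lt_min !gt_max =>
  /andP[/andP[/andP[kd _] /andP[k1 _]] /andP[/andP[_ hr] /andP[_ he]]].
have sk : `|s + k| <= `|s| + 1 by apply: le_trans (ler_normD _ _) _; lra.
rewrite -(subrKA (Phi (s + k) X)); apply: le_trans (ler_normD _ _) _.
have := Hd k kd; have := H _ h sk hr; rewrite ltr_pdivlMr// in he; lra.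
Qed.

Lemma lind_bound X (Th : R) : exists2 C : R, 0 <= C &
  forall s v, `|s| <= Th -> `|lind X v s| <= C * `|v|.
Proof.
have [L L0 HL] := tangent_bound X Th.
exists (expR (L * Th)); first exact: expR_ge0.
move=> s v sTh; rewrite mulrC.
by apply: (linear_ode_bound L0 HL (lind_ode X v)) => //; rewrite lind0.
Qed.

Definition flow_diff (q : R * E) (k : R * E) : E :=
  k.1 *: B (Phi q.1 q.2) + lind q.2 k.2 q.1.

Lemma flow_is_diff (q : R * E) : is_diff q (fun p : R * E => Phi p.1 p.2) (flow_diff q).
Proof.
case: q => s X; apply: is_diff_eps.
- move=> k x y; rewrite /flow_diff /= lind_lin -[k *: x.1]/(k * x.1); lmod_with R E.
- have [C C0 HC] := lind_bound X `|s|.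
  have cl : Cn 0 (fun w => lind X w s).
    move=> w; apply/cont_epsP => e e0.
    have C1 : 0 < C + 1 by rewrite ltr_wpDl.
    exists (e / (C + 1)); first by rewrite divr_gt0.
    move=> h hd; have -> : w + h = 1 *: h + w by rewrite scale1r addrC.
    rewrite lind_lin scale1r addrK; apply: le_trans (HC _ _ (lexx _)) _.
    move: hd; rewrite ltr_pdivlMr//; have := normr_ge0 h; nra.
  exact: (Cn_add (Cn_scale (Cn_fst _ _ _) (Cn_cst _ _ _)) (Cn_comp (Cn_snd _ _ _) cl)).
- move=> e e0; have e20 : 0 < e / 2 by rewrite divr_gt0.
  have [rho rho0 H] := lind_approx X `|s| e20.
  have cBP : {for (s, X), continuous (fun p : R * E => B (Phi p.1 p.2))}.
    apply: (@continuous_comp _ _ _ (fun p : R * E => Phi p.1 p.2) B);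
      first exact: flow_cont.
    exact: (Cn_cont CB).
  have [d d0 Hd] := (iffLR (cont_epsP _ _)) cBP _ e20.
  exists (Num.min d rho); first by rewrite lt_min d0.
  move=> [k h] khd; have := khd; rewrite lt_min {1 2}prod_normE /= !gt_max =>
    /andP[/andP[kd hd] /andP[_ hr]].
  rewrite /flow_diff /=.
  (* Uniformity in the direction allows the step [l = 1], which turns the directional estimate into
     a Frechet one. *)
  have h1 := H h 1 (oner_neq0 _); rewrite scale1r in h1.
  have {}h1 := h1 hr s (lexx _); rewrite /dquot invr1 !scale1r in h1.
  have h2 : `|Phi (s + k) (X + h) - Phi s (X + h) - k *: B (Phi s X)| <= e / 2 * `|k|.
    apply: (mean_value_sym (df := fun r => B (Phi r (X + h)))) => r rk.
    have := Hd (r - s, h); rewrite prod_normE /= gt_max hd andbT [s + _]addrC subrK.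
    by move=> /(_ (le_lt_trans rk kd)).
  rewrite [X in `|X|](_ : _ = (Phi (s + k) (X + h) - Phi s (X + h) - k *: B (Phi s X)) +
    (Phi s (X + h) - Phi s X - lind X h s)); last by lmod_with R E.
  apply: le_trans (ler_normD _ _) _.
  have k1 : `|k| <= `|(k, h)| by rewrite prod_normE le_max lexx.
  have k2 : `|h| <= `|(k, h)| by rewrite prod_normE le_max lexx orbT.
  have := ler_wpM2l (ltW e20) k1; have := ler_wpM2l (ltW e20) k2; lra.
Qed.

(** The difference of two linearised orbits starts at [w] and solves a linear equation of rate
    [L + 1], with a source due to the change of base point; Gronwall bounds it. *)
Lemma lind_jcont : continuous (fun p : R * (E * E) => lind p.2.1 p.2.2 p.1).
Proof.
move=> [s [X v]]; apply/cont_epsP => e e0.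
pose Th := `|s| + 1; have Th0 : 0 < Th by rewrite ltr_wpDl.
have e20 : 0 < e / 2 by rewrite divr_gt0.
have [d d0 Hd] := (iffLR (cont_epsP _ _)) (@lind_cont X v s) _ e20.
have [L L0 HL] := tangent_bound X Th.
have [C0 C00 HC0] := lind_bound X Th.
pose ex := expR ((L + 1) * Th); have ex0 : 0 < ex := expR_gt0 _.
have D0 : 0 < 2 * (C0 * `|v| * Th * ex + 1)
  by rewrite mulr_gt0// ltr_wpDl// !mulr_ge0// ltW.
(* The source [e1 * (C0 * |v|)] then contributes at most [e / 4] after amplification, and the
   initial difference [w] another [e / 4]; continuity in time takes the remaining [e / 2]. *)
pose e1 := e / 2 / (2 * (C0 * `|v| * Th * ex + 1)).
have e10 : 0 < e1 by rewrite divr_gt0.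
have [rho1 rho10 H1] := tangent_unif X Th ltr01.
have [rho2 rho20 H2] := tangent_unif X Th e10.
have [C [rho [C1 rho0 H]]] := flow_lip X Th.
exists (Num.min (Num.min d 1) (Num.min (Num.min rho (Num.min rho1 rho2 / C)) (e / 4 / ex))).
  have m0 : 0 < Num.min rho1 rho2 by rewrite lt_min rho10.
  by rewrite !lt_min d0 ltr01 rho0 !divr_gt0.
move=> [k [h w]]; rewrite !prod_normE /= !lt_min !gt_max.
move=> /andP[/andP[/andP[kd _] /andP[k1 _]] /andP[/andP[/andP[_ /andP[hr _]] /andP[_
  /andP[hm _]]]]] /andP[_ /andP[_ we]].
rewrite ltr_pdivlMr// mulrC lt_min in hm; case/andP: hm => hm1 hm2.
have sk : `|s + k| <= Th by rewrite /Th; apply: le_trans (ler_normD _ _) _; lra.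
have Dh t : `|t| <= Th -> `|Phi t (X + h) - Phi t X| < rho1 /\
  `|Phi t (X + h) - Phi t X| < rho2.
  by move=> tTh; have := H t h tTh hr; lra.
have PE t : Phi t (X + h) = Phi t X + (Phi t (X + h) - Phi t X).
  by rewrite [RHS]addrC subrK.
rewrite -(subrKA (lind X v (s + k))); apply: le_trans (ler_normD _ _) _.
have h1 := Hd k kd.
suff : `|lind (X + h) (v + w) (s + k) - lind X v (s + k)| <= e / 2 by lra.
pose bd := (`|w| + e1 * (C0 * `|v|) * Th) * ex.
have bdE : bd <= e / 2.
  have : `|w| * ex <= e / 4 by rewrite ltr_pdivlMr// in we; lra.
  have : e1 * (C0 * `|v|) * Th * ex <= e / 4.
    have D1 : 0 < C0 * `|v| * Th * ex + 1 by move: D0; rewrite pmulr_rgt0.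
    rewrite /e1 [leLHS](_ : _ = (C0 * `|v| * Th * ex) / (C0 * `|v| * Th * ex + 1) *
      (e / 4)); last first.
      by field; rewrite gt_eqF.
    rewrite ler_piMl//; first by rewrite divr_ge0// ltW.
    by rewrite ler_pdivrMr// mul1r lerDl.
  by rewrite /bd; lra.
apply: le_trans bdE.
apply: (@gronwall_sym R E (fun t => lind (X + h) (v + w) t - lind X v t)
  (fun t => TB (Phi t (X + h)) (lind (X + h) (v + w) t) - TB (Phi t X) (lind X v t)) Th
    (L + 1) (e1 * (C0 * `|v|)) `|w| (bd + 1)) => //.
- by move=> t; apply: is_deriveB; exact: lind_ode.
- by rewrite addr_ge0.
- by apply: mulr_ge0; [exact: ltW|exact: mulr_ge0].
- by rewrite !lind0 addrAC subrr add0r.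
- move=> t tTh _; have [D1 D2] := Dh t tTh.
  set u := lind (X + h) _ t; set u0 := lind X v t.
  have b1 := H1 t _ (u - u0) tTh D1; rewrite -PE in b1.
  have b2 := H2 t _ u0 tTh D2; rewrite -PE in b2.
  have b3 := HL t (u - u0) tTh.
  have b4 := HC0 t v tTh.
  rewrite [X in `|X|](_ : _ = (TB (Phi t (X + h)) (u - u0) - TB (Phi t X) (u - u0)) + TB
    (Phi t X) (u - u0) + (TB (Phi t (X + h)) u0 - TB (Phi t X) u0)); last first.
    by rewrite !tangentB; lmod_with R E.
  apply: le_trans (ler_normD _ _) _.
  apply: le_trans (lerD (ler_normD _ _) (lexx _)) _.
  have := ler_wpM2l (ltW e10) b4; rewrite -/u0; lra.
- by rewrite -/ex -/bd ltrDl.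
Qed.

Lemma tangent_flow : tangent (fun p : R * E => Phi p.1 p.2) =
  fun u => u.2.1 *: B (Phi u.1.1 u.1.2) + lind u.1.2 u.2.2 u.1.1.
Proof. by apply/funext => u; rewrite /tangent (diff_val (is_diff_def :=
  flow_is_diff u.1)). Qed.

Lemma flow_C1 : Cn 1 (fun p : R * E => Phi p.1 p.2).
Proof.
split=> [p|]; first by case: (flow_is_diff p).
rewrite tangent_flow.
have C1 := @Cn_fst R 0 (R * E)%type (R * E)%type.
have C2 := @Cn_snd R 0 (R * E)%type (R * E)%type.
apply: (@Cn_add _ 0).
  apply: (@Cn_scale _ 0); first exact: (Cn_comp C2 (Cn_fst _ _ _)).
  apply: (@Cn_comp _ 0 _ _ _ fst (fun p : R * E => B (Phi p.1 p.2)) C1).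
  apply: (@Cn_comp _ 0 _ _ _ (fun p : R * E => Phi p.1 p.2) B); first exact: flow_cont.
  exact: (CnS CB).
apply: (@Cn_comp _ 0 _ _ _ (fun u : R * E * (R * E) => (u.1.1, (u.1.2, u.2.2)))
  (fun p : R * (E * E) => lind p.2.1 p.2.2 p.1) _ lind_jcont).
apply: Cn_pair; first exact: (Cn_comp C1 (Cn_fst _ _ _)).
apply: Cn_pair; first exact: (Cn_comp C1 (Cn_snd _ _ _)).
exact: (Cn_comp C2 (Cn_snd _ _ _)).
Qed.

End Flow.

Section FlowCn.
Context {R : realType}.

(* The linearised flow together with the flow is the flow of the tangent field,
   which has one derivative less. *)
Theorem flow_Cn n (E : normedModType R) (B : E -> E) (Phi : R -> E -> E) :
  fd E -> Cn n.+1 B -> (forall X, Phi 0 X = X) ->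
  (forall (th : R) X, is_derive th 1 (Phi^~ X) (B (Phi th X))) ->
  Cn n.+1 (fun p : R * E => Phi p.1 p.2).
Proof.
elim: n E B Phi => [|n IH] E B Phi fdE CB Phi0 Phi_ode; first exact: (flow_C1 fdE CB).
have CB1 : Cn 1 B by apply: Cn_le CB.
pose B2 (p : E * E) := (B p.1, tangent B p).
pose Phi2 (th : R) (p : E * E) := (Phi th p.1, lind Phi p.1 p.2 th).
have C2 : Cn n.+1 (fun p : R * (E * E) => Phi2 p.1 p.2).
  apply: (IH _ B2).
  - exact: fd_prod.
  - apply: Cn_pair; last by case: CB.
    exact: (Cn_comp (Cn_fst _ _ _) (CnS CB)).
  - by move=> [X v]; rewrite /Phi2 /= Phi0 lind0.
  - move=> th [X v]; rewrite /B2 /Phi2 /=.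
    have d1 := Phi_ode th X; have d2 := lind_ode fdE CB1 Phi0 Phi_ode X v th.
    apply/is_derive_epsP => e e0.
    have [r1 r10 H1] := (iffLR (is_derive_epsP _ _ _)) d1 e e0.
    have [r2 r20 H2] := (iffLR (is_derive_epsP _ _ _)) d2 e e0.
    exists (Num.min r1 r2); first by rewrite lt_min r10.
    move=> h; rewrite lt_min => /andP[hr1 hr2].
    by rewrite prod_normE /= ge_max H1//= H2.
split=> [p|]; first by case: (flow_is_diff fdE CB1 Phi0 Phi_ode p).
rewrite (tangent_flow fdE CB1 Phi0 Phi_ode).
have P1 := @Cn_fst R n.+1 (R * E)%type (R * E)%type.
have P2 := @Cn_snd R n.+1 (R * E)%type (R * E)%type.
have CP : Cn n.+1 (fun u : R * E * (R * E) => Phi2 u.1.1 (u.1.2, u.2.2)).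
  apply: (@Cn_comp _ n.+1 _ _ _ (fun u : R * E * (R * E) =>
    (u.1.1, (u.1.2, u.2.2))) _ _ C2).
  apply: Cn_pair; first exact: (Cn_comp P1 (Cn_fst _ _ _)).
  apply: Cn_pair; first exact: (Cn_comp P1 (Cn_snd _ _ _)).
  exact: (Cn_comp P2 (Cn_snd _ _ _)).
apply: Cn_add; last exact: (Cn_comp CP (Cn_snd _ _ _)).
apply: Cn_scale; first exact: (Cn_comp P2 (Cn_fst _ _ _)).
exact: (Cn_comp (Cn_comp CP (Cn_fst _ _ _)) (CnS CB)).
Qed.

End FlowCn.

(** * Integrals and partial derivatives *)

Section Components.
Context {R : realType}.

Lemma is_derive_pair (E F : normedModType R) (u : R -> E) (w : R -> F) (t : R) du dw :
  is_derive t 1 u du -> is_derive t 1 w dw ->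
  is_derive t 1 (fun s => (u s, w s)) (du, dw).
Proof.
move=> d1 d2; apply/is_derive_epsP => e e0.
have [r1 r10 H1] := (iffLR (is_derive_epsP _ _ _)) d1 e e0.
have [r2 r20 H2] := (iffLR (is_derive_epsP _ _ _)) d2 e e0.
exists (Num.min r1 r2); first by rewrite lt_min r10.
move=> h; rewrite lt_min => /andP[hr1 hr2].
by rewrite prod_normE /= ge_max H1//= H2.
Qed.

Lemma rV_coord_sum d (v : 'rV[R]_d) : v = \sum_i v 0 i *: delta_mx 0 i.
Proof. exact: row_sum_delta. Qed.

Lemma is_derive_rowP d (u : R -> 'rV[R]_d) (t : R) (du : 'rV[R]_d) :
  (forall i, is_derive t 1 (fun s => u s 0 i) (du 0 i)) -> is_derive t 1 u du.
Proof.
move=> H.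
have -> : u = \sum_i (fun s => u s 0 i *: (delta_mx 0 i : 'rV[R]_d)).
  by apply/funext => s; rewrite fct_sumE [LHS]rV_coord_sum.
rewrite [du]rV_coord_sum; apply: is_derive_sum => i.
apply/is_derive_epsP => e e0.
have [r r0 Hr] := (iffLR (is_derive_epsP _ _ _)) (H i) e e0.
exists r => // h hr; rewrite scalerA -!scalerBl normrZ.
have n1 : `|(delta_mx 0 i : 'rV[R]_d)| <= 1.
  rewrite [leLHS]mx_normrE; apply/bigmax_leP; split=> //= -[a b] _ /=.
  by rewrite mxE; case: (_ && _); rewrite ?normr1 ?normr0.
apply: le_trans (Hr h hr); exact: ler_piMr.
Qed.

Lemma coord_norm d (v : 'rV[R]_d) i : `|v 0 i| <= `|v|.
Proof.
rewrite [leRHS]mx_normrE.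
exact: (le_bigmax _ (fun p : 'I_1 * 'I_d => `|v p.1 p.2|) (0, i)).
Qed.

Definition coordl d (i : 'I_d) (v : 'rV[R]_d) : R := v 0 i.

Fact coordl_linear d (i : 'I_d) : linear (coordl i).
Proof. by move=> k u v; rewrite /coordl !mxE. Qed.

HB.instance Definition _ d (i : 'I_d) :=
  GRing.isLinear.Build R 'rV[R]_d R *:%R (coordl i) (coordl_linear i).

Lemma coordl_continuous d (i : 'I_d) : continuous (coordl i).
Proof. by move=> v; exact: coord_continuous. Qed.

Lemma Cn_coord n d (i : 'I_d) : Cn n (fun v : 'rV[R]_d => v 0 i).
Proof. exact: (Cn_lin _ (@coordl_continuous d i)). Qed.

Lemma Cn_sum n (E F : normedModType R) (I : Type) (r : seq I) (P : pred I) (f : I -> E ->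
  F) :
  (forall i, P i -> Cn n (f i)) -> Cn n (fun x => \sum_(i <- r | P i) f i x).
Proof.
move=> H; elim: r => [|i r IH].
  by under eq_fun do rewrite big_nil; exact: Cn_cst.
have [Pi|nPi] := boolP (P i).
  by under eq_fun do rewrite big_cons Pi; apply: Cn_add => //; exact: H.
by under eq_fun do rewrite big_cons (negbTE nPi).
Qed.

Lemma Cn_rowP n (E : normedModType R) d (f : E -> 'rV[R]_d) :
  (forall i, Cn n (fun x => f x 0 i)) -> Cn n f.
Proof.
move=> H; have -> : f = fun x => \sum_i f x 0 i *: (delta_mx 0 i : 'rV[R]_d).
  by apply/funext => x; exact: rV_coord_sum.
by apply: Cn_sum => i _; apply: Cn_scale => //; exact: Cn_cst.
Qed.

Lemma Cn_opp n (E F : normedModType R) (f : E -> F) :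
  Cn n f -> Cn n (fun x => - f x).
Proof.
move=> Cf; have -> : (fun x => - f x) = (fun x => (-1 : R) *: f x).
  by apply/funext => x; rewrite scaleN1r.
by apply: Cn_scale => //; exact: Cn_cst.
Qed.

Lemma Cn_sub n (E F : normedModType R) (f g : E -> F) :
  Cn n f -> Cn n g -> Cn n (fun x => f x - g x).
Proof. by move=> Cf Cg; apply: Cn_add => //; exact: Cn_opp. Qed.

End Components.

Section Integral.
Context {R : realType}.
Local Notation mu := (@lebesgue_measure R).

Lemma is_derive_itv_integral (f : R -> R) (t : R) : continuous f ->
  is_derive t 1 (fun th => if 0 <= th then \int[mu]_(s in `[0, th]) f s
                           else - \int[mu]_(s in `[th, 0]) f s) (f t).
Proof.
move=> cf.
(* A base point to the left of both 0 and [t]. Near [t] the two branches of the oriented integral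
   are then the single expression [G th - G 0], even for [t = 0]. *)
pose A := - `|t| - 1.
have itg a b : mu.-integrable `[a, b] (EFin \o f).
  apply: continuous_compact_integrable; first exact: segment_compact.
  exact: continuous_subspaceT.
pose G x := \int[mu]_(s in `[A, x]) f s.
have GB x y : A <= x -> x <= y -> G y - G x = \int[mu]_(s in `[x, y]) f s.
  move=> Ax xy; rewrite /G Rintegral_itvB//.
  apply: (@Rintegral_itv_obnd_cbnd R x (BRight y) f); apply: integrableS (itg x y) => //.
  by apply: subset_itvr; rewrite bnd_simp.
have At : A < t by rewrite /A; have := ler_norm (- t); rewrite normrN; lra.
have A0 : A < 0 by rewrite /A; have := normr_ge0 t; lra.
have GE th : A <= th -> (if 0 <= th then \int[mu]_(s in `[0, th]) f s
                           else - \int[mu]_(s in `[th, 0]) f s) = G th - G 0.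
  move=> Ath; case: leP => th0; first by rewrite GB// ltW.
  by rewrite -GB ?opprB// ltW.
have [dG vG] : derivable G t 1 /\ G^`()%classic t = f t.
  apply: (@continuous_FTC1 R f (BLeft A) t (t + 1)) => //; first by rewrite ltrDl.
  exact: cf.
apply: (@near_eq_is_derive _ _ _ (fun th => G th - G 0)).
  near=> th; rewrite GE//; near: th.
  apply/nbhs_normP; exists (t - A); first by rewrite /= subr_gt0.
  by move=> y /=; rewrite ltr_norml; lra.
have d1 : is_derive t 1 G (f t) by split; [exact: dG|rewrite -derive1E].
by apply: is_derive_eq; rewrite subr0.
Unshelve. all: by end_near. Qed.

Lemma vint0 d (F : R -> 'rV[R]_d) : vint 0 0 F = 0.
Proof.
apply/rowP => i; rewrite !mxE lexx set_itv1; exact: Rintegral_set1.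
Qed.

Lemma is_derive_vint d (F : R -> 'rV[R]_d) (t : R) : continuous F ->
  is_derive t 1 (fun th => vint 0 th F) (F t).
Proof.
move=> cF; apply: is_derive_rowP => i.
under eq_fun do rewrite mxE; apply: is_derive_itv_integral => s.
apply: (@continuous_comp _ _ _ F (fun v : 'rV[R]_d => v 0 i)); first exact: cF.
exact: coord_continuous.
Qed.

(* The integral is a component of the flow of [(e, s, w) |-> (0, 1, g (s, e))]. *)
Lemma Cn_vint n (E : normedModType R) d (g : R * E -> 'rV[R]_d) :
  fd E -> Cn n.+1 g -> Cn n.+1 (fun p : R * E => vint 0 p.1 (fun s => g (s, p.2))).
Proof.
move=> fE Cg.
pose S := (E * (R * 'rV[R]_d))%type.
pose J th e := vint 0 th (fun s => g (s, e)).
pose B (X : S) : S := (0, (1, g (X.2.1, X.1))).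
pose Phi th (X : S) : S := (X.1, (X.2.1 + th, X.2.2 + (J (X.2.1 + th) X.1 - J X.2.1 X.1))).
have cg e : continuous (fun s => g (s, e)).
  have C1 : Cn n.+1 (fun s : R => g (s, e)).
    by apply: (@Cn_comp _ n.+1 _ _ _ (fun s : R => (s, e)) g) => //; apply: Cn_pair;
      [exact: Cn_id|exact: Cn_cst].
  exact: (Cn_cont C1).
have CP : Cn n.+1 (fun p : R * S => Phi p.1 p.2).
  apply: (@flow_Cn R n S B).
  - by apply: fd_prod => //; apply: fd_prod; [exact: fd_R|exact: fd_rV].
  - apply: Cn_pair; first exact: Cn_cst.
    apply: Cn_pair; first exact: Cn_cst.
    apply: (@Cn_comp _ n.+1 _ _ _ (fun X : S => (X.2.1, X.1)) g) => //.
    by apply: Cn_pair; [exact: (Cn_comp (Cn_snd _ _ _) (Cn_fst _ _ _))|exact: Cn_fst].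
  - by move=> [e [s w]]; rewrite /Phi /= addr0 subrr addr0.
  - move=> th [e [s w]]; rewrite /Phi /B /=.
    have dl : is_derive th 1 (fun r : R => s + r) 1.
      apply/is_derive_epsP => r r0; exists 1 => // h _.
      have -> : s + (th + h) - (s + th) - h *: 1 = 0.
        by rewrite -[h *: 1]/(h * 1); ring.
      by rewrite normr0 mulr_ge0// ltW.
    have dc0 := is_derive_cst e th (1 : R).
    apply: (is_derive_pair dc0).
    apply: is_derive_pair => //.
    have dJ := is_derive_vint (s + th) (cg e).
    have := is_derive_comp dl (f := fun r => J r e).
    move=> /(_ ltac:(by apply/derivable1_diffP; case: dJ)).
    rewrite diff1E; last by apply/derivable1_diffP; case: dJ.
    rewrite scale1r derive1E; have -> : 'D_1 (J^~ e) (s + th) = g (s + th, e) by case: dJ.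
    move=> d2; have d3 : is_derive th 1 (fun r => J (s + r) e) (g (s + th, e)) by [].
    by apply: is_derive_eq; rewrite subr0 add0r.
have CJ : Cn n.+1 (fun p : R * E => (Phi p.1 (p.2, (0, 0))).2.2).
  apply: (@Cn_comp _ n.+1 _ _ _ (fun p : R * E => Phi p.1 (p.2, (0, 0))) (fun X : S =>
    X.2.2)).
    apply: (@Cn_comp _ n.+1 _ _ _ (fun p : R * E => (p.1, (p.2, (0, 0)) : S)) _ _ CP).
    apply: Cn_pair; first exact: Cn_fst.
    by apply: Cn_pair; [exact: Cn_snd|exact: Cn_cst].
  exact: (Cn_comp (Cn_snd _ _ _) (Cn_snd _ _ _)).
have -> : (fun p : R * E => vint 0 p.1 (fun s => g (s, p.2))) = (fun p : R * E =>
  (Phi p.1 (p.2, (0, 0))).2.2); last by [].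
by apply/funext => p; rewrite /Phi /= !add0r /J vint0 subr0.
Qed.

End Integral.

Section Partials.
Context {R : realType} (E : normedModType R) (I : finType).
Variables (v : I -> E) (c : I -> {linear E -> R}).
Hypothesis cc : forall i, continuous (c i).
Hypothesis cv : forall w, w = \sum_i c i w *: v i.

Let cbound i : exists2 M : R, 0 < M & forall w, `|c i w| <= M * `|w|.
Proof.
have : {for 0, continuous (c i)} by exact: cc.
move=> /continuous_linear_bounded /linear_boundedP [M [_ HM]].
exists (`|M| + 1); first by rewrite ltr_wpDl.
by move=> w; apply: HM; rewrite (le_lt_trans (ler_norm _))// ltrDl.
Qed.

(** The chain rule for differentiable maps cannot be invoked: differentiability of [f] is what the
    partial derivatives are about to establish. *)
Lemma is_derive_dirline (f : E -> R) (x h : E) (t : R) :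
  derivable f (x + t *: h) h ->
  is_derive t 1 (fun s : R => f (x + s *: h)) ('D_h f (x + t *: h)).
Proof.
set y := x + t *: h => dy; apply/is_derive_epsP => e e0.
have Hl : k^-1 *: ((f \o shift y) (k *: h) - f y) @[k --> (0 :
  R)^'] --> 'D_h f y by exact: dy.
move/cvgrPdist_le: Hl => /(_ e e0); rewrite /dnbhs near_withinE.
move=> /nbhs_norm0P [d /= d0 Hd]; exists d => // k kd.
have -> : x + (t + k) *: h = k *: h + y by rewrite /y scalerDl addrA addrC.
rewrite -/y; have [->|k0] := eqVneq k 0.
  by rewrite !scale0r add0r subrr subr0 normr0 mulr_ge0// ltW.
have := Hd k kd k0; set D := 'D_h f y.
have -> : f (k *: h + y) - f y - k *: D = - (k *: (D - k^-1 *: (f (k *: h + y) - f y))).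
  by rewrite scalerBr scalerA divff// scale1r opprB.
by rewrite normrN normrZ mulrC => ?; apply: ler_wpM2r.
Qed.

(* Telescoping along the directions [v i], one coordinate at a time. *)
Lemma partial_telescope (f : E -> R) (x : E) (r : seq I) :
  (forall i y, derivable f y (v i)) -> (forall i, continuous ('D_(v i) f)) ->
  forall e : R, 0 < e -> exists2 d : R, 0 < d & forall w, `|w| < d ->
    `|f (x + \sum_(i <- r) c i w *: v i) - f x
      - \sum_(i <- r) c i w *: 'D_(v i) f x| <= e * `|w|.
Proof.
move=> df cf; elim: r => [|i r IH] e e0.
  by exists 1 => // w _; rewrite !big_nil addr0 subrr subr0 normr0 mulr_ge0// ltW.
have e20 : 0 < e / 2 by rewrite divr_gt0.
have [d1 d10 H1] := IH _ e20.
have [M M0 HM] := cbound i.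
have eM0 : 0 < e / 2 / M by rewrite divr_gt0.
have [d2 d20 H2] := (iffLR (cont_epsP _ _)) (cf i x) _ eM0.
have [K K0 HK] : exists2 K : R, 0 < K & forall w, forall t : R, `|t| <= 1 ->
  `|\sum_(j <- r) c j w *: v j + (t * c i w) *: v i| <= K * `|w|.
  have [K K0 HK] : exists2 K : R, 0 < K
    & forall w, `|\sum_(j <- r) c j w *: v j| <= K * `|w|.
    elim: (r) => [|j s [K K0 HK]].
      by exists 1 => // w; rewrite big_nil normr0 mul1r.
    have [Mj Mj0 HMj] := cbound j.
    exists (Mj * `|v j| + K); first by rewrite ltr_wpDl// mulr_ge0// ltW.
    move=> w; rewrite big_cons; apply: le_trans (ler_normD _ _) _.
    rewrite mulrDl; apply: lerD => //; rewrite normrZ mulrAC.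
    by apply: ler_wpM2r.
  exists (K + M * `|v i|); first by rewrite ltr_wpDr// mulr_ge0// ltW.
  move=> w t t1; apply: le_trans (ler_normD _ _) _.
  rewrite mulrDl; apply: lerD => //; rewrite normrZ mulrAC; apply: ler_wpM2r => //.
  rewrite normrM; apply: le_trans (HM w); exact: ler_piMl.
exists (Num.min d1 (d2 / K)); first by rewrite lt_min d10 divr_gt0.
move=> w; rewrite lt_min ltr_pdivlMr// => /andP[wd1 wd2].
set S := \sum_(j <- r) c j w *: v j.
have h2 : `|f (x + S + c i w *: v i) - f (x + S) - c i w *: 'D_(v i) f x| <= e / 2 * `|w|.
  have := @mean_value_sym R R (fun s => f (x + S + s *: v i)) (fun s =>
    'D_(v i) f (x + S + s *: v i)) 0 (c i w) ('D_(v i) f x) (e / 2 / M).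
  rewrite add0r scale0r addr0 => Hm; apply: le_trans (Hm _ _) _.
  - by move=> s _; exact: is_derive_dirline.
  - move=> s; rewrite subr0 => sc; rewrite -addrA; apply: H2.
    have [c0|c0] := eqVneq (c i w) 0.
      have s0 : s = 0 by apply/eqP; rewrite -normr_le0; rewrite c0 normr0 in sc.
      have := HK w 0; rewrite mul0r s0 normr0 => /(_ ler01) h.
      by apply: le_lt_trans h _; rewrite mulrC.
    have := HK w (s / c i w); rewrite normrM normfV ler_pdivrMr ?normr_gt0// mul1r =>
      /(_ sc).
    by rewrite divfK// => h; apply: le_lt_trans h _; rewrite mulrC.
  - rewrite -mulrA; apply: ler_wpM2l; first exact: ltW.
    by rewrite ler_pdivrMl.
have h1 := H1 w wd1; rewrite -/S in h1.
rewrite !big_cons -/S addrA [x + _ + S]addrAC.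
set D := \sum_(j <- r) _ in h1 *.
rewrite [X in `|X|](_ : _ = (f (x + S + c i w *: v i) - f
  (x + S) - c i w *: 'D_(v i) f x) + (f (x + S) - f x - D)); last by lmod_with R R.
apply: le_trans (ler_normD _ _) _; lra.
Qed.

Lemma partial_is_diff (f : E -> R) (x : E) :
  (forall i y, derivable f y (v i)) -> (forall i, continuous ('D_(v i) f)) ->
  is_diff x f (fun w => \sum_i c i w *: 'D_(v i) f x).
Proof.
move=> df cf; apply: is_diff_eps.
- move=> k u w; rewrite scaler_sumr -big_split /=; apply: eq_bigr => i _.
  by rewrite linearD linearZ /= scalerDl scalerA.
- apply: (@Cn_sum _ 0) => i _; apply: (@Cn_scale _ 0); first exact: cc.
  exact: (@Cn_cst _ 0).
- move=> e e0; have [d d0 H] := partial_telescope x (index_enum I) df cf e0.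
  by exists d => // w wd; have := H w wd; rewrite -cv.
Qed.

(** The tangent map is a sum of coordinates of the direction times partial derivatives, and the
    induction hypothesis applies to the latter. *)
Lemma Cn_of_Cb (e : seq E) (f : E -> R) n : (forall i, v i \in e) ->
  Cb e n f -> Cn n f.
Proof.
move=> ve; elim: n f => [|n IH] f; first by case.
move=> [_ _ H].
have df i y : derivable f y (v i) by case: (H _ (ve i)).
have CD i : Cn n ('D_(v i) f) by apply: IH; case: (H _ (ve i)).
have D x := partial_is_diff x df (fun i => Cn_cont (CD i)).
split=> [x|]; first by case: (D x).
have -> : tangent f = fun p => \sum_i c i p.2 *: 'D_(v i) f p.1.
  by apply/funext => p; rewrite /tangent (diff_val (is_diff_def := D p.1)).
apply: Cn_sum => i _; apply: Cn_scale; last exact: (Cn_comp (Cn_fst _ _ _) (CD i)).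
exact: (Cn_comp (Cn_snd _ _ _) (Cn_lin _ (@cc i))).
Qed.

Lemma Cb_tangent_bound (e : seq E) (f : E -> R) n : (forall i, v i \in e) ->
  Cb e n.+1 f -> exists2 M : R, 0 <= M & forall x w, `|tangent f (x, w)| <= M * `|w|.
Proof.
move=> ve [_ _ H].
have df i y : derivable f y (v i) by case: (H _ (ve i)).
have CD i : continuous ('D_(v i) f) by case: (H _ (ve i)) => _; case: (n) => [[]|?[]].
have HD i : exists M : R, forall x, `|'D_(v i) f x| <= M.
  by case: (H _ (ve i)) => _; case: (n) => [[]|?[]].
have D x := partial_is_diff x df CD.
have [M HM] := choice HD.
have HK0 i : exists k : R, 0 < k /\ forall w, `|c i w| <= k * `|w|.
  by have [K K0 HK] := cbound i; exists K.
have [K HK] := choice HK0.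
exists (\sum_i K i * `|M i|).
  by apply: sumr_ge0 => i _; apply: mulr_ge0 => //; apply: ltW; case: (HK i).
move=> x w; rewrite /tangent /= (diff_val (is_diff_def := D x)).
apply: le_trans (ler_norm_sum _ _ _) _; rewrite mulr_suml; apply: ler_sum => i _.
rewrite normrZ mulrAC; case: (HK i) => K0 HKi.
apply: ler_pM => //; exact: le_trans (HM i x) (ler_norm _).
Qed.

End Partials.

(** * Regularity of alpha^0 *)

Section TangentCalculus.
Context {R : realType}.

Lemma tangent_comp (E F G : normedModType R) (f : E -> F) (g : F -> G) x v :
  differentiable f x -> differentiable g (f x) ->
  tangent (g \o f) (x, v) = tangent g (f x, tangent f (x, v)).
Proof. by move=> df dg; rewrite /tangent /= diff_comp. Qed.

Lemma tangent_pair (E F G : normedModType R) (f : E -> F) (g : E -> G) p :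
  differentiable f p.1 -> differentiable g p.1 ->
  tangent (fun x => (f x, g x)) p = (tangent f p, tangent g p).
Proof. by move=> df dg; rewrite /tangent diff_pair. Qed.

Lemma tangent_cst (E F : normedModType R) (c : F) (p : E * E) :
  tangent (fun _ : E => c) p = 0.
Proof. by rewrite /tangent (diff_cst c). Qed.

Lemma tangent_linear (E F : normedModType R) (f : {linear E -> F}) p :
  continuous f -> tangent f p = f p.2.
Proof. by move=> cf; rewrite /tangent diff_lin. Qed.

Lemma tangent_id (E : normedModType R) (p : E * E) : tangent (fun x : E => x) p = p.2.
Proof. by apply: (@tangent_linear _ _ idfun) => x; exact: cvg_id. Qed.

Lemma tangent_snd (E F : normedModType R) p : tangent (@snd E F) p = p.2.2.
Proof. by apply: (@tangent_linear _ _ snd) => x; exact: cvg_snd. Qed.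

Lemma tangent_coord (E : normedModType R) d (f : E -> 'rV[R]_d) p i :
  differentiable f p.1 -> tangent f p 0 i = tangent (fun x => f x 0 i) p.
Proof.
case: p => x v /= df.
have dc (y : 'rV[R]_d) : differentiable (coordl i) y by apply: linear_differentiable;
  exact: coordl_continuous.
have := tangent_comp (g := coordl i) v df (dc _).
by rewrite tangent_linear; last exact: coordl_continuous.
Qed.

Lemma is_derive_tangent (E F : normedModType R) (f : E -> F) (c h : E) (t : R) :
  differentiable f (c + t *: h) ->
  is_derive t 1 (fun s : R => f (c + s *: h)) (tangent f (c + t *: h, h)).
Proof. exact: is_derive_line_comp. Qed.

Lemma tangent_lipschitz (E F : normedModType R) (f : E -> F) (L : R) :
  (forall x, differentiable f x) ->
  (forall x w, `|tangent f (x, w)| <= L * `|w|) ->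
  forall x y, `|f x - f y| <= L * `|x - y|.
Proof.
move=> df HL x y.
have := @mean_value_sym R F (fun r => f (y + r *: (x - y))) _ 0 1 0 (L * `|x - y|)
  (fun r _ => is_derive_tangent (df _)).
rewrite add0r scale0r addr0 !scale1r subr0 normr1 mulr1 [y + _]addrC subrK; apply.
by move=> r _; rewrite subr0; exact: HL.
Qed.

Lemma rV_norm_le d (v : 'rV[R]_d) (M : R) : 0 <= M ->
  (forall i, `|v 0 i| <= M) -> `|v| <= M.
Proof.
move=> M0 HM; rewrite [leLHS]mx_normrE; apply/bigmax_leP; split=> //= -[a j] _ /=.
by rewrite (ord1 a).
Qed.

End TangentCalculus.

Section Periodic.
Context {R : realType}.

Lemma periodic_reduce (P th : R) : 0 < P -> exists2 th', 0 <= th' <= P &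
  forall (T : Type) (f : R -> T), (forall x, f (x + P) = f x) -> f th = f th'.
Proof.
move=> P0; pose k := Num.floor (th / P).
have kP (T : Type) (f : R -> T) : (forall x, f (x + P) = f x) ->
    forall (n : nat) x, f (x + P *+ n) = f x.
  move=> fP; elim=> [|n IH] x; first by rewrite addr0.
  by rewrite mulrSr addrA fP.
exists (th - P * k%:~R).
  have /andP[h1 h2] := floor_itv (th / P).
  rewrite ler_pdivlMr// in h1; rewrite ltr_pdivrMr// in h2.
  rewrite intrD in h2; move: h1 h2; rewrite -/k; set K : R := k%:~R; nra.
move=> T f fP; rewrite mulrzr.
case: k => n.
  rewrite -pmulrn.
  by rewrite -[in LHS](subrK (P *+ n) th) kP.
by rewrite NegzE mulrNz opprK kP.
Qed.

End Periodic.

Section FastFlow.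
Context {R : realType} {d m : nat}.
Local Notation V := 'rV[R]_d.
Variables (a : R -> R -> V -> V) (b : R -> V -> V) (Z : R -> R -> V -> V).
Hypothesis a_Cb : forall i, Cb (coord_dirs_tthx d) m.+1
  (fun p : R * R * V => a p.1.1 p.1.2 p.2 0 i).
Hypothesis a_per : forall (t th : R) x, a t (th + 2 * pi) x = a t th x.
Hypothesis b_Cb : forall i, Cb (coord_dirs_tx d) m.+2
  (fun p : R * V => b p.1 p.2 0 i).
Hypothesis Z_ode : forall (t th : R) z,
  is_derive th 1 (fun th' => Z t th' z) (b t (Z t th z)).
Hypothesis Z_init : forall t z, Z t 0 z = z.
Hypothesis Z_per : forall (t th : R) z, Z t (th + 2 * pi) z = Z t th z.

Let tx_dir (i : 'I_(1 + d)) : R * V :=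
  match fintype.split i with inl _ => (1, 0) | inr j => (0, delta_mx 0 j) end.
Let tx_coord (i : 'I_(1 + d)) : {linear (R * V)%type -> R} :=
  match fintype.split i with inl _ => (fst : {linear (R * V)%type -> R})
  | inr j => (coordl j \o snd : {linear (R * V)%type -> R}) end.

Let tx_coord_cont i : continuous (tx_coord i).
Proof.
rewrite /tx_coord; case: (fintype.split i) => j; first exact: (@Cn_fst R 0).
exact: (Cn_comp (@Cn_snd R 0 _ _) (@Cn_coord R 0 d j)).
Qed.

Let tx_sum w : w = \sum_i tx_coord i w *: tx_dir i.
Proof.
rewrite big_split_ord big_ord1 /tx_coord /tx_dir /=.
have -> : fintype.split (lshift d (ord0 : 'I_1)) = inl ord0 by exact: (unsplitK (inl _)).
under eq_bigr => i _ do rewrite (unsplitK (inr i)) /=.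
move: w => [w1 w2] /=.
have -> : \sum_(i < d) coordl i w2 *: ((0, delta_mx 0 i) : R * V) = (0, w2).
  rewrite [in RHS](rV_coord_sum w2); elim/big_ind2 : _ => //.
    by move=> x1 x2 y1 y2 -> ->; congr pair; rewrite /= addr0.
  by move=> i _; congr pair; rewrite /= scaler0.
congr pair; rewrite /= ?scaler0 ?add0r// addr0; exact/esym/mulr1.
Qed.

Let tx_mem i : tx_dir i \in coord_dirs_tx d.
Proof.
rewrite /tx_dir /coord_dirs_tx /coord_dirs inE; case: (fintype.split i) => j.
  by rewrite eqxx.
apply/orP; right; apply/mapP; exists (delta_mx 0 j) => //.
by apply: map_f; rewrite mem_enum.
Qed.

Let bF (p : R * V) := b p.1 p.2.

Let bF_Cn : Cn m.+2 bF.
Proof. by apply: Cn_rowP => i; apply: (Cn_of_Cb tx_coord_cont tx_sum tx_mem (b_Cb i)). Qed.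

Let bF_bound : exists2 L : R, 0 <= L & forall x w, `|tangent bF (x, w)| <= L * `|w|.
Proof.
have HM0 i : exists M : R, 0 <= M /\ forall x w, `|tangent (fun p =>
  bF p 0 i) (x, w)| <= M * `|w|.
  by have [M M0 HM] := Cb_tangent_bound tx_coord_cont tx_sum tx_mem (b_Cb i); exists M.
have [M HM] := choice HM0.
exists (\sum_i M i); first by apply: sumr_ge0 => i _; case: (HM i).
move=> x w; apply: rV_norm_le.
  by apply: mulr_ge0 => //; apply: sumr_ge0 => i _; case: (HM i).
move=> i; rewrite tangent_coord; last by case: bF_Cn.
case: (HM i) => M0 /(_ x w) h; apply: le_trans h _; apply: ler_wpM2r => //.
by rewrite (bigD1 i)//= lerDl; apply: sumr_ge0 => j _; case: (HM j).
Qed.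

Let tthx_dir (i : 'I_(1 + (1 + d))) : R * R * V :=
  match fintype.split i with
  | inl _ => (1, 0, 0)
  | inr j => match fintype.split j with
             | inl _ => (0, 1, 0)
             | inr k => (0, 0, delta_mx 0 k)
             end
  end.
Let tthx_coord (i : 'I_(1 + (1 + d))) : {linear (R * R * V)%type -> R} :=
  match fintype.split i with
  | inl _ => (fst \o fst : {linear (R * R * V)%type -> R})
  | inr j => match fintype.split j with
             | inl _ => (snd \o fst : {linear (R * R * V)%type -> R})
             | inr k => (coordl k \o snd : {linear (R * R * V)%type -> R})
             end
  end.

Let tthx_coord_cont i : continuous (tthx_coord i).
Proof.
rewrite /tthx_coord; case: (fintype.split i) => j.
  exact: (Cn_comp (@Cn_fst R 0 _ _) (@Cn_fst R 0 _ _)).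
case: (fintype.split j) => k.
  exact: (Cn_comp (@Cn_fst R 0 _ _) (@Cn_snd R 0 _ _)).
exact: (Cn_comp (@Cn_snd R 0 _ _) (@Cn_coord R 0 d k)).
Qed.

Let tthx_sum w : w = \sum_i tthx_coord i w *: tthx_dir i.
Proof.
rewrite big_split_ord big_ord1 big_split_ord big_ord1 /tthx_coord /tthx_dir /=.
have -> : fintype.split (lshift (1 + d) (ord0 :
  'I_1)) = inl ord0 by exact: (unsplitK (inl _)).
have E j : fintype.split (rshift 1 j :
  'I_(1 + (1 + d))) = inr j by exact: (unsplitK (inr j)).
rewrite E.
have -> : fintype.split (lshift d (ord0 : 'I_1)) = inl ord0 by exact: (unsplitK (inl _)).
under eq_bigr => i _ do rewrite E (unsplitK (inr i)) /=.
move: w => [[w0 w1] w2] /=.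
have -> : \sum_(i < d) coordl i w2 *: ((0, 0, delta_mx 0 i) : R * R * V) = (0, 0, w2).
  rewrite [in RHS](rV_coord_sum w2); elim/big_ind2 : _ => //.
    by move=> x1 x2 y1 y2 -> ->; congr (_, _); rewrite /= ?addr0//; congr (_, _);
      rewrite /= addr0.
  by move=> i _; congr (_, _); rewrite /= ?scaler0//; congr (_, _); rewrite /= scaler0.
congr (_, _); rewrite /= ?scaler0 ?add0r//.
congr (_, _); rewrite /= ?scaler0 ?add0r// ?addr0; exact/esym/mulr1.
Qed.

Let tthx_mem i : tthx_dir i \in coord_dirs_tthx d.
Proof.
rewrite /tthx_dir /coord_dirs_tthx /coord_dirs !inE; case: (fintype.split i) => j.
  by rewrite eqxx.
case: (fintype.split j) => k; first by rewrite eqxx orbT.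
apply/orP; right; apply/orP; right; apply/mapP; exists (delta_mx 0 k) => //.
by apply: map_f; rewrite mem_enum.
Qed.

Let aF (p : R * (R * V)) := a p.1 p.2.1 p.2.2.

Let aF_Cn : Cn m.+1 aF.
Proof.
have H : Cn m.+1 (fun p : R * R * V => a p.1.1 p.1.2 p.2).
  by apply: Cn_rowP => i; apply: (Cn_of_Cb tthx_coord_cont tthx_sum tthx_mem (a_Cb i)).
apply: (@Cn_comp _ m.+1 _ _ _ (fun p : R * (R * V) => (p.1, p.2.1, p.2.2)) _ _ H).
apply: Cn_pair; last exact: (Cn_comp (Cn_snd _ _ _) (Cn_snd _ _ _)).
by apply: Cn_pair; [exact: Cn_fst|exact: (Cn_comp (Cn_snd _ _ _) (Cn_fst _ _ _))].
Qed.

Let a_bound : exists M : R, forall t th x, `|a t th x| <= M.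
Proof.
have HM0 i : exists M : R, 0 <= M /\ forall t th x, `|a t th x 0 i| <= M.
  have [_ [M HM] _] := a_Cb i; exists `|M|; split=> // t th x.
  exact: le_trans (HM (t, th, x)) (ler_norm _).
have [M HM] := choice HM0; exists (\sum_i M i) => t th x.
apply: rV_norm_le; first by apply: sumr_ge0 => i _; case: (HM i).
move=> i; case: (HM i) => M0 /(_ t th x) h; apply: le_trans h _.
by rewrite (bigD1 i)//= lerDl; apply: sumr_ge0 => j _; case: (HM j).
Qed.

Let B (X : R * V) : R * V := (0, bF X).
Let Phi (th : R) (X : R * V) : R * V := (X.1, Z X.1 th X.2).

Let B_Cn : Cn m.+2 B.
Proof. by apply: Cn_pair => //; exact: Cn_cst. Qed.

Let Phi0 X : Phi 0 X = X.
Proof. by case: X => t z; rewrite /Phi /= Z_init. Qed.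

Let Phi_ode (th : R) X : is_derive th 1 (Phi^~ X) (B (Phi th X)).
Proof.
have dc0 := is_derive_cst X.1 th (1 : R).
exact: (is_derive_pair dc0 (Z_ode X.1 th X.2)).
Qed.

Let fdE : fd (R * V)%type. Proof. by apply: fd_prod; [exact: fd_R|exact: fd_rV]. Qed.

Definition ZF (p : R * (R * V)) : V := Z p.2.1 p.1 p.2.2.

Lemma ZF_Cn : Cn m.+2 ZF.
Proof.
have H := flow_Cn fdE B_Cn Phi0 Phi_ode.
exact: (Cn_comp H (Cn_snd _ _ _)).
Qed.

(** Derivatives of [b] are bounded globally, so the linearised flow obeys a linear equation whose
    rate [L] does not depend on the orbit; over one period Gronwall gives the factor exp(2 pi L). *)
Lemma ZF_bound : exists2 L : R, 0 <= L &
  forall th X v, `|th| <= 2 * pi -> `|tangent ZF ((th, X), (0, v))| <= L * `|v|.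
Proof.
have B1 : Cn 1 B by apply: Cn_le B_Cn.
have [L L0 HL] := bF_bound.
exists (expR (L * (2 * pi))); first exact: expR_ge0.
move=> th X v th2.
have HB s w : `|s| <= 2 * pi -> `|tangent B (Phi s X, w)| <= L * `|w|.
  move=> _; rewrite /B tangent_pair /=.
  - by rewrite tangent_cst prod_normE /= normr0 ge_max mulr_ge0//= HL.
  - exact: differentiable_cst.
  - by case: bF_Cn.
have := linear_ode_bound L0 HB (lind_ode fdE B1 Phi0 Phi_ode X v) (lexx _) th2.
rewrite lind0// mulrC; apply: le_trans.
have -> : tangent ZF ((th, X), (0, v)) = (lind Phi X v th).2;
  last by rewrite prod_normE le_max lexx orbT.
have H := flow_C1 fdE B1 Phi0 Phi_ode.
have := @tangent_comp R _ _ _ (fun p : R * (R * V) => Phi p.1 p.2) snd (th, X) (0, v).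
rewrite tangent_snd (tangent_flow fdE B1 Phi0 Phi_ode) /= scale0r add0r; apply.
- by case: H.
- by apply: linear_differentiable => x; exact: cvg_snd.
Qed.

(** As functions of [s], Z(s; Z(th; z)) and Z(s + th; z) solve the same globally Lipschitz equation
    and agree at 0; take [s = - th]. *)
Lemma Z_group t th z : Z t (- th) (Z t th z) = z.
Proof.
have [L L0 HL] := bF_bound.
have Lip z1 z2 : `|b t z1 - b t z2| <= L * `|z1 - z2|.
  have := tangent_lipschitz (f := bF) (L := L) _ HL (t, z1) (t, z2).
  rewrite /bF /= [X in L * X]prod_normE /= subrr normr0.
  have -> : Num.max 0 `|z1 - z2| = `|z1 - z2| by apply/max_idPr.
  by apply; case: bF_Cn.
pose u s := Z t s (Z t th z) - Z t (s + th) z.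
have hu (s : R) : is_derive s 1 u (b t (Z t s (Z t th z)) - b t (Z t (s + th) z)).
  apply: is_deriveB.
  have dl : is_derive s 1 (fun r : R => th + r *: (1 : R)) (1 : R) by exact: is_derive_line.
  have dZ := Z_ode t (s + th) z.
  have dZ1 : differentiable (fun r => Z t r z) (s + th) by apply/derivable1_diffP; case: dZ.
  have E1 : s + th = th + s *: (1 : R) by rewrite addrC; congr (_ + _); exact/esym/mulr1.
  rewrite E1 in dZ dZ1.
  have := is_derive_comp dl dZ1.
  rewrite diff1E// scale1r derive1E.
  have -> : 'D_1 (fun r => Z t r z) (th + s *: (1 : R)) = b t (Z t (th + s *: (1 :
    R)) z) by case: dZ.
  have -> : (fun r => Z t r z) \o (fun r => th + r *: 1) = (fun r => Z t (r + th) z).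
    by apply/funext => r /=; rewrite addrC; congr (Z t (_ + _) z); exact: mulr1.
  by rewrite E1.
have := @gronwall_sym R V u _ `|th| L 0 0 1 hu L0 (lexx _) (lexx _).
rewrite mul0r addr0 mul0r /u Z_init add0r subrr normr0 => /(_ (lexx _)) H.
have := H _ ltr01 (- th); rewrite normrN addNr Z_init => /(_ _ (lexx _)) H2.
apply/eqP; rewrite -subr_eq0 -normr_le0; apply: H2 => s _ _.
by rewrite addr0; exact: Lip.
Qed.

Lemma tangent_ZF_x t th y w :
  'd (Z t th) y w = tangent ZF ((th, (t, y)), (0, (0, w))).
Proof.
have -> : Z t th = ZF \o (fun y => (th, (t, y))) by [].
rewrite -[LHS]/(tangent (ZF \o (fun y => (th, (t, y)))) (y, w)).
have dp : differentiable (fun y : V => (t, y)) y by apply: differentiable_pair.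
rewrite tangent_comp.
- rewrite tangent_pair//= tangent_cst.
  by rewrite tangent_pair//= tangent_cst tangent_id.
- by apply: differentiable_pair => //; exact: differentiable_cst.
- by case: ZF_Cn.
Qed.

Lemma Z_diff t th y : differentiable (Z t th) y.
Proof.
have -> : Z t th = ZF \o (fun y => (th, (t, y))) by [].
apply: differentiable_comp; last by case: ZF_Cn.
have dp : differentiable (fun y : V => (t, y)) y by apply: differentiable_pair.
by apply: differentiable_pair => //; exact: differentiable_cst.
Qed.

(** Chain rule applied to [Z_group]. The library's transposed Jacobians multiply in the order of
    application. Regularity of the inverse matrix thus comes from the flow, without differentiating
    matrix inversion. *)
Lemma invmx_jacobian t th y :
  invmx ('J (Z t th) y) = 'J (Z t (- th)) (Z t th y).
Proof.
have J12 : 'J (Z t th) y *m 'J (Z t (- th)) (Z t th y) = 1%:M.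
  apply/row_matrixP => i; rewrite rowE mulmxA !mul_rV_lin1 row1.
  have := @tangent_comp R _ _ _ (Z t th) (Z t (- th)) y (delta_mx 0 i) (Z_diff _ _ _)
    (Z_diff _ _ _).
  have -> : Z t (- th) \o Z t th = id by apply/funext => z; exact: Z_group.
  by rewrite tangent_id.
have [U1 U2] := mulmx1_unit J12.
by rewrite -[RHS]mul1mx -(mulVmx U1) -mulmxA J12 mulmx1.
Qed.

Definition alpha0F (p : R * (R * V)) : V := alpha0 a Z p.1 p.2.1 p.2.2.

(** Both the inverse Jacobian and the time derivative become values of the single map [tangent ZF],
    from which the regularity and the bound of alpha^0 are read off. *)
Lemma alpha0_tangent t th y : alpha0 a Z t th y =
  tangent ZF ((- th, (t, Z t th y)), (0, (0,
    a t th (Z t th y) - tangent ZF ((th, (t, y)), (0, (1, 0)))))).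
Proof.
rewrite /alpha0 invmx_jacobian mul_rV_lin1 tangent_ZF_x; congr tangent.
congr (_, (_, (_, _ - _))).
have := @is_derive_tangent R _ _ ZF (th, (0, y)) (0, (1, 0)) t.
have E1 (s : R) : (th, (0, y)) + s *: (0, (1, 0)) = (th, (s, y)) :> R * (R * V).
  congr (_, (_, _)); rewrite /= ?scaler0 ?addr0 ?add0r//; exact: mulr1.
rewrite E1 => /(_ ltac:(by case: ZF_Cn)).
under eq_fun do rewrite E1.
by rewrite derive1E => -[].
Qed.

Lemma alpha0F_Cn : Cn m.+1 alpha0F.
Proof.
have -> : alpha0F = fun p => tangent ZF ((- p.2.1, (p.1, ZF (p.2.1, (p.1, p.2.2)))), (0, (0,
    aF (p.1, (p.2.1, ZF (p.2.1, (p.1, p.2.2)))) - tangent ZF ((p.2.1, (p.1, p.2.2)), (0,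
      (1, 0)))))).
  by apply/funext => -[t [th y]]; rewrite /alpha0F alpha0_tangent.
have C1 := @Cn_fst R m.+1 R (R * V)%type; have C2 := @Cn_snd R m.+1 R (R * V)%type.
have Cth := Cn_comp C2 (@Cn_fst R m.+1 R V); have Cy := Cn_comp C2 (@Cn_snd R m.+1 R V).
have C3 := Cn_pair Cth (Cn_pair C1 Cy).
have CZ : Cn m.+1 (fun p : R * (R * V) => ZF (p.2.1, (p.1, p.2.2))).
  exact: (@Cn_comp _ m.+1 _ _ _ _ _ C3 (CnS ZF_Cn)).
have CT : Cn m.+1 (tangent ZF) by case: ZF_Cn.
have C0 (F : normedModType R) (c : F) := @Cn_cst R m.+1 (R * (R * V))%type F c.
have Ca := @Cn_comp _ m.+1 _ _ _ _ _ (Cn_pair C1 (Cn_pair Cth CZ)) aF_Cn.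
have CtZ := @Cn_comp _ m.+1 _ _ _ _ _ (Cn_pair C3 (C0 _ ((0, (1, 0)) : R * (R * V)))) CT.
exact: (Cn_comp (Cn_pair (Cn_pair (Cn_opp Cth) (Cn_pair C1 CZ))
  (Cn_pair (C0 _ 0) (Cn_pair (C0 _ 0) (Cn_sub Ca CtZ)))) CT).
Qed.

Lemma alpha0_per t th y : alpha0 a Z t (th + 2 * pi) y = alpha0 a Z t th y.
Proof.
rewrite /alpha0 a_per Z_per.
have -> : Z t (th + 2 * pi) = Z t th by apply/funext => z; exact: Z_per.
by under eq_fun do rewrite Z_per.
Qed.

Lemma alpha0_bounded : exists M : R, forall t th y, `|alpha0 a Z t th y| <= M.
Proof.
have [L L0 HL] := ZF_bound; have [A HA] := a_bound.
(* [A] bounds [a]; [L] bounds both the time derivative of [Z] and the inverse Jacobian. The latter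
   is taken at [- th'], still within one period of 0. *)
exists (L * (A + L)) => t th y.
have pi20 : 0 < 2 * pi :> R by rewrite mulr_gt0// pi_gt0.
have [th' th'2 Hth] := periodic_reduce th pi20.
rewrite (Hth _ (fun th => alpha0 a Z t th y)); last by move=> r; exact: alpha0_per.
have n1 : `|th'| <= 2 * pi by rewrite ler_norml; move: th'2 pi20; lra.
rewrite alpha0_tangent; apply: le_trans (HL _ _ _ _) _; first by rewrite normrN.
apply: ler_wpM2l => //; rewrite prod_normE /= normr0 ge_max.
have AL : `|a t th' (Z t th' y) - tangent ZF ((th', (t, y)), (0, (1, 0)))| <= A + L.
  apply: le_trans (ler_normB _ _) _; apply: lerD => //.
  apply: le_trans (HL _ _ _ n1) _.
  by rewrite prod_normE /= normr0 normr1 max_l// mulr1.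
by rewrite AL andbT (le_trans _ AL).
Qed.

End FastFlow.

(** * Two-scale profiles *)

Section Partial.
Context {R : realType} {d : nat}.
Local Notation V := 'rV[R]_d.

Lemma Cn_mul n (E : normedModType R) (f g : E -> R) :
  Cn n f -> Cn n g -> Cn n (fun x => f x * g x).
Proof. by move=> Cf Cg; exact: (Cn_scale Cf Cg). Qed.

Lemma Cn_prod n (E : normedModType R) (I : Type) (r : seq I) (f : I -> E -> R) :
  (forall i, Cn n (f i)) -> Cn n (fun x => \prod_(i <- r) f i x).
Proof.
move=> H; elim: r => [|i r IH].
  by under eq_fun do rewrite big_nil; exact: Cn_cst.
by under eq_fun do rewrite big_cons; exact: Cn_mul.
Qed.

Lemma tangent_slice (E F G : normedModType R) (f : E * F -> G) (x : E) (y w : F) :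
  (forall p, differentiable f p) ->
  'd (fun u => f (x, u)) y w = tangent f ((x, y), (0, w)).
Proof.
move=> df; have dp : differentiable (fun u : F => (x, u)) y.
  by apply: differentiable_pair => //; exact: differentiable_cst.
have := tangent_comp w dp (df _).
rewrite tangent_pair/= ?tangent_cst ?tangent_id//; exact: differentiable_cst.
Qed.

Lemma diff_slice (E F G : normedModType R) (f : E * F -> G) (x : E) (y : F) :
  (forall p, differentiable f p) -> differentiable (fun u => f (x, u)) y.
Proof.
move=> df; apply: (@differentiable_comp _ _ _ _ (fun u : F => (x, u)) f) => //.
Qed.

Lemma Cn_partial n (E : normedModType R) (f : E * V -> R) (l : seq 'I_d) :
  Cn (n + size l) f -> Cn n (fun p : E * V => partial l (fun z => f (p.1, z)) p.2).
Proof.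
elim: l n => [|j l IH] n /=; first by rewrite addn0;
  under eq_fun do rewrite -surjective_pairing.
rewrite addnS -addSn => /IH [dG CG].
set G := (fun p : E * V => partial l (fun z => f (p.1, z)) p.2) in dG CG.
have -> : (fun p : E * V => 'D_(delta_mx 0 j) (partial l (fun z => f (p.1, z))) p.2) =
    fun p => tangent G (p, (0, delta_mx 0 j)).
  apply/funext => -[x y] /=; rewrite deriveE; last exact: (@diff_slice _ _ _ G).
  exact: (@tangent_slice _ _ _ G).
apply: (@Cn_comp _ n _ _ _ (fun p : E * V => (p, (0, delta_mx 0 j))) _ _ CG).
by apply: Cn_pair; [exact: Cn_id|exact: Cn_cst].
Qed.

Lemma nablap1 (F : V -> V) (y h : V) : differentiable F y ->
  nablap F y (fun _ : 'I_1 => h) = 'd F y h.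
Proof.
move=> dF; apply/rowP => i; rewrite mxE.
have -> : 'd F y h 0 i = \sum_(j < d) 'D_(delta_mx 0 j) (fun z => F z 0 i) y * h 0 j.
  rewrite -[LHS]/(tangent F (y, h) 0 i) tangent_coord//.
  have dFi : differentiable (fun z => F z 0 i) y.
    apply: (@differentiable_comp _ _ _ _ F (coordl i)) => //.
    by apply: linear_differentiable; exact: coordl_continuous.
  rewrite /tangent /= {1}(rV_coord_sum h) linear_sum; apply: eq_bigr => j _.
  by rewrite linearZ /= -deriveE// mulrC.
pose l2j (l : {ffun 'I_1 -> 'I_d}) := l ord0.
pose j2l (j : 'I_d) := [ffun _ : 'I_1 => j].
rewrite (reindex j2l) /=; last first.
  exists l2j => [j _|l _]; first by rewrite /l2j ffunE.
  by apply/ffunP => q; rewrite ffunE /l2j (ord1 q).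
apply: eq_bigr => j _; rewrite big_ord1 ffunE; congr (_ * _).
have -> : codom (j2l j) = [:: j].
  rewrite /codom /image_mem (_ : enum _ = [:: ord0]) /= ?ffunE//.
  apply: (inj_map val_inj); rewrite val_enum_ord //.
by [].
Qed.

Lemma nablap0 (F : V -> V) (y : V) (h : 'I_0 -> V) : nablap F y h = F y.
Proof.
apply/rowP => i; rewrite mxE (bigD1 (ffun0 (card_ord 0)))//= big_ord0 mulr1.
have -> : codom (ffun0 (card_ord 0) : {ffun 'I_0 -> 'I_d}) = [::].
  by apply/size0nil; rewrite size_codom card_ord.
by rewrite big1 ?addr0// => l /eqP []; apply/ffunP => -[].
Qed.

End Partial.

Local Opaque vint.

Section Profiles.
Context {R : realType} {d : nat}.
Local Notation V := 'rV[R]_d.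
Local Notation profile := (@profile R d).

Definition smooth (E F : normedModType R) (f : E -> F) := forall n, Cn n f.

(* Smoothness of a function of (t, theta, y) for y in an infinite product is
   tested on smooth finite-dimensional families. *)
Definition prof_smooth n (g : profile) :=
  forall (E : normedModType R) (tau vth : E -> R) (eta : nat -> E -> V),
  fd E -> smooth tau -> smooth vth -> (forall j, smooth (eta j)) ->
  Cn n (fun e => g (tau e) (vth e) (fun j => eta j e)).

Lemma prof_smooth_le k n g : (k <= n)%N -> prof_smooth n g -> prof_smooth k g.
Proof. by move=> kn H E tau vth eta fE h1 h2 h3; apply: Cn_le kn _; exact: H. Qed.

(* Unlike [osc], whose value at th = 0 is junk, this is smooth in th. *)
Definition tosc (al : profile) : profile := fun t th y => th *: osc al t th y.

Lemma toscE al t th y : tosc al t th y =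
  vint 0 th (fun sg => al t sg y) - th *: mean al t y.
Proof.
rewrite /tosc /osc; have [->|th0] := eqVneq th 0.
  by rewrite vint0 !scale0r subrr.
by rewrite scalerBr scalerA divff// scale1r.
Qed.

Lemma osc_tosc al t th y : th != 0 -> osc al t th y = th^-1 *: tosc al t th y.
Proof. by move=> th0; rewrite /tosc scalerA mulVf// scale1r. Qed.

Section Integrals.
Variables (n : nat) (al : profile).
Hypothesis al_smooth : prof_smooth n.+1 al.

Lemma prof_vint (E : normedModType R) (tau : E -> R) (eta : nat -> E -> V) :
  fd E -> smooth tau -> (forall j, smooth (eta j)) ->
  Cn n.+1 (fun p : R * E => vint 0 p.1 (fun sg => al (tau p.2) sg (fun j => eta j p.2))).
Proof.
move=> fE h1 h3.
apply: (@Cn_vint R n E d (fun p => al (tau p.2) p.1 (fun j => eta j p.2))) => //.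
apply: al_smooth.
- by apply: fd_prod => //; exact: fd_R.
- by move=> k; apply: (Cn_comp (Cn_snd _ _ _) (h1 k)).
- by move=> k; exact: Cn_fst.
- by move=> j k; apply: (Cn_comp (Cn_snd _ _ _) (h3 j k)).
Qed.

Lemma prof_mean (E : normedModType R) (tau : E -> R) (eta : nat -> E -> V) :
  fd E -> smooth tau -> (forall j, smooth (eta j)) ->
  Cn n.+1 (fun e => mean al (tau e) (fun j => eta j e)).
Proof.
move=> fE h1 h3; apply: Cn_scale; first exact: Cn_cst.
apply: (@Cn_comp _ n.+1 _ _ _ (fun e : E => (2 * pi, e)) _ _ (prof_vint fE h1 h3)).
by apply: Cn_pair; [exact: Cn_cst|exact: Cn_id].
Qed.

Lemma prof_tosc : prof_smooth n.+1 (tosc al).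
Proof.
move=> E tau vth eta fE h1 h2 h3.
under eq_fun do rewrite toscE.
apply: Cn_sub; last by apply: Cn_scale; [exact: h2|exact: prof_mean].
apply: (@Cn_comp _ n.+1 _ _ _ (fun e : E => (vth e, e)) _ _ (prof_vint fE h1 h3)).
by apply: Cn_pair; [exact: h2|exact: Cn_id].
Qed.

Lemma prof_cont t y : continuous (fun th => al t th y).
Proof.
have H := al_smooth (E := R) (tau := fun=> t) (vth := id) (eta := fun j _ => y j).
apply: (Cn_cont (H _ _ _ _)).
- exact: fd_R.
- by move=> k; exact: Cn_cst.
- by move=> k; exact: Cn_id.
- by move=> j k; exact: Cn_cst.
Qed.

Lemma is_derive_tosc (t th : R) y :
  is_derive th 1 (fun th' => tosc al t th' y) (al t th y - mean al t y).
Proof.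
under eq_fun do rewrite toscE.
have d1 := is_derive_vint th (@prof_cont t y).
have d2 : is_derive th 1 (fun r : R => r *: mean al t y) (mean al t y).
  by have := is_derive_line 0 (mean al t y) th; under eq_fun do rewrite add0r.
exact: is_deriveB.
Qed.

(** The derivative in theta is alpha minus its mean, hence periodic, so the increment over a period
    is constant; at 0 it vanishes because that derivative has zero mean. *)
Lemma tosc_per : (forall t th y, al t (th + 2 * pi) y = al t th y) ->
  forall t th y, tosc al t (th + 2 * pi) y = tosc al t th y.
Proof.
move=> per t th y.
pose D r := tosc al t (r + 2 * pi) y - tosc al t r y.
have dD (r : R) : is_derive r 1 D 0.
  have d1 := is_derive_tosc t r y.
  have d2 := is_derive_tosc t (r + 2 * pi) y.
  have d3 : is_derive r 1 (fun r => tosc al t (r + 2 * pi) y) (al t r y - mean al t y).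
    apply/is_derive_epsP => e e0.
    have [q q0 Hq] := (iffLR (is_derive_epsP _ _ _)) d2 e e0.
    exists q => // h hq; have := Hq h hq.
    by rewrite (per t r y) [r + 2 * pi + h]addrAC.
  by apply: (is_derive_eq (is_deriveB d3 d1)); rewrite subrr.
have := @mean_value_sym R V D (fun=> 0) 0 th 0 0 (fun r _ => dD r).
rewrite subrr normr0 mul0r add0r scaler0 subr0 => /(_ (fun _ _ => lexx _)).
have -> : D 0 = 0.
  rewrite /D add0r !toscE scale0r subr0 vint0 subr0 /mean scalerA divff ?scale1r ?subrr//.
  by rewrite gt_eqF// mulr_gt0// pi_gt0.
by rewrite subr0 normr_le0 /D subr_eq0 => /eqP.
Qed.

Let fwith_smooth (E : normedModType R) (eta : nat -> E -> V) j :
  (forall i, smooth (eta i)) ->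
  forall i, smooth (fun p : E * V => [eta (fun i => eta i p.1) with j |-> p.2] i).
Proof.
move=> h i k /=; case: eqP => _; first exact: Cn_snd.
exact: (Cn_comp (Cn_fst _ _ _) (h i k)).
Qed.

Lemma tosc_diff_y t th y j u :
  differentiable (fun u => tosc al t th [eta y with j |-> u]) u.
Proof.
have := @prof_tosc (R * V)%type (fun=> t) (fun=> th) (fun i p => [eta (fun i =>
  y i) with j |-> p.2] i).
case.
- by apply: fd_prod; [exact: fd_R|exact: fd_rV].
- by move=> k; exact: Cn_cst.
- by move=> k; exact: Cn_cst.
- by move=> i; apply: (@fwith_smooth R (fun i _ => y i)) => i' k; exact: Cn_cst.
- by move=> dG _; exact: (diff_slice 0 u dG).
Qed.

Lemma tosc_diff_t t th y : differentiable (fun t' => tosc al t' th y) t.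
Proof.
have := @prof_tosc R id (fun=> th) (fun i _ => y i).
case; first exact: fd_R.
- by move=> k; exact: Cn_id.
- by move=> k; exact: Cn_cst.
- by move=> i k; exact: Cn_cst.
- by move=> dG _; exact: dG.
Qed.

Definition tosc_dy j t th (y : nat -> V) (w : V) : V :=
  'd (fun u => tosc al t th [eta y with j |-> u]) (y j) w.

Definition tosc_dt t th (y : nat -> V) : V := 'd (fun t' => tosc al t' th y) t 1.

(** At [th = 0] both sides vanish, [tosc] being identically 0 there; elsewhere [osc] is [tosc]
    divided by [th]. *)
Lemma scale_nablap_osc j t th y w :
  th *: nablap (fun u => osc al t th [eta y with j |-> u]) (y j) (fun _ : 'I_1 => w)
  = tosc_dy j t th y w.
Proof.
have [->|th0] := eqVneq th 0.
  rewrite scale0r /tosc_dy.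
  have -> : (fun u => tosc al t 0 [eta y with j |-> u]) = fun=> 0.
    by apply/funext => u; rewrite /tosc scale0r.
  by rewrite (diff_cst (0 : V)).
have E : (fun u => osc al t th [eta y with j |-> u]) = th^-1 \*: (fun u =>
  tosc al t th [eta y with j |-> u]).
  by apply/funext => u; rewrite osc_tosc.
rewrite E nablap1; last by apply: differentiableZ; exact: tosc_diff_y.
rewrite diffZ; last exact: tosc_diff_y.
by rewrite /= scalerA divff// scale1r.
Qed.

Lemma scale_derive_osc t th y :
  th *: derive1 (fun t' => osc al t' th y) t = tosc_dt t th y.
Proof.
have [->|th0] := eqVneq th 0.
  rewrite scale0r /tosc_dt.
  have -> : (fun t' => tosc al t' 0 y) = fun=> 0.
    by apply/funext => u; rewrite /tosc scale0r.
  by rewrite (diff_cst (0 : V)).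
have E : (fun t' => osc al t' th y) = th^-1 \*: (fun t' => tosc al t' th y).
  by apply/funext => u; rewrite osc_tosc.
have dT := tosc_diff_t t th y.
rewrite E derive1E deriveE; last exact: differentiableZ.
rewrite diffZ//= scalerA divff// scale1r.
by [].
Qed.

Lemma prof_tosc_dy j (E : normedModType R) (tau vth : E -> R) (eta : nat -> E ->
  V) (w : E -> V) :
  fd E -> smooth tau -> smooth vth -> (forall j, smooth (eta j)) -> Cn n w ->
  Cn n (fun e => tosc_dy j (tau e) (vth e) (fun j => eta j e) (w e)).
Proof.
move=> fE h1 h2 h3 Cw.
pose G (p : E * V) := tosc al (tau p.1) (vth p.1) [eta (fun i => eta i p.1) with j |-> p.2].
have [dG CG] : Cn n.+1 G.
  apply: (@prof_tosc (E * V)%type (fun p => tau p.1) (fun p => vth p.1) (fun i p =>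
    [eta (fun i => eta i p.1) with j |-> p.2] i)).
  - by apply: fd_prod => //; exact: fd_rV.
  - by move=> k; exact: (Cn_comp (Cn_fst _ _ _) (h1 k)).
  - by move=> k; exact: (Cn_comp (Cn_fst _ _ _) (h2 k)).
  - exact: fwith_smooth.
have -> : (fun e => tosc_dy j (tau e) (vth e) (fun j => eta j e) (w e)) =
    fun e => tangent G ((e, eta j e), (0, w e)).
  by apply/funext => e; rewrite -tangent_slice.
apply: (@Cn_comp _ n _ _ _ (fun e : E => ((e, eta j e), (0, w e))) _ _ CG).
apply: Cn_pair; apply: Cn_pair => //; [exact: Cn_id|exact: h3|exact: Cn_cst].
Qed.

Lemma prof_tosc_dt (E : normedModType R) (tau vth : E -> R) (eta : nat -> E -> V) :
  fd E -> smooth tau -> smooth vth -> (forall j, smooth (eta j)) ->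
  Cn n (fun e => tosc_dt (tau e) (vth e) (fun j => eta j e)).
Proof.
move=> fE h1 h2 h3.
pose G (p : E * R) := tosc al p.2 (vth p.1) (fun i => eta i p.1).
have [dG CG] : Cn n.+1 G.
  apply: (@prof_tosc (E * R)%type (fun p => p.2) (fun p => vth p.1) (fun i p => eta i p.1)).
  - by apply: fd_prod => //; exact: fd_R.
  - by move=> k; exact: Cn_snd.
  - by move=> k; exact: (Cn_comp (Cn_fst _ _ _) (h2 k)).
  - by move=> i k; exact: (Cn_comp (Cn_fst _ _ _) (h3 i k)).
have -> : (fun e => tosc_dt (tau e) (vth e) (fun j => eta j e)) =
    fun e => tangent G ((e, tau e), (0, 1)).
  by apply/funext => e; rewrite -tangent_slice.
apply: (@Cn_comp _ n _ _ _ (fun e : E => ((e, tau e), ((0 : E), (1 : R)))) _ _ CG).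
apply: Cn_pair; last exact: Cn_cst.
by apply: Cn_pair; [exact: Cn_id|exact: h1].
Qed.

End Integrals.
End Profiles.

Section Locality.
Context {R : realType} {d : nat}.
Local Notation V := 'rV[R]_d.
Variables (a : R -> R -> V -> V) (Z : R -> R -> V -> V).
Local Notation al := (alphat a Z).

Lemma mean_local k t (y y' : nat -> V) : (forall i, (i <= k)%N -> y i = y' i) ->
  mean (al k) t y = mean (al k) t y'.
Proof.
move=> yy'; rewrite /mean.
suff -> : (fun th => al k t th y) = (fun th => al k t th y') by [].
by apply/funext => th; exact: alphat_local.
Qed.

Lemma tosc_local k t th (y y' : nat -> V) : (forall i, (i <= k)%N -> y i = y' i) ->
  tosc (al k) t th y = tosc (al k) t th y'.
Proof.
move=> yy'; rewrite !toscE (mean_local t yy').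
suff -> : (fun sg => al k t sg y) = (fun sg => al k t sg y') by [].
by apply/funext => sg; exact: alphat_local.
Qed.

End Locality.

Local Opaque alphat alpha0 tosc mean osc.

(** * Regularity and periodicity along the recursion *)

Section Recursion.
Context {R : realType} {d m : nat}.
Local Notation V := 'rV[R]_d.
Variables (a : R -> R -> V -> V) (Z : R -> R -> V -> V).
Hypothesis f_Cn : Cn m.+1 (fun p : R * (R * V) => alpha0 a Z p.1 p.2.1 p.2.2).
Hypothesis f_per : forall t th y, alpha0 a Z t (th + 2 * pi) y = alpha0 a Z t th y.

Local Notation al := (alphat a Z).

Lemma Cn_nablap p n (E : normedModType R) (tau vth : E -> R) (y0 : E -> V)
    (h : 'I_p -> E -> V) : (n + p <= m.+1)%N ->
  Cn n tau -> Cn n vth -> Cn n y0 -> (forall q, Cn n (h q)) ->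
  Cn n (fun e => nablap (alpha0 a Z (tau e) (vth e)) (y0 e) (fun q => h q e)).
Proof.
move=> np h1 h2 h3 h4; apply: Cn_rowP => i; under eq_fun do rewrite mxE.
apply: Cn_sum => l _; apply: Cn_mul; last first.
  by apply: Cn_prod => q; exact: (Cn_comp (h4 q) (@Cn_coord R n d (l q))).
pose F (p : R * R * V) := alpha0 a Z p.1.1 p.1.2 p.2 0 i.
have CF : Cn (n + size (codom l)) F.
  rewrite size_codom card_ord; apply: Cn_le np _.
  have := Cn_comp f_Cn (@Cn_coord R m.+1 d i).
  move=> /(fun H => @Cn_comp _ m.+1 _ _ _ (fun p : R * R * V =>
    (p.1.1, (p.1.2, p.2))) _ _ H).
  apply; apply: Cn_pair; first exact: (Cn_comp (Cn_fst _ _ _) (Cn_fst _ _ _)).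
  by apply: Cn_pair; [exact: (Cn_comp (Cn_fst _ _ _) (Cn_snd _ _ _))|exact: Cn_snd].
have := Cn_partial CF.
move=> /(fun H => @Cn_comp _ n _ _ _ (fun e : E => ((tau e, vth e), y0 e)) _ _ H).
by apply; apply: Cn_pair => //; exact: Cn_pair.
Qed.

(** For positive [k], theta times [transport_term], expressed through [tosc] so that it is
    manifestly smooth at theta = 0. *)
Definition transport (k : nat) : profile := fun t th y =>
  \sum_(j < k) tosc_dy (al k.-1) j t th y (mean (al j) t y) + tosc_dt (al k.-1) t th y.

Lemma taylor_termE k t th y : taylor_term a Z al k t th y =
  \sum_(1 <= p < k.+1) (p`!%:R)^-1 *:
    (\sum_(j : {ffun 'I_p -> 'I_k.+1} |
           [forall q, (0 < j q)%N] && (\sum_(q < p) j q == k)%N)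
        nablap (alpha0 a Z t th) (y 0%N) (fun q => y (j q) + tosc (al (j q).-1) t th y)).
Proof. by []. Qed.

Lemma transport_smooth n k : (forall j, (j <= k)%N -> prof_smooth n.+1 (al j)) ->
  prof_smooth n (transport k.+1).
Proof.
move=> als E tau vth eta fE h1 h2 h3; apply: Cn_add.
  apply: Cn_sum => j _; apply: prof_tosc_dy => //; first exact: als.
  by apply: CnS; apply: prof_mean => //; apply: als; rewrite -ltnS; exact: ltn_ord.
by apply: prof_tosc_dt => //; exact: als.
Qed.

Lemma transport_per n k : (forall j, (j <= k)%N -> prof_smooth n.+1 (al j)) ->
  (forall t th y, al k t (th + 2 * pi) y = al k t th y) ->
  forall t th y, transport k.+1 t (th + 2 * pi) y = transport k.+1 t th y.
Proof.
move=> als per t th y; have TP := tosc_per (als k (leqnn k)) per.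
have Edy j : tosc_dy (al k) j t (th + 2 * pi) y = tosc_dy (al k) j t th y.
  apply/funext => w; rewrite /tosc_dy.
  by apply: (congr1 (fun g : V -> V => 'd g (y j) w)); apply/funext => u; exact: TP.
have Edt : tosc_dt (al k) t (th + 2 * pi) y = tosc_dt (al k) t th y.
  rewrite /tosc_dt.
  by apply: (congr1 (fun g : R -> V => 'd g t 1)); apply/funext => u; exact: TP.
rewrite /transport Edt; apply: (congr1 (fun v => v + tosc_dt (al k) t th y)).
by apply: eq_bigr => j _; rewrite Edy.
Qed.

Local Opaque taylor_term.

(** Index [k] differentiates alpha^0 at most [k] times in the Taylor part and the previous [tosc]
    once in the transport part, which leaves m - k + 1 derivatives. The three claims are proved
    together: rewriting [nablap] and [derive1] as differentials requires the regularity of the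
    earlier profiles, and the periodicity of [tosc] requires both their regularity and their
    periodicity. *)
Theorem alphat_smooth k : (k <= m)%N ->
  prof_smooth (m - k).+1 (al k) /\
  (forall t th y, al k t (th + 2 * pi) y = al k t th y) /\
  (forall t th y, (0 < k)%N -> al k t th y = taylor_term a Z al k t th y - transport k t
    th y).
Proof.
elim/ltn_ind: k => -[|k] IH km.
  split; [|split]; last by move=> t th y.
    move=> E tau vth eta fE h1 h2 h3; rewrite subn0.
    apply: (@Cn_comp _ m.+1 _ _ _ (fun e : E => (tau e, (vth e, eta 0%N e))) _ _ f_Cn).
    exact: (Cn_pair (h1 _) (Cn_pair (h2 _) (h3 _ _))).
  by move=> t th y; rewrite !alphat0E f_per.
have IHs j : (j <= k)%N -> prof_smooth (m - k).+1 (al j).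
  move=> jk; have [//|+ _] := IH j _ (leq_trans (leqW jk) km).
  by apply: prof_smooth_le; rewrite ltnS leq_sub2l.
have IHp j : (j <= k)%N -> forall t th y, al j t (th + 2 * pi) y = al j t th y.
  by move=> jk; have [//|_ []] := IH j _ (leq_trans (leqW jk) km).
have mk : (m - k = (m - k.+1).+1)%N by rewrite subnSK.
have alE t th y : al k.+1 t th y = taylor_term a Z al k.+1 t th y - transport k.+1 t th y.
  rewrite alphatE// /alpha_next; congr (_ - _).
  rewrite /transport_term /transport /= scalerDr scaler_sumr; congr (_ + _).
    by apply: eq_bigr => j _; exact: (scale_nablap_osc (IHs k (leqnn k))).
  exact: (scale_derive_osc (IHs k (leqnn k))).
split; [|split=> t th y]; last by move=> _; exact: alE.
  move=> E tau vth eta fE h1 h2 h3; under eq_fun do rewrite alE.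
  apply: Cn_sub.
    under eq_fun do rewrite taylor_termE big_nat.
    apply: Cn_sum => p /andP[_ pk]; apply: Cn_scale; first exact: Cn_cst.
    apply: Cn_sum => j /andP[/forallP j0 _]; apply: Cn_nablap.
    - by rewrite addSn ltnS -[X in (_ <= X)%N](subnK km) leq_add2l -ltnS.
    - exact: h1.
    - exact: h2.
    - exact: h3.
    - move=> q; have jq : ((j q).-1 <= k)%N by rewrite -ltnS prednK// -ltnS ltn_ord.
      apply: Cn_add; first exact: h3.
      apply: CnS; rewrite -mk; exact: (prof_tosc (IHs _ jq)).
  apply: (transport_smooth (k := k)) => // j jk; rewrite -mk; exact: IHs.
have TP j : (j <= k)%N -> forall t th y, tosc (al j) t (th + 2 * pi) y = tosc (al j) t th y.
  by move=> jk; exact: (tosc_per (IHs j jk) (IHp j jk)).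
rewrite (alE t (th + 2 * pi)) (alE t th).
have -> : taylor_term a Z al k.+1 t (th + 2 * pi) y = taylor_term a Z al k.+1 t th y.
  rewrite !taylor_termE; apply: eq_bigr => p _.
  apply: (congr1 (fun v : V => (p`!%:R)^-1 *: v)).
  apply: eq_bigr => j /andP[/forallP j0 _].
  have -> : alpha0 a Z t (th + 2 * pi) = alpha0 a Z t th by apply/funext => u; exact: f_per.
  apply: (congr1 (nablap (alpha0 a Z t th) (y 0%N))).
  apply/funext => q; rewrite TP//.
  by rewrite -ltnS prednK// -ltnS ltn_ord.
apply: (congr1 (fun v => taylor_term a Z al k.+1 t th y - v)).
exact: (transport_per IHs (IHp k (leqnn k))).
Qed.

End Recursion.

(** * Taylor expansion by weight *)

Section Bounds.
Context {R : realType} {d m : nat}.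
Local Notation V := 'rV[R]_d.
Variables (a : R -> R -> V -> V) (Z : R -> R -> V -> V).
Hypothesis f_Cn : Cn m.+1 (fun p : R * (R * V) => alpha0 a Z p.1 p.2.1 p.2.2).
Hypothesis f_per : forall t th y, alpha0 a Z t (th + 2 * pi) y = alpha0 a Z t th y.
Local Notation al := (alphat a Z).
Local Notation f := (alpha0 a Z).
Variables (s0 s1 : R).

Let pi20 : 0 < 2 * pi :> R.
Proof. by rewrite mulr_gt0// pi_gt0. Qed.

Lemma periodic_bounded (E F : normedModType R) (r : R) (g : R -> R -> E -> F) :
  fd E -> continuous (fun p : R * (R * E) => g p.1 p.2.1 p.2.2) ->
  (forall t th e, g t (th + 2 * pi) e = g t th e) ->
  exists2 M : R, 0 <= M &
    forall t th e, s0 <= t <= s1 -> `|e| <= r -> `|g t th e| <= M.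
Proof.
move=> fE cg per.
have cK : compact (`[s0, s1]%classic `*` ((`[0, 2 * pi]%classic : set R) `*` [set e :
  E | `|e| <= r])).
  apply: compact_setX; first exact: segment_compact.
  by apply: compact_setX; [exact: segment_compact|exact: fE].
have [M M0 HM] := compact_cont_bounded cK cg.
exists M => // t th e ts er.
have [th' th'2 Hth] := periodic_reduce th pi20.
rewrite (Hth _ (fun th => g t th e)); last by move=> ?; exact: per.
apply: (HM (t, (th', e))); split; first by rewrite /= in_itv.
by split => //=; rewrite in_itv.
Qed.

Lemma nablap_bound p (r : R) : (p <= m.+1)%N -> exists2 M : R, 0 <= M &
  forall t th z (h : 'I_p -> V) (N : 'I_p -> R), s0 <= t <= s1 -> `|z| <= r ->
    (forall q, `|h q| <= N q) -> `|nablap (f t th) z h| <= M * \prod_q N q.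
Proof.
move=> pm.
have HM0 (il : 'I_d * {ffun 'I_p -> 'I_d}) : exists M : R, 0 <= M /\
    forall t th z, s0 <= t <= s1 -> `|z| <= r ->
    `|partial (codom il.2) (fun z => f t th z 0 il.1) z| <= M.
  have [|||M M0 HM] := @periodic_bounded V R r (fun t th z =>
    partial (codom il.2) (fun z => f t th z 0 il.1) z).
  - exact: fd_rV.
  - pose F (p : R * R * V) := f p.1.1 p.1.2 p.2 0 il.1.
    have CF : Cn (0 + size (codom il.2)) F.
      rewrite size_codom card_ord add0n; apply: Cn_le pm _.
      have := Cn_comp f_Cn (@Cn_coord R m.+1 d il.1).
      move=> /(fun H => @Cn_comp _ m.+1 _ _ _ (fun p : R * R * V =>
        (p.1.1, (p.1.2, p.2))) _ _ H).
      apply; apply: Cn_pair; first exact: (Cn_comp (Cn_fst _ _ _) (Cn_fst _ _ _)).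
      by apply: Cn_pair; [exact: (Cn_comp (Cn_fst _ _ _) (Cn_snd _ _ _))|exact: Cn_snd].
    have := Cn_partial CF.
    move=> /(fun H => @Cn_comp _ 0 _ _ _ (fun p : R * (R * V) =>
      ((p.1, p.2.1), p.2.2)) _ _ H).
    apply; have C2 := @Cn_snd R 0 R (R * V)%type.
    apply: Cn_pair; last exact: (Cn_comp C2 (Cn_snd _ _ _)).
    by apply: Cn_pair; [exact: Cn_fst|exact: (Cn_comp C2 (Cn_fst _ _ _))].
  - move=> t th z; suff -> : f t (th + 2 * pi) = f t th by [].
    by apply/funext => u; exact: f_per.
  - by exists M; split=> // t th z; exact: HM.
have [M HM] := choice HM0.
exists (\sum_il M il); first by apply: sumr_ge0 => il _; case: (HM il).
move=> t th z h N ts zr hN.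
have N0 q : 0 <= N q by apply: le_trans (hN q).
have P0 : 0 <= \prod_q N q by apply: prodr_ge0 => q _.
apply: rV_norm_le; first by apply: mulr_ge0 => //; apply: sumr_ge0 => il _; case: (HM il).
move=> i; rewrite mxE; apply: le_trans (ler_norm_sum _ _ _) _.
apply: (@le_trans _ _ ((\sum_l M (i, l)) * \prod_q N q)).
  rewrite mulr_suml; apply: ler_sum => l _; rewrite normrM.
  apply: ler_pM => //; first by case: (HM (i, l)) => _; exact.
  rewrite normr_prod; apply: ler_prod => q _; rewrite normr_ge0 /=.
  by apply: le_trans (hN q); exact: coord_norm.
apply: ler_wpM2r => //.
rewrite (eq_bigr (fun il => M (il.1, il.2))); last by case.
rewrite -(pair_bigA _ (fun i l => M (i, l))) /= [leRHS](bigD1 i)//= lerDl.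
by apply: sumr_ge0 => j _; apply: sumr_ge0 => l _; case: (HM (j, l)).
Qed.

Lemma f_diff t th z : differentiable (f t th) z.
Proof.
have [dF _] := f_Cn.
apply: (@differentiable_comp _ _ _ _ (fun z : V => (t, (th, z))) (fun p : R * (R * V) =>
  f p.1 p.2.1 p.2.2)) => //.
have dp : differentiable (fun z : V => (th, z)) z by apply: differentiable_pair.
by apply: differentiable_pair => //; exact: differentiable_cst.
Qed.

Lemma f_lipschitz (r : R) : exists2 L : R, 0 <= L &
  forall t th z w, s0 <= t <= s1 -> `|z| <= r -> `|w| <= r ->
    `|f t th z - f t th w| <= L * `|z - w|.
Proof.
have [//|L L0 HL] := @nablap_bound 1 r.
exists L => // t th z w ts zr wr.
have := @mean_value R V (fun q => f t th (w + q *: (z - w))) (fun q =>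
  'd (f t th) (w + q *: (z - w)) (z - w)) 0 1 (L * `|z - w|).
rewrite scale0r addr0 scale1r [w + _]addrC subrK subr0 mulr1; apply => //.
- apply: (@derive_cont_on _ _ _ (fun q => 'd (f t th) (w + q *: (z - w)) (z - w))) => q _.
  by apply: is_derive_line_comp; exact: f_diff.
- by move=> q _; apply: is_derive_line_comp; exact: f_diff.
- move=> q q01; rewrite -nablap1; last exact: f_diff.
  have := HL t th (w + q *: (z - w)) (fun=> z - w) (fun=> `|z - w|) ts.
  rewrite big_ord1; apply => //.
  have -> : w + q *: (z - w) = q *: z + (1 - q) *: w by lmod R.
  apply: le_trans (ler_normD _ _) _; rewrite !normrZ.
  rewrite ger0_norm ?(ger0_norm (x := 1 - q)); [|lra|lra].
  have : q * `|z| <= q * r by apply: ler_wpM2l => //; lra.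
  have : (1 - q) * `|w| <= (1 - q) * r by apply: ler_wpM2l => //; lra.
  lra.
- exact: mulr_ge0.
Qed.

(** The remainder of order n + 1 vanishes at 0 and its derivative is the remainder of order n of the
    shifted family, so the mean value inequality drives the induction. The factor l^n / n! is given
    up. *)
Lemma taylor_bound (g : nat -> R -> R) n (M : R) :
  (forall p, (p < n)%N -> forall l : R, is_derive l 1 (g p) (g p.+1 l)) ->
  (forall l, 0 <= l <= 1 -> `|g n l| <= M) ->
  forall l, 0 <= l <= 1 -> `|g 0%N l - \sum_(p < n) l ^+ p / p`!%:R * g p 0| <= M.
Proof.
elim: n g => [|n IH] g hg gM l l01; first by rewrite big_ord0 subr0; exact: gM.
have M0 : 0 <= M by apply: le_trans (gM l l01).
pose D x := g 0%N x - \sum_(p < n.+1) x ^+ p / p`!%:R * g p 0.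
pose dD x := g 1%N x - \sum_(p < n) x ^+ p / p`!%:R * g p.+1 0.
have dDM x : 0 <= x <= 1 -> `|dD x| <= M.
  by apply: (IH (fun p => g p.+1)) => // p pn; apply: hg.
have hD (x : R) : is_derive x 1 D (dD x).
  have d1 : is_derive x 1 (g 0%N) (g 1%N x) by exact: hg.
  have d2 : is_derive x 1 (fun x => \sum_(p < n.+1) x ^+ p / p`!%:R * g p 0)
      (\sum_(p < n) x ^+ p / p`!%:R * g p.+1 0).
    have -> : (fun x => \sum_(p < n.+1) x ^+ p / p`!%:R * g p 0) =
        \sum_(p < n.+1) (fun x => x ^+ p / p`!%:R * g p 0).
      by apply/funext => y; rewrite fct_sumE.
    have -> : \sum_(p < n) x ^+ p / p`!%:R * g p.+1 0 =
        \sum_(p < n.+1) (if p : nat is p'.+1 then x ^+ p' / p'`!%:R * g p 0 else 0).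
      by rewrite big_ord_recl /= add0r.
    apply: is_derive_sum => -[[|p] /= pn].
      have -> : (fun x : R => x ^+ 0 / 0`!%:R * g 0%N 0) = cst (g 0%N 0).
        by apply/funext => y; rewrite expr0 fact0 divr1 mul1r.
      exact: is_derive_cst.
    have -> : (fun x : R => x ^+ p.+1 / (p.+1)`!%:R * g p.+1 0) =
        (g p.+1 0 / (p.+1)`!%:R) \*: (id ^+ p.+1 : R -> R).
      apply/funext => y; rewrite /= exprfctE.
      by rewrite -[_ *: _]/(_ * _); ring.
    have dX := @is_deriveX _ _ (@id R) p.+1 x 1 1 (is_derive_id x 1).
    have dZ := @is_deriveZ _ _ _ (id ^+ p.+1 : R -> R) (g p.+1 0 / (p.+1)`!%:R) x 1 _ dX.
    apply: (is_derive_eq dZ).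
    rewrite -[_ *: (_ *: _)]/(_ * (_ * _)) /= factS natrM; field.
    by rewrite -[1]/(1%:R) -natrD !pnatr_eq0 -lt0n fact_gt0.
  exact: is_deriveB.
have D0 : D 0 = 0.
  rewrite /D big_ord_recl /= expr0 fact0 divr1 mul1r big1 ?addr0 ?subrr// => p _.
  by rewrite expr0n /= !mul0r.
have := @mean_value R R D dD 0 l M.
rewrite D0 !subr0 => H; rewrite -/(D l).
apply: le_trans (H _ _ _ _ _) _ => //.
- by apply: derive_cont_on => x _; exact: hD.
- by move=> x xl; apply: dDM; lra.
- by case/andP: l01.
- by rewrite ler_piMr//; case/andP: l01.
Qed.

(** The first index is split off because one more differentiation of [partial] puts its index at the
    head of the list. *)
Lemma big_ffun_recl (T : nmodType) (I : finType) p (F : {ffun 'I_p.+1 -> I} -> T) :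
  \sum_l F l = \sum_(l : {ffun 'I_p -> I}) \sum_j
    F [ffun q => if unlift ord0 q is Some q' then l q' else j].
Proof.
rewrite exchange_big pair_bigA /=.
pose h (x : I * {ffun 'I_p -> I}) : {ffun 'I_p.+1 -> I} :=
  [ffun q => if unlift ord0 q is Some q' then x.2 q' else x.1].
rewrite (reindex h) //=.
exists (fun l => (l ord0, [ffun q => l (lift ord0 q)])) => [[j l] _|l _].
  congr (_, _); first by rewrite ffunE unlift_none.
  by apply/ffunP => q; rewrite !ffunE liftK.
apply/ffunP => q; rewrite ffunE /=; case: unliftP => [q' ->|->//].
by rewrite ffunE.
Qed.

Lemma nablap_derive t th (y h : V) (i : 'I_d) p : (p <= m)%N -> forall l : R,
  is_derive l 1 (fun l : R => nablap (f t th) (y + l *: h) (fun _ : 'I_p => h) 0 i)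
    (nablap (f t th) (y + l *: h) (fun _ : 'I_p.+1 => h) 0 i).
Proof.
move=> pm l; rewrite mxE; under eq_fun do rewrite mxE.
rewrite big_ffun_recl.
have -> : (fun l => \sum_(k : {ffun 'I_p -> 'I_d}) partial (codom k) (fun z =>
  f t th z 0 i) (y + l *: h) * \prod_(q < p) h 0 (k q)) =
  fun l => \sum_(k <- enum {ffun 'I_p -> 'I_d}) partial (codom k) (fun z =>
    f t th z 0 i) (y + l *: h) * \prod_(q < p) h 0 (k q).
  by apply/funext => x; rewrite big_enum.
rewrite -[X in is_derive _ _ _ X]big_enum /=.
have step (k : {ffun 'I_p -> 'I_d}) : is_derive l 1
    (fun l => partial (codom k) (fun z =>
      f t th z 0 i) (y + l *: h) * \prod_(q < p) h 0 (k q))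
    (\sum_j partial (codom ([ffun q =>
      if unlift ord0 q is Some q' then k q' else j] : {ffun 'I_p.+1 -> 'I_d})) (fun z =>
        f t th z 0 i) (y + l *: h) *
      \prod_(q < p.+1) h 0 (([ffun q =>
        if unlift ord0 q is Some q' then k q' else j] : {ffun 'I_p.+1 -> 'I_d}) q)).
  pose G := partial (codom k) (fun z => f t th z 0 i).
  have dG z : differentiable G z.
    pose F (p : R * R * V) := f p.1.1 p.1.2 p.2 0 i.
    have CF : Cn (1 + size (codom k)) F.
      rewrite size_codom card_ord add1n; apply: (@Cn_le _ _ m.+1) => //.
      have := Cn_comp f_Cn (@Cn_coord R m.+1 d i).
      move=> /(fun H => @Cn_comp _ m.+1 _ _ _ (fun p : R * R * V =>
        (p.1.1, (p.1.2, p.2))) _ _ H).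
      apply; apply: Cn_pair; first exact: (Cn_comp (Cn_fst _ _ _) (Cn_fst _ _ _)).
      by apply: Cn_pair; [exact: (Cn_comp (Cn_fst _ _ _) (Cn_snd _ _ _))|exact: Cn_snd].
    have [dP _] := Cn_partial CF.
    exact: (diff_slice (t, th) z dP).
  have d1 := is_derive_line_comp (dG (y + l *: h)).
  pose c := \prod_(q < p) h 0 (k q).
  have -> : (fun l => partial (codom k) (fun z =>
    f t th z 0 i) (y + l *: h) * c) = c \*: (fun l => G (y + l *: h)).
    by apply/funext => x; rewrite /= mulrC.
  apply: (is_derive_eq (is_deriveZ c d1)).
  set z := y + l *: h; rewrite [in LHS](rV_coord_sum h) linear_sum scaler_sumr;
    apply: eq_bigr => j _.
  rewrite linearZ /= -deriveE//.
  have -> : codom ([ffun q => if unlift ord0 q is Some q' then k q' else j] :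
    {ffun 'I_p.+1 -> 'I_d}) = j :: codom k.
    rewrite /codom /image_mem enum_ordSl /= ffunE unlift_none; congr (_ :: _).
    by rewrite -map_comp; apply: eq_map => q /=; rewrite ffunE liftK.
  rewrite big_ord_recl ffunE unlift_none /=.
  have -> : \prod_(i0 < p) h 0 ([ffun q =>
    if unlift ord0 q is Some q' then k q' else j] (lift ord0 i0)) = c.
    by apply: eq_bigr => q _; rewrite ffunE liftK.
  rewrite -[_ *: (_ *: _)]/(_ * (_ * _)) /G; ring.
elim: (enum _) => [|k r IH].
  by under eq_fun do rewrite big_nil; rewrite big_nil; exact: is_derive_cst.
under eq_fun do rewrite big_cons; rewrite big_cons.
exact: is_deriveD.
Qed.

Lemma f_taylor (r : R) : exists2 M : R, 0 <= M &
  forall t th y h, s0 <= t <= s1 -> `|y| <= r -> `|h| <= r ->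
    `|f t th (y + h) - \sum_(p < m.+1) (p`!%:R)^-1 *: nablap (f t th) y (fun _ : 'I_p => h)|
      <= M * `|h| ^+ m.+1.
Proof.
have [//|M M0 HM] := @nablap_bound m.+1 (r + r).
exists M => // t th y h ts yr hr.
apply: rV_norm_le; first by rewrite mulr_ge0// exprn_ge0.
move=> i.
have := @taylor_bound (fun p l => nablap (f t th) (y + l *: h) (fun _ : 'I_p =>
  h) 0 i) m.+1 (M * `|h| ^+ m.+1) _ _ 1.
rewrite ler01 lexx => H; apply: le_trans (H _ _ isT).
- rewrite le_eqVlt; apply/orP; left; apply/eqP; congr `|_|.
  rewrite scale1r nablap0 !mxE summxE; congr (_ - _).
  by apply: eq_bigr => p _; rewrite mxE expr1n mul1r scale0r addr0.
- by move=> p pm l; exact: nablap_derive.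
- move=> l l01; apply: le_trans (coord_norm _ _) _.
  have := HM t th (y + l *: h) (fun=> h) (fun=> `|h|) ts.
  rewrite prodr_const card_ord; apply => //.
  apply: le_trans (ler_normD _ _) _; apply: lerD => //.
  by rewrite normrZ; apply: le_trans hr; rewrite ler_piMl// ger0_norm; lra.
Qed.

End Bounds.

Section Expansion.
Context {R : realType} {d : nat}.
Local Notation V := 'rV[R]_d.

Lemma nablap_expand p N (F : V -> V) (y : V) (c : nat -> R) (H : nat -> V) :
  nablap F y (fun _ : 'I_p => \sum_(j < N) c j *: H j) =
  \sum_(J : {ffun 'I_p -> 'I_N}) (\prod_q c (J q)) *: nablap F y (fun q => H (J q)).
Proof.
apply/rowP => i; rewrite mxE summxE.
under [RHS]eq_bigr => J _ do rewrite !mxE mulr_sumr.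
rewrite exchange_big /=; apply: eq_bigr => l _.
under eq_bigr => q _ do rewrite summxE.
rewrite (bigA_distr_bigA (fun (q : 'I_p) (j : 'I_N) => (c j *: H j) 0 (l q))) mulr_sumr.
apply: eq_bigr => J _.
under eq_bigr => q _ do rewrite mxE.
by rewrite big_split /= mulrCA.
Qed.

Lemma nablap_eq0 p (F : V -> V) (y : V) (h : 'I_p -> V) q : h q = 0 -> nablap F y h = 0.
Proof.
move=> hq; apply/rowP => i; rewrite !mxE big1// => l _.
by rewrite (bigD1 q)//= hq mxE mul0r mulr0.
Qed.

Definition allpos p N (J : {ffun 'I_p -> 'I_N}) := [forall q, (0 < J q)%N].

Lemma sum_allpos p N (J : {ffun 'I_p -> 'I_N}) : allpos J -> (p <= \sum_(q < p) J q)%N.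
Proof.
move=> /forallP J0; rewrite -[X in (X <= _)%N]card_ord -sum1_card.
by apply: leq_sum.
Qed.

(** Indices of sum [k] are at most [k], so the range can be cut down to the one used in the
    recursion. *)
Lemma weight_reindex (T : nmodType) p k N (F : ('I_p -> nat) -> T) : (k < N)%N ->
  \sum_(J : {ffun 'I_p -> 'I_N} | allpos J && (\sum_(q < p) J q == k)%N) F (fun q => J q) =
  \sum_(J : {ffun 'I_p -> 'I_k.+1} | allpos J && (\sum_(q < p) J q == k)%N) F (fun q =>
    J q).
Proof.
move=> kN.
rewrite (reindex_onto (fun J : {ffun 'I_p -> 'I_k.+1} => [ffun q => widen_ord kN (J q)])
  (fun J => [ffun q => inord (J q)])) /=; last first.
  move=> J /andP[_ /eqP Jk]; apply/ffunP => q; rewrite !ffunE; apply/val_inj => /=.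
  by rewrite inordK// ltnS -Jk (bigD1 q)//= leq_addr.
apply: eq_big => [J|J _]; last by congr F; apply/funext => q; rewrite ffunE.
have -> : ([ffun q => inord ([ffun q0 => widen_ord kN (J q0)] q)] == J) = true.
  by apply/eqP/ffunP => q; rewrite !ffunE; apply/val_inj; rewrite /= inordK.
have E1 : allpos [ffun q => widen_ord kN (J q)] = allpos J.
  by apply: eq_forallb => q; rewrite ffunE.
have E2 : (\sum_(q < p) [ffun q0 => widen_ord kN (J q0)] q = \sum_(q < p) J q)%N.
  by apply: eq_bigr => q _; rewrite ffunE.
by rewrite andbT E1 E2.
Qed.

(** Multilinear expansion sorted by total weight. Families containing the index 0 contribute nothing
    because [H 0] is 0, so the weights up to [m] give precisely the index sets of the recursion. *)
Lemma expand_by_weight m p (F : V -> V) (y : V) (e : R) (H : nat -> V) : H 0%N = 0 ->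
  nablap F y (fun _ : 'I_p => \sum_(j < m.+2) e ^+ j *: H j) =
  \sum_(k < m.+1) e ^+ k *: (\sum_(J : {ffun 'I_p -> 'I_k.+1} |
      allpos J && (\sum_(q < p) J q == k)%N) nablap F y (fun q => H (J q)))
  + \sum_(J : {ffun 'I_p -> 'I_m.+2} | (m < \sum_(q < p) J q)%N)
      e ^+ (\sum_(q < p) J q) *: nablap F y (fun q => H (J q)).
Proof.
move=> H0; rewrite (nablap_expand p m.+2 F y (fun j => e ^+ j)).
under eq_bigr => J _ do rewrite prodrXr.
rewrite (bigID (fun J : {ffun 'I_p -> 'I_m.+2} => (m < \sum_(q < p) J q)%N)) /= addrC.
congr (_ + _).
have -> : \sum_(k < m.+1) e ^+ k *: (\sum_(J : {ffun 'I_p -> 'I_k.+1} |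
      allpos J && (\sum_(q < p) J q == k)%N) nablap F y (fun q => H (J q))) =
    \sum_(k < m.+1) \sum_(J : {ffun 'I_p -> 'I_m.+2})
      if (\sum_(q < p) J q == k)%N then e ^+ k *: nablap F y (fun q => H (J q)) else 0.
  apply: eq_bigr => k _.
  rewrite -(@weight_reindex _ p k m.+2 (fun J => nablap F y (fun q => H (J q))));
    last first.
    exact: leq_trans (ltn_ord k) _.
  rewrite -big_mkcond scaler_sumr /= [RHS](bigID (@allpos p m.+2)) /=.
  rewrite [X in _ = _ + X]big1 ?addr0.
    by apply: eq_bigl => J; rewrite andbC.
  move=> J /andP[_]; rewrite negb_forall => /existsP[q]; rewrite -eqn0Ngt => /eqP Jq.
  by rewrite (@nablap_eq0 _ _ _ _ q) ?scaler0// Jq.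
rewrite exchange_big big_mkcond /=; apply: eq_bigr => J _.
rewrite -leqNgt; case: ifPn => [Jm|].
  have Jm' : (\sum_(q < p) J q < m.+1)%N by [].
  rewrite (bigD1 (inord (\sum_(q < p) J q)%N)) //= inordK// eqxx.
  rewrite [X in _ = _ + X]big1 ?addr0// => k kJ.
  by case: eqP => // E; case/eqP: kJ; apply/val_inj; rewrite /= inordK.
rewrite -ltnNge => Jm; rewrite big1// => k _; case: eqP => // E.
by have := ltn_ord k; rewrite -E ltnS leqNgt Jm.
Qed.

End Expansion.

(** * Finite-dimensional encoding of (y^0, ..., y^m) *)

Section Pack.
Context {R : realType} {d m : nat}.
Local Notation V := 'rV[R]_d.
Local Notation VP := 'rV[R]_(m.+1 * d).

(** Sequences vanishing beyond [m] are identified with vectors of m + 1 blocks, a space where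
    compactness and differentiability make sense. Indices beyond [m] are sent to 0. *)
Definition slot_in (j : nat) (w : V) : VP :=
  mxvec (\matrix_(k < m.+1, i < d) (if k == j :> nat then w 0 i else 0)).

Definition slot_out (j : nat) (e : VP) : V :=
  if (j < m.+1)%N then \row_i e 0 (mxvec_index (inord j) i) else 0.

Definition pack (y : nat -> V) : VP := \sum_(j < m.+1) slot_in j (y j).

Fact slot_in_linear j : linear (slot_in j).
Proof.
move=> k u v; apply/rowP => l; case/mxvec_indexP: l => a i.
rewrite /slot_in mxE [in RHS]mxE !mxvecE !mxE.
by case: eqP => _ //; rewrite mulr0 addr0.
Qed.

HB.instance Definition _ j := GRing.isLinear.Build R V VP *:%R (slot_in j)
  (slot_in_linear j).

Lemma slot_in_smooth j : smooth (slot_in j).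
Proof.
move=> n; apply: Cn_rowP => l; case/mxvec_indexP: l => a i.
under eq_fun do rewrite mxvecE mxE.
by case: eqP => _; [exact: Cn_coord|exact: Cn_cst].
Qed.

Lemma slot_out_smooth j : smooth (slot_out j).
Proof.
move=> n; have -> : slot_out j = if (j < m.+1)%N
    then fun e => \row_i e 0 (mxvec_index (inord j) i) else fun=> 0.
  by apply/funext => e; rewrite /slot_out; case: ifP.
case: ifP => _; last exact: Cn_cst.
by apply: Cn_rowP => i; under eq_fun do rewrite mxE; exact: Cn_coord.
Qed.

Lemma slot_out_pack (y : nat -> V) : (forall j, (m < j)%N -> y j = 0) ->
  (fun j => slot_out j (pack y)) = y.
Proof.
move=> y0; apply/funext => j; rewrite /slot_out; case: ifPn => jm;
  last by rewrite y0// ltnNge.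
apply/rowP => i; rewrite mxE /pack summxE (bigD1 (inord j)) //= mxvecE mxE eqxx inordK//.
rewrite big1 ?addr0// => k kj; rewrite mxvecE mxE inordK//; case: eqP => // E.
by case/eqP: kj; apply/val_inj; rewrite /= inordK.
Qed.

Lemma pack_with (y : nat -> V) j u h : (j <= m)%N ->
  pack [eta y with j |-> u + h] = pack [eta y with j |-> u] + slot_in j h.
Proof.
move=> jm; have jm' : (j < m.+1)%N by [].
rewrite /pack (bigD1 (Ordinal jm'))//= [in RHS](bigD1 (Ordinal jm'))//= eqxx linearD.
rewrite -!addrA; congr (_ + _); rewrite [RHS]addrC; congr (_ + _).
apply: eq_bigr => k kj; case: eqP => // E.
by case/eqP: kj; apply/val_inj.
Qed.

Lemma tangent_affine (E F G : normedModType R) (A L : E -> F) (g : F -> G) x w :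
  linear L -> continuous L -> (forall x h, A (x + h) = A x + L h) ->
  (forall p, differentiable g p) -> tangent (g \o A) (x, w) = tangent g (A x, L w).
Proof.
move=> linL cL AL dg.
have [dA vA] : is_diff x A L.
  apply: is_diff_eps => // e e0; exists 1 => // h _.
  by rewrite AL addrAC addrK subrr normr0 mulr_ge0// ltW.
by rewrite tangent_comp// /tangent /= vA.
Qed.

Lemma tangent_sum (E F : normedModType R) (g : E -> F) x (I : Type) (r : seq I) (v : I ->
  E) :
  tangent g (x, \sum_(i <- r) v i) = \sum_(i <- r) tangent g (x, v i).
Proof. by rewrite /tangent /= linear_sum. Qed.

Lemma tangentD (E F : normedModType R) (g : E -> F) x u v :
  tangent g (x, u + v) = tangent g (x, u) + tangent g (x, v).
Proof. by rewrite /tangent /= linearD. Qed.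

End Pack.

(** * Chain rule along the two-scale trajectory *)

Section Chain.
Context {R : realType} {d m : nat}.
Local Notation V := 'rV[R]_d.
Local Notation VP := 'rV[R]_(m.+1 * d).
Variables (a : R -> R -> V -> V) (Z : R -> R -> V -> V).
Hypothesis f_Cn : Cn m.+1 (fun p : R * (R * V) => alpha0 a Z p.1 p.2.1 p.2.2).
Hypothesis f_per : forall t th y, alpha0 a Z t (th + 2 * pi) y = alpha0 a Z t th y.
Local Notation al := (alphat a Z).

Lemma alphat_C1 k : (k <= m)%N -> prof_smooth 1 (al k).
Proof.
move=> km; have [+ _] := alphat_smooth f_Cn f_per km.
exact: prof_smooth_le.
Qed.

Lemma packed_Cn n (g : profile) : prof_smooth n g ->
  Cn n (fun e : R * (R * VP) => g e.1 e.2.1 (fun j => slot_out j e.2.2)).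
Proof.
move=> sg; apply: (sg (R * (R * VP))%type (fun e => e.1) (fun e => e.2.1) (fun j e =>
  slot_out j e.2.2)).
- by apply: fd_prod; [exact: fd_R|apply: fd_prod; [exact: fd_R|exact: fd_rV]].
- by move=> k; exact: Cn_fst.
- by move=> k; exact: (Cn_comp (Cn_snd _ _ _) (Cn_fst _ _ _)).
- by move=> j k; exact: (Cn_comp (Cn_comp (Cn_snd _ _ _) (Cn_snd _ _ _))
  (@slot_out_smooth _ _ _ j k)).
Qed.

Let G k (e : R * (R * VP)) : V := tosc (al k) e.1 e.2.1 (fun j => slot_out j e.2.2).

Let G_diff k p : (k <= m)%N -> differentiable (G k) p.
Proof.
move=> km; have [dG _] : Cn 1 (G k) by apply: packed_Cn; exact: prof_tosc (alphat_C1 km).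
exact: dG.
Qed.

Variables (s eps t : R) (Y : nat -> R -> V) (dY : nat -> V).
Hypothesis Y0 : forall j r, (m < j)%N -> Y j r = 0.
Hypothesis hY : forall j, (j <= m)%N -> is_derive t 1 (Y j) (dY j).
Let y : nat -> V := fun j => Y j t.
Let th := (t - s) / eps.

(** The velocity of [c] splits into the slow time, the fast time with speed 1 / eps, and one
    component per block. The fast part gives alpha minus its mean, by [is_derive_tosc]. *)
Lemma tosc_chain k : (k <= m)%N ->
  is_derive t 1 (fun r => tosc (al k) r ((r - s) / eps) (fun j => Y j r))
    (tosc_dt (al k) t th y + eps^-1 *: (al k t th y - mean (al k) t y)
     + \sum_(j < k.+1) tosc_dy (al k) j t th y (dY j)).
Proof.
move=> km.
pose c r : R * (R * VP) := (r, ((r - s) / eps, pack (fun j => Y j r))).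
have pp r : (fun j => slot_out j (pack (m := m) (fun j => Y j r))) = (fun j => Y j r).
  by apply: slot_out_pack => j jm; exact: Y0.
have -> : (fun r => tosc (al k) r ((r - s) / eps) (fun j => Y j r)) = G k \o c.
  by apply/funext => r; rewrite /G /c /= pp.
have dp : is_derive t 1 (fun r => pack (fun j =>
  Y j r) : VP) (\sum_(j < m.+1) slot_in j (dY j)).
  have -> : (fun r => pack (fun j => Y j r) : VP) = \sum_(j < m.+1) (fun r =>
    slot_in j (Y j r)).
    by apply/funext => r; rewrite fct_sumE.
  apply: is_derive_sum => j; have cj : continuous (slot_in j : V ->
    VP) by exact: (slot_in_smooth j 0).
  have dj := hY (j := j); rewrite -ltnS in dj.
  have dl : differentiable (slot_in j : V -> VP) (Y j t) by apply: linear_differentiable.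
  have := is_derive_comp (dj (ltn_ord j)) dl.
  by rewrite diff_lin.
have dth : is_derive t 1 (fun r : R => (r - s) / eps) eps^-1.
  apply/is_derive_epsP => e e0; exists 1 => // h _.
  have -> : (t + h - s) / eps - (t - s) / eps - h *: eps^-1 = 0.
    by rewrite -[h *: _]/(h * _); ring.
  by rewrite normr0 mulr_ge0// ltW.
have dc : is_derive t 1 c (1, (eps^-1, \sum_(j < m.+1) slot_in j (dY j))).
  by apply: is_derive_pair; exact: is_derive_pair.
apply: (is_derive_eq (is_derive_comp dc (G_diff _ km))).
rewrite -[LHS]/(tangent (G k) (c t, (1, (eps^-1, \sum_(j < m.+1) slot_in j (dY j))))).
have -> : ((1, (eps^-1, \sum_(j < m.+1) slot_in j (dY j))) : R * (R * VP)) =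
    eps^-1 *: (0, (1, 0)) + ((1, (0, 0)) + \sum_(j < m.+1) (0, (0, slot_in j (dY j)))).
  have -> : \sum_(j < m.+1) ((0, (0, slot_in j (dY j))) :
    R * (R * VP)) = (0, (0, \sum_(j < m.+1) slot_in j (dY j))).
    elim/big_ind2 : _ => // x1 x2 y1 y2 -> ->.
    by congr (_, (_, _)); rewrite /= addr0.
  congr (_, (_, _)); rewrite /= ?scaler0 ?add0r ?addr0//.
  exact/esym/mulr1.
rewrite tangent_lin tangentD tangent_sum addrCA addrA; congr (_ + _ *: _ + _).
- have := @tangent_affine _ _ _ _ (fun t' => (t', (th, pack y)) : R * (R * VP)) (fun h =>
  (h, (0, 0))) (G k) t 1.
  move=> <-.
  + have -> : G k \o (fun t' => (t', (th, pack y))) = (fun t' => tosc (al k) t' th y).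
      by apply/funext => t'; rewrite /G /= pp.
    by [].
  + by move=> q u v; congr (_, (_, _)); rewrite /= ?scaler0 ?addr0.
  + by apply: (@Cn_pair _ 0); [exact: Cn_id|exact: Cn_cst].
  + by move=> u v; congr (_, (_, _)); rewrite /= addr0.
  + by move=> p; exact: G_diff.
- have := @tangent_affine _ _ _ _ (fun th' =>
  (t, (th', pack y)) : R * (R * VP)) (fun h => (0, (h, 0))) (G k) th 1.
  move=> <-.
  + have dt := is_derive_tosc (alphat_C1 km) t th y.
    have dd : differentiable (fun th' => tosc (al k) t th' y) th.
      by apply/derivable1_diffP; case: dt.
    have -> : G k \o (fun th' => (t, (th', pack y))) = (fun th' => tosc (al k) t th' y).
      by apply/funext => t'; rewrite /G /= pp.
    by rewrite /tangent /= -deriveE//; case: dt.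
  + by move=> q u v; congr (_, (_, _)); rewrite /= ?scaler0 ?addr0.
  + by apply: (@Cn_pair _ 0); [exact: Cn_cst|apply: (@Cn_pair _ 0);
    [exact: Cn_id|exact: Cn_cst]].
  + by move=> u v; congr (_, (_, _)); rewrite /= addr0.
  + by move=> p; exact: G_diff.
- have km1 : (k.+1 <= m.+1)%N by [].
  have E (j : 'I_m.+1) : tangent (G k) (c t, (0, (0, slot_in j (dY j)))) = tosc_dy
    (al k) j t th y (dY j).
    have jm : (j <= m)%N by rewrite -ltnS.
    have := @tangent_affine _ _ _ _ (fun u =>
      (t, (th, pack [eta y with (j : nat) |-> u])) : R * (R * VP)) (fun h =>
        (0, (0, slot_in j h))) (G k) (y j) (dY j).
    have -> : ([eta y with (j : nat) |-> y j] : nat -> V) = y.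
      by apply/funext => i /=; case: eqP => [->|].
    move=> <-.
    + have -> : G k \o (fun u => (t, (th, pack [eta y with (j : nat) |-> u]))) =
          (fun u => tosc (al k) t th [eta y with (j : nat) |-> u]).
        apply/funext => u; rewrite /G /= slot_out_pack// => i im /=.
        by case: eqP => [ij|_]; [move: im; rewrite ij ltnNge jm|exact: Y0].
      by [].
    + by move=> q u v; congr (_, (_, _)); rewrite /= ?scaler0 ?addr0// linearP.
    + by apply: (@Cn_pair _ 0); [exact: Cn_cst|apply: (@Cn_pair _ 0);
      [exact: Cn_cst|exact: (slot_in_smooth j 0)]].
    + by move=> u v; rewrite pack_with//; congr (_, (_, _)); rewrite /= addr0.
    + by move=> p; exact: G_diff.
  (* The profile of index [k] does not depend on y^j for j > k, so those blocks contribute 0. *)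
  rewrite (big_ord_widen m.+1 (fun j =>
    tosc_dy (al k) j t th y (dY j)) km1) [RHS]big_mkcond /=.
  apply: eq_bigr => j _; rewrite E; case: ifPn => // jk.
  rewrite /tosc_dy.
  have -> : (fun u => tosc (al k) t th [eta y with (j :
    nat) |-> u]) = fun=> tosc (al k) t th y.
    apply/funext => u; apply: tosc_local => i ik /=; case: eqP => // ij.
    by move: jk; rewrite -ij ltnS ik.
  by rewrite (diff_cst (tosc (al k) t th y)).
Qed.

End Chain.

(** * Continuity on a compact interval *)

Section ContOn.
Context {R : realType}.
Implicit Types (E F G : normedModType R).

Lemma cont_onP E (a b : R) (u : R -> E) :
  {within `[a, b], continuous u} <-> cont_on a b u.
Proof.
split=> [/subspace_continuousP H t tab e e0|H].
  have /cvgrPdist_le /(_ e e0) := H t (tab : `[a, b]%classic t).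
  rewrite near_withinE => /nbhs_ballP[q /= q0 Hq]; exists q => // r rab rt.
  by rewrite distrC; apply: Hq => //; rewrite -ball_normE /= distrC.
apply/subspace_continuousP => t tab; apply/cvgrPdist_le => e e0.
have [q q0 Hq] := H t tab e e0.
rewrite near_withinE; apply/nbhs_ballP; exists q => //= r.
by rewrite -ball_normE /= distrC => rt rab; rewrite distrC; exact: Hq.
Qed.

Lemma cont_on_comp E F (a b : R) (u : R -> E) (g : E -> F) :
  continuous g -> cont_on a b u -> cont_on a b (g \o u).
Proof.
move=> cg cu t tab e e0; have /cont_epsP/(_ e e0)[q q0 Hq] := cg (u t).
have [r r0 Hr] := cu t tab (q / 2) (divr_gt0 q0 (ltr0n _ 2)).
exists r => // x xab xt; have := Hq (u x - u t); rewrite [u t + _]addrC subrK; apply.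
by apply: le_lt_trans (Hr x xab xt) _; rewrite ltr_pdivrMr// ltr_pMr// ltr1n.
Qed.

Lemma cont_on_pair E F (a b : R) (u : R -> E) (v : R -> F) :
  cont_on a b u -> cont_on a b v -> cont_on a b (fun t => (u t, v t)).
Proof.
move=> cu cv t tab e e0.
have [q q0 Hq] := cu t tab e e0; have [r r0 Hr] := cv t tab e e0.
exists (Num.min q r) => [|x xab]; first by rewrite lt_min q0.
rewrite lt_min => /andP[xq xr]; rewrite prod_normE /= ge_max.
by rewrite Hq// Hr.
Qed.

Lemma cont_on_add E (a b : R) (u v : R -> E) :
  cont_on a b u -> cont_on a b v -> cont_on a b (fun t => u t + v t).
Proof.
move=> cu cv; apply: (@cont_on_comp _ _ a b (fun t => (u t, v t)) (fun p => p.1 + p.2));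
  last exact: cont_on_pair.
exact: (Cn_cont (Cn_add (Cn_fst 0 _ _) (Cn_snd 0 _ _))).
Qed.

Lemma cont_on_scale E (a b k : R) (u : R -> E) :
  cont_on a b u -> cont_on a b (fun t => k *: u t).
Proof.
apply: (@cont_on_comp _ _ a b u (fun v => k *: v)).
exact: (Cn_cont (Cn_scale (Cn_cst 0 _ k) (Cn_id 0 _))).
Qed.

Lemma cont_on_continuous E (a b : R) (u : R -> E) : continuous u -> cont_on a b u.
Proof.
move=> cu; apply/cont_onP; exact: continuous_subspaceT.
Qed.

Lemma cont_on_sum E (a b : R) (I : Type) (r : seq I) (u : I -> R -> E) :
  (forall i, cont_on a b (u i)) -> cont_on a b (fun t => \sum_(i <- r) u i t).
Proof.
move=> H; elim: r => [|i r IH].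
  under eq_fun do rewrite big_nil; apply: cont_on_continuous => t; exact: cvg_cst.
by under eq_fun do rewrite big_cons; exact: cont_on_add.
Qed.

Lemma cont_on_bounded E (a b : R) (u : R -> E) : a <= b -> cont_on a b u ->
  exists2 M : R, 0 <= M & forall t, a <= t <= b -> `|u t| <= M.
Proof.
move=> ab cu; have cn : cont_on a b (fun t => `|u t|).
  apply: (@cont_on_comp _ _ a b u (fun v : E => `|v|)) => //; exact: norm_continuous.
have [c cab Hc] := EVT_max ab ((cont_onP _ _ _).2 cn).
exists `|u c| => // t tab; apply: Hc; rewrite in_itv /=; exact: tab.
Qed.

End ContOn.

(** * Euclidean norm, uniform convergence and essential bounds *)

Section Norms.
Context {R : realType} {d : nat}.
Local Notation V := 'rV[R]_d.

Lemma enorm_ge0 (v : V) : 0 <= enorm v.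
Proof. exact: sqrtr_ge0. Qed.

Lemma enorm_le (v : V) : enorm v <= Num.sqrt d%:R * `|v|.
Proof.
have -> : `|v| = Num.sqrt (`|v| ^+ 2) by rewrite sqrtr_sqr normr_id.
rewrite -sqrtrM ?ler0n// ler_sqrt; last by apply: mulr_ge0; rewrite ?ler0n ?sqr_ge0.
rewrite mulr_natl -[X in _ <= _ *+ X](card_ord d) -sumr_const.
apply: ler_sum => i _; rewrite -real_normK ?num_real//.
by apply: lerXn2r; rewrite ?nnegrE ?normr_ge0// coord_norm.
Qed.

Lemma cvg_unif_eps_linear (D : set R) (F : R -> R -> V) (G : R -> V) (K eps0 : R) :
  0 < eps0 -> 0 <= K -> D !=set0 ->
  (forall eps t, 0 < eps <= eps0 -> D t -> `|F eps t - G t| <= K * eps) ->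
  cvg_unif_eps D F G.
Proof.
move=> e0 K0 [t0 Dt0] H.
pose C := Num.sqrt d%:R * K.
have C0 : 0 <= C by rewrite mulr_ge0// sqrtr_ge0.
apply: (@squeeze_cvge _ _ _ _ (fun=> 0%E) _ (fun eps => (C * eps)%:E)).
- near=> eps.
  have ee : 0 < eps <= eps0.
    by apply/andP; split; near: eps; [exact: nbhs_right_gt|exact: nbhs_right_le].
  apply/andP; split.
    (* A point of [D] is needed for the lower bound: over an empty set the extended supremum would
       be minus infinity. *)
    apply: (@le_trans _ _ (enorm (F eps t0 - G t0))%:E); first by rewrite lee_fin enorm_ge0.
    by apply: ereal_sup_ubound; exists t0.
  apply: ge_ereal_sup => _ [t Dt <-]; rewrite lee_fin.
  apply: le_trans (enorm_le _) _; rewrite /C -mulrA.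
  by apply: ler_wpM2l; [exact: sqrtr_ge0|exact: H].
- exact: cvg_cst.
- apply: cvg_EFin; first by near=> eps.
  rewrite -[X in _ --> X](mulr0 C); apply: cvgM; first exact: cvg_cst.
  exact: cvg_within.
Unshelve. all: by end_near. Qed.

Lemma bounded_Linfty_cont (a b : R) (F : R -> R -> V) (K : R) : 0 <= K ->
  (forall eps, 0 < eps -> cont_on a b (F eps)) ->
  (forall eps t, 0 < eps -> a <= t <= b -> `|F eps t| <= K) ->
  bounded_Linfty `[a, b] F.
Proof.
move=> K0 cF FK; exists (Num.sqrt d%:R * K) => eps e0; split=> [i|].
  apply: measurable_realfun.subspace_continuous_measurable_fun; first exact: measurable_itv.
  apply/cont_onP; apply: (@cont_on_comp _ _ _ a b (F eps) (fun v => v 0 i)); last exact: cF.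
  exact: (Cn_cont (@Cn_coord R 0 d i)).
have P0 : 0 <= Num.sqrt d%:R * K by rewrite mulr_ge0// sqrtr_ge0.
rewrite unlock; case: ifPn => _; last by rewrite lee_fin.
apply/ess_sup_inf.ess_supP; apply: nearW => t /=.
rewrite /patch; case: ifPn => [|_]; last by rewrite abse0 lee_fin.
rewrite inE /= in_itv /= => tab; rewrite lee_fin ger0_norm ?enorm_ge0//.
apply: le_trans (enorm_le _) _; apply: ler_wpM2l; first exact: sqrtr_ge0.
exact: FK.
Qed.

End Norms.

(** * Expansion of alpha^0 in powers of eps *)

Section TaylorByWeight.
Context {R : realType} {d m : nat}.
Local Notation V := 'rV[R]_d.
Variables (a : R -> R -> V -> V) (Z : R -> R -> V -> V).
Hypothesis f_Cn : Cn m.+1 (fun p : R * (R * V) => alpha0 a Z p.1 p.2.1 p.2.2).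
Hypothesis f_per : forall t th y, alpha0 a Z t (th + 2 * pi) y = alpha0 a Z t th y.
Local Notation f := (alpha0 a Z).
Variables (s0 s1 : R).

(** The Taylor part of the recursion, with arbitrary vectors [H j] in place of the h^j. *)
Definition weight_coef (F : V -> V) (y : V) (H : nat -> V) (k : nat) : V :=
  \sum_(1 <= p < k.+1) (p`!%:R)^-1 *:
    (\sum_(J : {ffun 'I_p -> 'I_k.+1} | allpos J && (\sum_(q < p) J q == k)%N)
       nablap F y (fun q => H (J q))).

(** A family of p positive indices has sum at least p, so weight [k] only sees p up to [k]; and p =
    0 contributes in weight 0 alone. *)
Lemma weight_coefE (F : V -> V) (y : V) (H : nat -> V) (k : nat) :
  (k <= m)%N ->
  \sum_(p < m.+1) (p`!%:R)^-1 *: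
    (\sum_(J : {ffun 'I_p -> 'I_k.+1} | allpos J && (\sum_(q < p) J q == k)%N)
       nablap F y (fun q => H (J q)))
  = if k is 0%N then F y else weight_coef F y H k.
Proof.
move=> km; pose S p : V := (p`!%:R)^-1 *:
    (\sum_(J : {ffun 'I_p -> 'I_k.+1} | allpos J && (\sum_(q < p) J q == k)%N)
       nablap F y (fun q => H (J q))).
have SE p : (k < p)%N -> S p = 0.
  move=> kp; rewrite /S big1 ?scaler0// => J /andP[/sum_allpos Jp /eqP Jk].
  by move: Jp; rewrite Jk leqNgt kp.
have -> : \sum_(p < m.+1) S p = \sum_(0 <= p < k.+1) S p.
  rewrite -(big_mkord xpredT S) (@big_cat_nat _ _ _ k.+1)//=.
  by rewrite [X in _ + X]big_nat [X in _ + X]big1 ?addr0// => p /andP[/SE].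
rewrite big_nat_recl//; case: k {km SE} @S => [|k] S.
  rewrite big_nil addr0 /S fact0 invr1 scale1r.
  rewrite (bigD1 (ffun0 (card_ord 0)))//=; last first.
    by rewrite big_ord0 eqxx andbT; apply/forallP => -[].
  rewrite nablap0 big1 ?addr0// => J /andP[_ /eqP[]].
  by apply/ffunP => -[].
have -> : S 0%N = 0.
  by rewrite /S big1 ?scaler0// => J /andP[_]; rewrite big_ord0.
by rewrite add0r /weight_coef big_add1.
Qed.

(** Two errors of order eps^(m+1) add up: the Taylor remainder, since the increment starts at the
    power eps^1, and the terms of weight above [m] in the expanded polynomial. *)
Lemma f_taylor_weight (r C : R) : 0 <= r -> 0 <= C -> exists2 M : R, 0 <= M &
  forall t th y (H : nat -> V) eps, s0 <= t <= s1 -> `|y| <= r ->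
    (forall j, (j < m.+2)%N -> `|H j| <= C) -> H 0%N = 0 -> 0 < eps <= 1 ->
    `|f t th (y + \sum_(j < m.+2) eps ^+ j *: H j) -
      (f t th y + \sum_(k < m) eps ^+ k.+1 *: weight_coef (f t th) y H k.+1)|
    <= M * eps ^+ m.+1.
Proof.
move=> r0 C0; pose C1 := m.+2%:R * C.
have C10 : 0 <= C1 by rewrite mulr_ge0.
have [M1 M10 HM1] := f_taylor f_Cn f_per s0 s1 (r + C1).
have H2 (p : 'I_m.+1) : exists M, 0 <= M /\ forall t th y (H : nat -> V) eps,
    s0 <= t <= s1 -> `|y| <= r -> (forall j, (j < m.+2)%N -> `|H j| <= C) -> 0 < eps <= 1 ->
    `|\sum_(J : {ffun 'I_p -> 'I_m.+2} | (m < \sum_(q < p) J q)%N)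
       eps ^+ (\sum_(q < p) J q) *: nablap (f t th) y (fun q =>
         H (J q))| <= M * eps ^+ m.+1.
  have [|M M0 HM] := nablap_bound f_Cn f_per s0 s1 (p := p) r; first exact: ltnW.
  exists (\sum_(J : {ffun 'I_p -> 'I_m.+2}) M * C ^+ p); split.
    by apply: sumr_ge0 => J _; rewrite mulr_ge0// exprn_ge0.
  move=> t th y H eps ts yr HC e01; have /andP[e0 e1] := e01.
  have em : 0 <= eps ^+ m.+1 by rewrite exprn_ge0// ltW.
  apply: le_trans (ler_norm_sum _ _ _) _; rewrite mulr_suml big_mkcond /=.
  apply: ler_sum => J _; case: ifPn => Jm; last by rewrite !mulr_ge0// exprn_ge0.
  rewrite normrZ mulrC; apply: ler_pM => //.
    have := HM t th y (fun q => H (J q)) (fun=> C) ts yr (fun q => HC _ (ltn_ord (J q))).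
    by rewrite prodr_const card_ord.
  rewrite ger0_norm ?exprn_ge0 ?(ltW e0)//.
  by apply: ler_wiXn2l => //; exact: ltW.
have [M2 HM2] := choice H2.
exists (M1 * C1 ^+ m.+1 + \sum_(p < m.+1) M2 p).
  apply: addr_ge0; first by rewrite mulr_ge0// exprn_ge0.
  by apply: sumr_ge0 => p _; case: (HM2 p).
move=> t th y H eps ts yr HC HH0 e01; have /andP[e0 e1] := e01.
have em : 0 <= eps ^+ m.+1 by rewrite exprn_ge0// ltW.
set h := \sum_(j < m.+2) eps ^+ j *: H j.
have hC : `|h| <= C1 * eps.
  apply: le_trans (ler_norm_sum _ _ _) _.
  have -> : C1 * eps = \sum_(j < m.+2) C * eps.
    by rewrite sumr_const card_ord /C1 -mulrA mulr_natl.
  apply: ler_sum => -[[|j] jm] _ /=.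
    by rewrite HH0 scaler0 normr0 mulr_ge0// ltW.
  rewrite normrZ mulrC; apply: ler_pM => //; first exact: HC.
  rewrite ger0_norm ?exprn_ge0 ?(ltW e0)// exprS.
  by rewrite ler_piMr ?(ltW e0)// exprn_ile1// ltW.
have hC1 : `|h| <= C1 by apply: le_trans hC _; rewrite ler_piMr.
have T := HM1 t th y h ts (le_trans yr _) (le_trans hC1 _).
have {}T := T (ler_wpDr C10 (lexx r)) (ler_wpDl r0 (lexx C1)).
pose W p : V := \sum_(J : {ffun 'I_p -> 'I_m.+2} | (m < \sum_(q < p) J q)%N)
       eps ^+ (\sum_(q < p) J q) *: nablap (f t th) y (fun q => H (J q)).
have E : \sum_(p < m.+1) (p`!%:R)^-1 *: nablap (f t th) y (fun _ : 'I_p => h) =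
    (f t th y + \sum_(k < m) eps ^+ k.+1 *: weight_coef (f t th) y H k.+1)
    + \sum_(p < m.+1) (p`!%:R)^-1 *: W p.
  under eq_bigr => p _ do rewrite /h (expand_by_weight m p (f t th) y eps HH0) scalerDr.
  rewrite big_split; apply: (congr1 (fun v => v + _)).
  under eq_bigr => p _ do rewrite scaler_sumr.
  rewrite exchange_big big_ord_recl /=.
  have F k : (k <= m)%N -> \sum_(p < m.+1) (p`!%:R)^-1 *: (eps ^+ k *: (\sum_(J :
    {ffun 'I_p -> 'I_k.+1} |
      allpos J && (\sum_(q < p) J q == k)%N) nablap (f t th) y (fun q => H (J q)))) =
      eps ^+ k *: (if k is 0%N then f t th y else weight_coef (f t th) y H k).
    move=> km; rewrite -(weight_coefE (f t th) y H km) scaler_sumr.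
    by apply: eq_bigr => p _; rewrite !scalerA mulrC.
  rewrite (F 0%N)// expr0 scale1r; apply: (congr1 (fun v => _ + v)).
  by apply: eq_bigr => k _; rewrite (F k.+1)// ltn_ord.
have aux (u v w : V) : u - v = u - (v + w) + w by rewrite opprD addrA subrK.
have -> : f t th (y + h) - (f t th y + \sum_(k < m) eps ^+ k.+1 *: weight_coef
  (f t th) y H k.+1)
   = (f t th (y + h) - \sum_(p < m.+1) (p`!%:R)^-1 *: nablap (f t th) y (fun _ : 'I_p => h))
     + \sum_(p < m.+1) (p`!%:R)^-1 *: W p.
  rewrite E; exact: aux.
apply: le_trans (ler_normD _ _) _; rewrite mulrDl; apply: lerD.
  apply: le_trans T _; rewrite -mulrA -exprMn; apply: ler_wpM2l => //.
  by apply: lerXn2r; rewrite ?nnegrE ?normr_ge0 ?mulr_ge0// ltW.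
apply: le_trans (ler_norm_sum _ _ _) _; rewrite mulr_suml; apply: ler_sum => p _.
have [M2p HW] := HM2 p; apply: le_trans (HW t th y H eps ts yr HC e01).
rewrite normrZ ler_piMl// ger0_norm ?invr_ge0 ?ler0n// invf_le1 ?ltr0n ?fact_gt0//.
by rewrite ler1n fact_gt0.
Qed.

End TaylorByWeight.

(** * Error estimates *)

Section Asymptotics.
Context {R : realType} {d m : nat}.
Local Notation V := 'rV[R]_d.
Local Notation VP := 'rV[R]_(m.+1 * d).
Variables (a : R -> R -> V -> V) (Z : R -> R -> V -> V).
Hypothesis f_Cn : Cn m.+1 (fun p : R * (R * V) => alpha0 a Z p.1 p.2.1 p.2.2).
Hypothesis f_per : forall t th y, alpha0 a Z t (th + 2 * pi) y = alpha0 a Z t th y.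
Local Notation f := (alpha0 a Z).
Local Notation al := (alphat a Z).
Variables (x : V) (s T : R) (T_gt0 : 0 < T) (Y : nat -> R -> V).
Hypothesis Y_vanish : forall j r, (m < j)%N -> Y j r = 0.
Hypothesis Y_cont : forall j, cont_on s (s + T) (Y j).
Hypothesis Y_init : forall j, Y j s = if j is 0%N then x else 0.
Hypothesis Y_ode : forall j, (j <= m)%N -> forall t : R, s < t < s + T ->
  is_derive t 1 (Y j) (mean (al j) t (fun i => Y i t)).

Let Yt t : nat -> V := fun j => Y j t.
Let Yp t : VP := pack (Yt t).

Let proj_Yp t : (fun j => slot_out j (Yp t)) = Yt t.
Proof. by apply: slot_out_pack => j; exact: Y_vanish. Qed.

Let sT : s <= s + T.
Proof. by rewrite lerDl ltW. Qed.

Let Yp_cont : cont_on s (s + T) Yp.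
Proof.
apply: cont_on_sum => j; apply: (@cont_on_comp _ _ _ _ _ (Y j) (slot_in j));
  last exact: Y_cont.
exact: (Cn_cont (@slot_in_smooth _ _ _ j 0)).
Qed.

Lemma prof_bounded (g : profile) : prof_smooth 0 g ->
  (forall t th y, g t (th + 2 * pi) y = g t th y) ->
  exists2 C : R, 0 <= C & forall t th, s <= t <= s + T -> `|g t th (Yt t)| <= C.
Proof.
move=> sg pg; have [M M0 HM] := cont_on_bounded sT Yp_cont.
have [|||C C0 HC] := @periodic_bounded R s (s + T) VP V M (fun t th e => g t th (fun j =>
  slot_out j e)).
- exact: fd_rV.
- exact: (packed_Cn sg).
- by move=> t th e; exact: pg.
by exists C => // t th ts; rewrite -proj_Yp; apply: HC => //; exact: HM.
Qed.

Lemma tosc_bounded : exists2 C : R, 0 <= C &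
  forall k t th, (k <= m)%N -> s <= t <= s + T -> `|tosc (al k) t th (Yt t)| <= C.
Proof.
have H (k : 'I_m.+1) : exists C : R, 0 <= C /\
    forall t th, s <= t <= s + T -> `|tosc (al k) t th (Yt t)| <= C.
  have km : (k <= m)%N by rewrite -ltnS.
  have a1 := alphat_C1 f_Cn f_per km; have [_ [pk _]] := alphat_smooth f_Cn f_per km.
  have [|C C0 HC] := @prof_bounded (tosc (al k)) _ (tosc_per a1 pk); last by exists C.
  by apply: prof_smooth_le (prof_tosc a1).
have [C HC] := choice H.
exists (\sum_k C k); first by apply: sumr_ge0 => k _; case: (HC k).
move=> k t th km ts; have kk : (k < m.+1)%N by [].
have [_ HCk] := HC (Ordinal kk); apply: le_trans (HCk t th ts) _.
by rewrite (bigD1 (Ordinal kk))//= lerDl; apply: sumr_ge0 => i _; case: (HC i).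
Qed.

Lemma profiles_bounded : exists2 C : R, 0 <= C &
  forall j t, s <= t <= s + T -> `|Y j t| <= C.
Proof.
have [M M0 HM] := cont_on_bounded sT Yp_cont.
exists M => // j t ts; apply: le_trans (HM t ts).
rewrite -[Y j t]/(Yt t j) -proj_Yp; apply: rV_norm_le => // i.
rewrite /slot_out; case: ifP => _; rewrite mxE ?normr0//; exact: coord_norm.
Qed.

Lemma tosc0 (al : @profile R d) t y : tosc al t 0 y = 0.
Proof. by rewrite toscE vint0 scale0r subrr. Qed.

Section Ansatz.
Variable eps : R.
Local Notation th t := ((t - s) / eps).

Definition osc_at j t : V := tosc (al j) t (th t) (Yt t).

Definition ansatz n t : V := \sum_(j < n) eps ^+ j *: (Y j t + eps *: osc_at j t).

(** The vector h^j of the recursion along the trajectory: Y^j and theta A^(j-1) carry the same power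
    of eps. Index 0 is set to 0 because Y^0 is the base point of the expansion. *)
Definition ansatz_incr t (j : nat) : V := if j is j'.+1 then Y j t + osc_at j' t else 0.

(** Grouping by powers of eps shifts the oscillating part by one index and brings in a term Y^(n+1)
    absent from the ansatz, which is subtracted; at n = m it is 0 by [Y_vanish]. *)
Lemma ansatzE n t : ansatz n.+1 t =
  Y 0%N t + \sum_(j < n.+2) eps ^+ j *: ansatz_incr t j - eps ^+ n.+1 *: Y n.+1 t.
Proof.
elim: n => [|n IH].
  rewrite /ansatz big_ord1 !big_ord_recr big_ord0 /= expr0 expr1.
  by set u := osc_at 0 t; lmod R.
rewrite /ansatz big_ord_recr -/(ansatz n.+1 t) IH [in RHS]big_ord_recr /=.
set S := \sum_(j < n.+2) _; set u := osc_at _ t.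
rewrite !exprS; lmod R.
Qed.

Lemma ansatzEm t : ansatz m.+1 t = Y 0%N t + \sum_(j < m.+2) eps ^+ j *: ansatz_incr t j.
Proof. by rewrite ansatzE (Y_vanish t (ltnSn m)) scaler0 subr0. Qed.

Lemma ansatz_init : ansatz m.+1 s = x.
Proof.
rewrite /ansatz big_ord_recl big1 ?addr0 => [|j _].
  by rewrite expr0 scale1r Y_init /osc_at subrr mul0r tosc0 scaler0 addr0.
by rewrite Y_init /osc_at subrr mul0r tosc0 scaler0 addr0 scaler0.
Qed.

Lemma osc_at_cont j : (j <= m)%N -> cont_on s (s + T) (osc_at j).
Proof.
move=> jm; have Cg := prof_smooth_le (leq0n 1) (prof_tosc (alphat_C1 f_Cn f_per jm)).
have -> : osc_at j = (fun e : R * (R * VP) => tosc (al j) e.1 e.2.1 (fun j =>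
  slot_out j e.2.2)) \o
    (fun t => (t, (th t, Yp t))).
  by apply/funext => t; rewrite /= proj_Yp.
apply: cont_on_comp; first exact: (packed_Cn Cg).
apply: cont_on_pair; first by apply: cont_on_continuous => t; exact: cvg_id.
apply: cont_on_pair => //; apply: cont_on_continuous.
apply: (Cn_cont (n := 0)); apply: Cn_mul; last exact: Cn_cst.
by apply: Cn_sub; [exact: Cn_id|exact: Cn_cst].
Qed.

Lemma ansatz_cont : cont_on s (s + T) (ansatz m.+1).
Proof.
apply: cont_on_sum => j; apply: cont_on_scale; apply: cont_on_add; first exact: Y_cont.
by apply: cont_on_scale; apply: osc_at_cont; rewrite -ltnS.
Qed.

Hypothesis eps_gt0 : 0 < eps.

Lemma is_derive_ansatz (t : R) : s < t < s + T ->
  is_derive t 1 (ansatz m.+1)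
    (\sum_(j < m.+1) eps ^+ j *: (al j t (th t) (Yt t) + eps *: transport a Z j.+1 t
      (th t) (Yt t))).
Proof.
move=> ts.
have -> : ansatz m.+1 = \sum_(j < m.+1) (fun t => eps ^+ j *: (Y j t + eps *: osc_at j t)).
  by apply/funext => r; rewrite fct_sumE.
apply: is_derive_sum => j; have jm : (j <= m)%N by rewrite -ltnS.
have d1 := Y_ode jm ts.
have d2 := tosc_chain f_Cn f_per s eps Y_vanish (fun i im => Y_ode im ts) jm.
have d3 := is_deriveZ eps d2.
have d4 := is_deriveD d1 d3.
apply: (is_derive_eq (is_deriveZ (eps ^+ j) d4)).
rewrite /transport -/(Yt t); set A := \sum_(i < _) _; set B := tosc_dt _ _ _ _.
rewrite -[X in mean _ _ X]/(Yt t); set M := mean _ _ _; set F := al _ _ _ _.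
apply: (congr1 (fun v => eps ^+ j *: v)).
(* The mean driving Y^j cancels the one subtracted in the fast derivative of theta A^j, which leaves
   alpha^j itself. *)
have aux (u v w z : V) : u + eps *: (v + eps^-1 *: (w - u) + z) = w + eps *: (z + v).
  rewrite (scalerDr eps _ z) (scalerDr eps v) scalerA divff ?gt_eqF// scale1r; lmod R.
exact: aux.
Qed.

Lemma ansatz_telescope n t (thv : R) (y : nat -> V) : (n <= m)%N ->
  \sum_(j < n.+1) eps ^+ j *: (al j t thv y + eps *: transport a Z j.+1 t thv y) =
  f t thv (y 0%N) + \sum_(j < n) eps ^+ j.+1 *: taylor_term a Z al j.+1 t thv y
  + eps ^+ n.+1 *: transport a Z n.+1 t thv y.
Proof.
elim: n => [_|n IH nm].
  rewrite big_ord1 big_ord0 addr0 expr0 scale1r expr1.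
  by rewrite (alphat0E a Z t thv y).
rewrite big_ord_recr IH ?(ltnW nm)// [in RHS]big_ord_recr /=.
have [_ [_ alE]] := alphat_smooth f_Cn f_per nm.
rewrite (alE t thv y isT).
have aux (A S P Q D : V) (k : R) :
  A + S + k *: P + k *: (Q - P + eps *: D) = A + (S + k *: Q) + (eps * k) *: D.
  by lmod R.
by rewrite [in RHS](exprS eps n.+1); exact: aux.
Qed.

End Ansatz.

Lemma ansatz_residual : exists2 M : R, 0 <= M &
  forall eps (t : R), 0 < eps <= 1 -> s < t < s + T -> exists2 dW : V,
    is_derive t 1 (ansatz eps m.+1) dW &
    `|f t ((t - s) / eps) (ansatz eps m.+1 t) - dW| <= M * eps ^+ m.+1.
Proof.
have [C1 C10 HC1] := profiles_bounded; have [C2 C20 HC2] := tosc_bounded.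
have als j : (j <= m)%N -> prof_smooth 1 (al j) by exact: (alphat_C1 f_Cn f_per).
have [_ [pm _]] := alphat_smooth f_Cn f_per (leqnn m).
have [C3 C30 HC3] := prof_bounded (transport_smooth als) (transport_per als pm).
have [M M0 HM] := f_taylor_weight f_Cn f_per s (s + T) C10 (addr_ge0 C10 C20).
exists (M + C3) => [|eps t e01 ts]; first exact: addr_ge0.
have /andP[e0 e1] := e01.
have tst : s <= t <= s + T by case/andP: ts => /ltW -> /ltW ->.
have dW := is_derive_ansatz e0 ts; eexists; first exact: dW.
rewrite ansatz_telescope//.
have aI j : (j < m.+2)%N -> `|ansatz_incr eps t j| <= C1 + C2.
  case: j => [_|j jm]; first by rewrite normr0 addr_ge0.
  apply: le_trans (ler_normD _ _) _; apply: lerD; first exact: HC1.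
  exact: HC2.
have := HM t ((t - s) / eps) (Y 0%N t) (ansatz_incr eps t) eps tst (HC1 0%N t tst) aI
  (erefl _) e01.
rewrite -ansatzEm.
(* On positive indices [ansatz_incr] is the h^j of the recursion, so the coefficients are the Taylor
   terms. *)
have -> : \sum_(k < m) eps ^+ k.+1 *: weight_coef (f t ((t - s) / eps)) (Y 0%N t)
  (ansatz_incr eps t) k.+1 =
    \sum_(j < m) eps ^+ j.+1 *: taylor_term a Z al j.+1 t ((t - s) / eps) (Yt t).
  apply: eq_bigr => k _; apply: (congr1 (fun v => eps ^+ k.+1 *: v)).
  rewrite taylor_termE; apply: eq_bigr => p _.
  apply: (congr1 (fun v : V => (p`!%:R)^-1 *: v)).
  apply: eq_bigr => J /andP[/forallP J0 _].
  apply: (congr1 (nablap (f t ((t - s) / eps)) (Y 0%N t))).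
  by apply/funext => q; have := J0 q; case: (nat_of_ord (J q)).
set S := \sum_(j < m) _; set P := transport _ _ _ _ _ _; set F := f _ _ (ansatz _ _ _).
have -> : f t ((t - s) / eps) (Yt t 0%N) = f t ((t - s) / eps) (Y 0%N t) by [].
set G := f _ _ (Y 0%N t) => HF.
rewrite opprD addrA mulrDl; apply: le_trans (ler_normB _ _) _.
apply: lerD => //; rewrite normrZ mulrC ger0_norm ?exprn_ge0 ?(ltW e0)//.
apply: ler_wpM2r; first by rewrite exprn_ge0// ltW.
exact: HC3.
Qed.

Variables (f_bound : exists M : R, forall t th y, `|f t th y| <= M).
Variable Yeps : R -> R -> V.
Hypothesis Yeps_init : forall eps, 0 < eps -> Yeps eps s = x.
Hypothesis Yeps_cont : forall eps, 0 < eps -> cont_on s (s + T) (Yeps eps).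
Hypothesis Yeps_ode : forall eps, 0 < eps -> forall t : R, s < t < s + T ->
  is_derive t 1 (Yeps eps) (f t ((t - s) / eps) (Yeps eps t)).

Lemma ansatz_bounded : exists2 C : R, 0 <= C &
  forall eps t, 0 < eps <= 1 -> s <= t <= s + T -> `|ansatz eps m.+1 t| <= C.
Proof.
have [C1 C10 HC1] := profiles_bounded; have [C2 C20 HC2] := tosc_bounded.
exists (m.+1%:R * (C1 + C2)) => [|eps t /andP[e0 e1] ts].
  by rewrite mulr_ge0// addr_ge0.
apply: le_trans (ler_norm_sum _ _ _) _.
rewrite mulr_natl -[X in _ *+ X](card_ord m.+1) -sumr_const; apply: ler_sum => j _.
rewrite normrZ ger0_norm ?exprn_ge0 ?(ltW e0)//.
apply: le_trans (ler_piMl _ _) _ => //; first by rewrite exprn_ile1 ?(ltW e0).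
apply: le_trans (ler_normD _ _) _; apply: lerD; first exact: HC1.
rewrite normrZ ger0_norm ?(ltW e0)//; apply: le_trans (ler_piMl _ _) _ => //.
by apply: HC2 => //; rewrite -ltnS.
Qed.

Lemma ansatz_error : exists K eps0 : R, [/\ 0 <= K, 0 < eps0 <= 1 &
  forall eps t, 0 < eps <= eps0 -> s <= t <= s + T ->
    `|Yeps eps t - ansatz eps m.+1 t| <= K * eps ^+ m.+1].
Proof.
have [C C0 HC] := ansatz_bounded; have [M M0 HM] := ansatz_residual.
(* The ball of radius [C + 1] contains the ansatz, and also the exact solution as long as their
   distance is below 1, the threshold given to Gronwall's lemma. *)
have [L L0 HL] := f_lipschitz f_Cn f_per s (s + T) (C + 1).
pose K := M * T * expR (L * T).
have K0 : 0 <= K by rewrite !mulr_ge0 ?expR_ge0// ltW.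
have K1 : 0 < 1 + K by rewrite ltr_wpDr.
(* For these eps the bound [K * eps ^+ m.+1] is below 1, which closes the bootstrap. *)
exists K, (1 + K)^-1; split=> //.
  by rewrite invr_gt0 K1 /= invf_le1// lerDl.
move=> eps t /andP[e0 eK] ts.
have e1 : eps <= 1 by apply: le_trans eK _; rewrite invf_le1// lerDl.
have e01 : 0 < eps <= 1 by rewrite e0.
have em : 0 <= eps ^+ m.+1 by rewrite exprn_ge0// ltW.
have sTs : s + T - s = T by rewrite addrAC subrr add0r.
have KE : (0 + M * eps ^+ m.+1 * (s + T - s)) * expR (L * (s + T - s)) = K * eps ^+ m.+1.
  by rewrite sTs add0r /K; ring.
(* The value 0 is a default: derivatives are known only in the open interval. *)
pose du r := if r \in `]s, s + T[ then f r ((r - s) / eps) (Yeps eps r) - 'D_1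
  (ansatz eps m.+1) r else 0.
have duE r : s < r < s + T -> du r = f r ((r - s) / eps) (Yeps eps r) - 'D_1
  (ansatz eps m.+1) r.
  by move=> rs; rewrite /du in_itv /= rs.
have dA r : s < r < s + T -> is_derive r 1 (ansatz eps m.+1) ('D_1 (ansatz eps m.+1) r) /\
    `|f r ((r - s) / eps) (ansatz eps m.+1 r) - 'D_1 (ansatz eps m.+1) r| <=
      M * eps ^+ m.+1.
  by move=> rs; have [dW dWE HW] := HM eps r e01 rs; case: (dWE) => ex v; rewrite v.
rewrite -KE.
apply: (@gronwall R V (fun r =>
  Yeps eps r - ansatz eps m.+1 r) du s (s + T) L (M * eps ^+ m.+1) 0 1) => //.
- apply: cont_on_add; first exact: Yeps_cont.
  have -> : (fun r => - ansatz eps m.+1 r) = (fun r => (-1) *: ansatz eps m.+1 r).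
    by apply/funext => r; rewrite scaleN1r.
  by apply: cont_on_scale; exact: ansatz_cont.
- move=> r rs; rewrite duE//; have [dAr _] := dA r rs.
  exact: is_deriveB (Yeps_ode e0 rs) dAr.
- exact: mulr_ge0.
- by rewrite Yeps_init// ansatz_init subrr normr0.
- move=> r rs u1; rewrite duE//; have [_ HR] := dA r rs.
  have rs' : s <= r <= s + T by case/andP: rs => /ltW -> /ltW ->.
  have A1 := HC eps r e01 rs'.
  have B1 : `|Yeps eps r| <= C + 1.
    rewrite -[Yeps eps r](subrK (ansatz eps m.+1 r)); apply: le_trans (ler_normD _ _) _.
    by rewrite addrC; apply: lerD => //; exact: ltW.
  have := HL r ((r - s) / eps) _ _ rs' B1 (ler_wpDr ler01 A1).
  set F := f r _ (Yeps eps r); set G := f r _ (ansatz _ _ _) in HR *; move=> FG.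
  rewrite -[F](subrK G) -addrA; apply: le_trans (ler_normD _ _) _.
  exact: lerD.
- rewrite KE; apply: (@le_lt_trans _ _ (K * eps)).
    by apply: ler_wpM2l => //; rewrite exprS ler_piMr ?(ltW e0)// exprn_ile1// ltW.
  apply: (@le_lt_trans _ _ (K * (1 + K)^-1)); first by apply: ler_wpM2l.
  by rewrite ltr_pdivrMr// mul1r ltrDr.
Qed.

Notation Yk eps k := (Yk_eps a Z s Y (Yeps eps) eps k).

Lemma Yk_epsS eps k t : Yk eps k.+1 t = eps^-1 *: (Yk eps k t - Y k t) - osc_at eps k t.
Proof. by []. Qed.

Lemma Yk_epsE eps k t : 0 < eps ->
  Yk eps k t = eps ^- k *: (Yeps eps t - ansatz eps k t).
Proof.
move=> e0; elim: k => [|k IH].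
  by rewrite expr0 invr1 scale1r /ansatz big_ord0 subr0.
rewrite Yk_epsS IH /ansatz big_ord_recr /= -/(ansatz eps k t).
have aux (c e : R) (u v y B : V) : c != 0 -> e != 0 ->
    e^-1 *: (c^-1 *: (u - v) - y) - B = (c * e)^-1 *: (u - (v + c *: (y + e *: B))).
  by move=> c0 e1; apply/rowP => i; rewrite !mxE; field; rewrite c0 e1.
by rewrite exprSr; apply: aux; rewrite ?expf_neq0// gt_eqF.
Qed.

Lemma Yk_eps_small_bounded : exists2 eps0 : R, 0 < eps0 & exists2 K : R, 0 <= K &
  forall k eps t, (k <= m.+1)%N -> 0 < eps <= eps0 -> s <= t <= s + T -> `|Yk eps k t| <= K.
Proof.
have [K [eps0 [K0 /andP[e00 e01] HK]]] := ansatz_error.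
have [C1 C10 HC1] := profiles_bounded; have [C2 C20 HC2] := tosc_bounded.
exists eps0 => //; exists (K + m.+1%:R * (C1 + C2)) => [|k eps t km e ts].
  by rewrite addr_ge0// mulr_ge0// addr_ge0.
(* The descent starts at index m + 1, where the corrected difference is the error of the ansatz
   divided by eps^(m+1). As eps is at most 1, each step down adds at most one profile and one
   oscillating part. *)
suff H i : (i <= m.+1)%N -> `|Yk eps (m.+1 - i) t| <= K + i%:R * (C1 + C2).
  rewrite -(subKn km); apply: le_trans (H _ (leq_subr _ _)) _.
  rewrite lerD2l; apply: ler_wpM2r; first exact: addr_ge0.
  by rewrite ler_nat leq_subr.
have /andP[e0 ee] := e; have e1 := le_trans ee e01.
elim: i => [_|i IH im].
  rewrite subn0 mul0r addr0 Yk_epsE// normrZ ger0_norm ?invr_ge0 ?exprn_ge0 ?(ltW e0)//.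
  by rewrite ler_pdivrMl ?exprn_gt0// mulrC; exact: HK.
have mi : (m.+1 - i = (m.+1 - i.+1).+1)%N by rewrite subnSK.
have {}IH := IH (ltnW im); move: IH; rewrite mi; set j := (m.+1 - i.+1)%N.
have jm : (j <= m)%N by rewrite /j subSS leq_subr.
move=> IH.
have -> : Yk eps j t = Y j t + eps *: (Yk eps j.+1 t + osc_at eps j t).
  by rewrite Yk_epsS subrK scalerA divff ?gt_eqF// scale1r addrC subrK.
apply: le_trans (ler_normD _ _) _; rewrite normrZ ger0_norm ?(ltW e0)//.
have : eps * `|Yk eps j.+1 t + osc_at eps j t| <= `|Yk eps j.+1 t + osc_at eps j t|
  by rewrite ler_piMl.
have := ler_normD (Yk eps j.+1 t) (osc_at eps j t).
have := HC1 j t ts; have := HC2 j t ((t - s) / eps) jm ts.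
rewrite -[tosc _ _ _ _]/(osc_at eps j t) -natr1 mulrDl mul1r.
move: IH; lra.
Qed.

Lemma Yk_eps_bounded : exists2 K : R, 0 <= K &
  forall k eps t, (k <= m)%N -> 0 < eps -> s <= t <= s + T -> `|Yk eps k t| <= K.
Proof.
have [eps0 e00 [K K0 HK]] := Yk_eps_small_bounded.
have [C1 C10 HC1] := profiles_bounded; have [C2 C20 HC2] := tosc_bounded.
have [M HM] := f_bound.
have M0 : 0 <= M by apply: le_trans (HM 0 0 0).
(* Away from eps = 0 the definition is unrolled upwards, each division by eps costing at most
   [eps0^-1]. *)
have large k : (k <= m)%N -> exists2 K' : R, 0 <= K' &
    forall eps t, eps0 <= eps -> s <= t <= s + T -> `|Yk eps k t| <= K'.
  elim: k => [_|k IH km].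
    exists (`|x| + M * T) => [|eps t ee ts]; first by rewrite addr_ge0// mulr_ge0// ltW.
    have e0 : 0 < eps by exact: lt_le_trans ee.
    have /andP[st tT] := ts.
    rewrite /= -[Yeps eps t](subrK x) addrC; apply: le_trans (ler_normD _ _) _.
    rewrite lerD2l -(Yeps_init e0).
    apply: le_trans (@mean_value R V (Yeps eps) (fun r =>
      f r ((r - s) / eps) (Yeps eps r)) s t M _ _ _ M0 st) _.
    - by move=> r /andP[sr rt] e' e'0; have [|q q0 Hq] := Yeps_cont e0 (t := r) _ e'0;
        [rewrite sr (le_trans rt)|exists q => // z /andP[sz zt]; apply: Hq;
          rewrite sz (le_trans zt)].
    - by move=> r /andP[sr rt]; apply: Yeps_ode => //; rewrite sr (lt_le_trans rt).
    - by move=> r _; exact: HM.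
    - by apply: ler_wpM2l => //; rewrite lerBlDl.
  have [K' K'0 HK'] := IH (ltnW km).
  exists (eps0^-1 * (K' + C1) + C2) => [|eps t ee ts].
    by rewrite addr_ge0// mulr_ge0// ?addr_ge0// invr_ge0 ltW.
  have e0 : 0 < eps by exact: lt_le_trans ee.
  rewrite Yk_epsS; apply: le_trans (ler_normB _ _) _.
  apply: lerD; last exact: (HC2 k t _ (ltnW km) ts).
  rewrite normrZ ger0_norm ?invr_ge0 ?(ltW e0)//; apply: ler_pM => //.
  - by rewrite invr_ge0 ltW.
  - by rewrite lef_pV2.
  - by apply: le_trans (ler_normB _ _) _; apply: lerD; [exact: HK'|exact: HC1].
have large' (k : 'I_m.+1) : exists K' : R, 0 <= K' /\
    forall eps t, eps0 <= eps -> s <= t <= s + T -> `|Yk eps k t| <= K'.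
  by have [|K' K'0 HK'] := large k; [rewrite -ltnS|exists K'].
have [K' HK'] := choice large'.
have S0 : 0 <= \sum_k K' k by apply: sumr_ge0 => k _; case: (HK' k).
exists (K + \sum_k K' k) => [|k eps t km e0 ts]; first exact: addr_ge0.
have [ee|ee] := leP eps eps0.
  by apply: le_trans (HK k eps t (leqW km) _ ts) _; rewrite ?e0// lerDl.
have kk : (k < m.+1)%N by [].
have [_ Hk] := HK' (Ordinal kk); apply: le_trans (Hk eps t (ltW ee) ts) _.
rewrite (bigD1 (Ordinal kk))//= addrCA lerDl addr_ge0//.
by apply: sumr_ge0 => i _; case: (HK' i).
Qed.

Lemma Yk_eps_cvg : exists2 eps0 : R, 0 < eps0 & exists2 K : R, 0 <= K &
  forall k eps t, (k <= m)%N -> 0 < eps <= eps0 -> s <= t <= s + T ->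
    `|Yk eps k t - Y k t| <= K * eps.
Proof.
have [eps0 e00 [K K0 HK]] := Yk_eps_small_bounded.
have [C2 C20 HC2] := tosc_bounded.
exists eps0 => //; exists (K + C2) => [|k eps t km e ts]; first exact: addr_ge0.
have /andP[e0 _] := e.
have -> : Yk eps k t - Y k t = eps *: (Yk eps k.+1 t + osc_at eps k t).
  by rewrite Yk_epsS subrK scalerA divff ?gt_eqF// scale1r.
rewrite normrZ ger0_norm ?(ltW e0)// mulrC; apply: ler_wpM2r; first exact: ltW.
by apply: le_trans (ler_normD _ _) _; apply: lerD; [exact: HK|exact: HC2].
Qed.

Lemma Yk_eps_cont eps k : (k <= m)%N -> 0 < eps -> cont_on s (s + T) (Yk eps k).
Proof.
move=> + e0; elim: k => [_|k IH km]; first exact: Yeps_cont.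
have {}IH := IH (ltnW km).
have opp (u : R -> V) : cont_on s (s + T) u -> cont_on s (s + T) (fun t => - u t).
  move=> cu; under eq_fun do rewrite -scaleN1r; exact: cont_on_scale.
apply: (@cont_on_add R V s (s + T) (fun t => eps^-1 *: (Yk eps k t - Y k t)) (fun t =>
  - osc_at eps k t)).
  by apply: cont_on_scale; apply: cont_on_add => //; apply: opp.
by apply: opp; apply: osc_at_cont; exact: ltnW.
Qed.

End Asymptotics.

(** * Transfer of the estimates to the given solutions *)

Theorem theorem1p2 (R : realType) (d m : nat)
  (a : R -> R -> 'rV[R]_d -> 'rV[R]_d) (b : R -> 'rV[R]_d -> 'rV[R]_d)
  (Z : R -> R -> 'rV[R]_d -> 'rV[R]_d)
  (d_ge1 : (1 <= d)%N)
  (a_Cb : forall i, Cb (coord_dirs_tthx d) m.+1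
            (fun p : R * R * 'rV[R]_d => a p.1.1 p.1.2 p.2 0 i))
  (a_per : forall (t th : R) x, a t (th + 2 * pi) x = a t th x)
  (b_Cb : forall i, Cb (coord_dirs_tx d) m.+2
            (fun p : R * 'rV[R]_d => b p.1 p.2 0 i))
  (Z_ode : forall t (th : R) z,
            is_derive th 1 (fun th' => Z t th' z) (b t (Z t th z)))
  (Z_init : forall t z, Z t 0 z = z)
  (Z_per : forall (t th : R) z, Z t (th + 2 * pi) z = Z t th z)
  (x : 'rV[R]_d) (s T : R) (T_gt0 : 0 < T)
  (Yeps : R -> R -> 'rV[R]_d) (Y : nat -> R -> 'rV[R]_d)
  (Yeps_sol : forall eps : R, 0 < eps ->
     solves_on s T x (Yeps eps)
       (fun t => alpha0 a Z t ((t - s) / eps) (Yeps eps t)))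
  (Y0_sol : solves_on s T x (Y 0%N)
       (fun t => at_ a Z 0 t (fun j => Y j t)))
  (Yk_sol : forall k, (1 <= k <= m)%N ->
     solves_on s T 0 (Y k) (fun t => at_ a Z k t (fun j => Y j t))) :
  let Yk eps k t := Yk_eps a Z s Y (Yeps eps) eps k t in
  [/\ forall k, (k <= m)%N ->
        bounded_Linfty `[s, s + T] (fun eps => Yk eps k),
      cvg_unif_eps `[s, s + T] Yeps (Y 0%N) &
      forall k, (1 <= k <= m)%N ->
        cvg_unif_eps `[s, s + T] (fun eps => Yk eps k) (Y k)].
Proof.
move=> Yk.
have f_Cn : Cn m.+1 (fun p : R * (R * 'rV[R]_d) => alpha0 a Z p.1 p.2.1 p.2.2).
  exact: (alpha0F_Cn a_Cb b_Cb Z_ode Z_init).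
have f_per := alpha0_per a_per Z_per.
have f_bound := alpha0_bounded a_Cb a_per b_Cb Z_ode Z_init Z_per.
(* Only Y^0, ..., Y^m are constrained by the hypotheses. *)
pose Y' j := if (j <= m)%N then Y j else fun=> 0.
have YE j : (j <= m)%N -> Y' j = Y j by rewrite /Y' => ->.
have Y_sol j : (j <= m)%N -> solves_on s T (if j is 0%N then x else 0) (Y j)
    (fun t => mean (alphat a Z j) t (fun i => Y i t)).
  by case: j => [|j] jm; [exact: Y0_sol|exact: (Yk_sol j.+1)].
have Y'_vanish j r : (m < j)%N -> Y' j r = 0 by rewrite /Y' ltnNge => /negbTE ->.
have Y'_cont j : cont_on s (s + T) (Y' j).
  have [jm|jm] := leqP j m; first by rewrite YE//; apply/cont_onP; case: (Y_sol j jm).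
  have -> : Y' j = fun=> 0 by apply/funext => r; exact: Y'_vanish.
  by apply: cont_on_continuous => t; exact: cvg_cst.
have Y'_init j : Y' j s = if j is 0%N then x else 0.
  have [jm|jm] := leqP j m; first by rewrite YE//; case: (Y_sol j jm).
  by rewrite Y'_vanish//; case: j jm.
have Y'_ode j : (j <= m)%N -> forall t : R, s < t < s + T ->
    is_derive t 1 (Y' j) (mean (alphat a Z j) t (fun i => Y' i t)).
  move=> jm t ts; rewrite YE//; have [_ _ /(_ t)] := Y_sol j jm.
  (* By locality the mean of index j sees only Y^0, ..., Y^j, on which [Y] and [Y'] agree. *)
  rewrite in_itv /= ts => /(_ isT); rewrite (@mean_local _ _ a Z j t _ (fun i => Y' i t))//.
  by move=> i ij; rewrite YE// (leq_trans ij).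
have Yeps_init eps : 0 < eps -> Yeps eps s = x by move=> e0; case: (Yeps_sol eps e0).
have Yeps_cont eps : 0 < eps -> cont_on s (s + T) (Yeps eps).
  by move=> e0; apply/cont_onP; case: (Yeps_sol eps e0).
have Yeps_ode eps : 0 < eps -> forall t : R, s < t < s + T ->
    is_derive t 1 (Yeps eps) (alpha0 a Z t ((t - s) / eps) (Yeps eps t)).
  by move=> e0 t ts; case: (Yeps_sol eps e0) => _ _; apply; rewrite in_itv.
have YkE eps k t : (k <= m)%N -> Yk eps k t = Yk_eps a Z s Y' (Yeps eps) eps k t.
  rewrite /Yk; elim: k t => [//|k IH] t km.
  have -> : Yk_eps a Z s Y (Yeps eps) eps k.+1 t =
    eps^-1 *: (Yk_eps a Z s Y (Yeps eps) eps k t - Y k t) - tosc (alphat a Z k) t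
      ((t - s) / eps) (fun j => Y j t) by [].
  rewrite (IH t (ltnW km)) -(YE k (ltnW km)) (@tosc_local _ _ a Z k t _ _ (fun i =>
    Y' i t))//.
  by move=> i ik; rewrite YE// (leq_trans ik)// ltnW.
have [K K0 HK] := Yk_eps_bounded f_Cn f_per T_gt0 Y'_vanish Y'_cont Y'_init Y'_ode
  f_bound Yeps_init Yeps_cont Yeps_ode.
have [eps0 e00 [K' K'0 HK']] :=
  Yk_eps_cvg f_Cn f_per T_gt0 Y'_vanish Y'_cont Y'_init Y'_ode Yeps_init Yeps_cont Yeps_ode.
have cvg k : (k <= m)%N -> cvg_unif_eps `[s, s + T] (fun eps => Yk eps k) (Y k).
  move=> km; apply: (@cvg_unif_eps_linear _ _ _ _ _ K' eps0) => //.
    by exists s; rewrite /= in_itv /= lexx lerDl ltW.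
  move=> eps t e; rewrite /= in_itv /= => ts; rewrite YkE// -(YE k km).
  exact: HK'.
split=> [k km||k /andP[_ km]]; last exact: cvg.
- apply: (@bounded_Linfty_cont _ _ _ _ _ K) => // [eps e0|eps t e0 ts].
    have -> : Yk eps k = Yk_eps a Z s Y' (Yeps eps) eps k by apply/funext => t; exact: YkE.
    exact: (Yk_eps_cont f_Cn f_per Y'_vanish Y'_cont Yeps_cont).
  by rewrite YkE//; exact: HK.
- exact: (cvg 0%N).
Qed.
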